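(* For every real $a>1$, $$\sum_{n=0}^{\infty}\frac{e^{-a^{n}}}{\sinh(a^{n})}=-\frac{\ln\pi}{\ln a}-\frac12+\frac{a}{a-1}+\frac{\gamma}{\ln a}+\sum_{k=1}^{\infty}\left(a^{k}-\coth(a^{-k})\right)+\frac{4}{\ln a}\,\Re\left(\sum_{k=1}^{\infty}\zeta\left(\frac{2i\pi k}{\ln a}\right)\Gamma\left(\frac{2i\pi k}{\ln a}\right)2^{-\frac{2i\pi k}{\ln a}}\right).$$
   Context: $\gamma$ is the Euler–Mascheroni constant, $\zeta$ is the Riemann zeta function (analytically continued), $\Gamma$ is the Gamma function, and $\Re$ denotes the real part. *)

(* Defs.v *)
From Stdlib Require Import Reals.
From Coquelicot Require Import Coquelicot.

Open Scope R_scope.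

Definition coth (x : R) : R := cosh x / sinh x.

(* The limit of H_{n+1} - ln (n+1). *)
Definition euler_gamma : R :=
  real (Lim_seq (fun n => sum_f_R0 (fun k => / INR (S k)) n - ln (INR (S n)))).

Definition Cexp (z : C) : C :=
  (exp (Re z) * cos (Im z), exp (Re z) * sin (Im z)).

(* x^s = exp (s ln x) with the real logarithm; meaningful for x > 0 only. *)
Definition cpower (x : R) (s : C) : C := Cexp (s * RtoC (ln x))%C.

(* Euler's integral; it converges, and is the Gamma function, for Re s > 0. *)
Definition Gamma_integral (s : C) : C :=
  @RInt_gen C_R_CompleteNormedModule
    (fun t : R => (cpower t (s - 1) * RtoC (exp (- t)))%C)
    (at_right 0) (Rbar_locally p_infty).

Fixpoint rising (s : C) (n : nat) : C :=
  match n with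
  | O => RtoC 1
  | S m => (rising s m * (s + RtoC (INR m)))%C
  end.

(* Number of unit steps that bring s into the half-plane Re > 0:
   it is 0 if Re s > 0, and otherwise the least n with Re s + n > 0. *)
Definition Gamma_shift (s : C) : nat := Z.to_nat (up (- Re s)).

(* The Gamma function on C minus {0, -1, -2, ...}: Euler's integral, continued
   by the functional equation Gamma (s + 1) = s Gamma s.  The values at the
   poles are junk. *)
Definition Gamma (s : C) : C :=
  (Gamma_integral (s + RtoC (INR (Gamma_shift s))) / rising s (Gamma_shift s))%C.

Definition analytic_at (f : C -> C) (z0 : C) : Prop :=
  exists (c : nat -> C) (r : R), 0 < r /\
    forall z : C, Cmod (z - z0)%C < r ->
      @is_pseries C_AbsRing C_NormedModule c (z - z0)%C (f z).

(* f is the analytic continuation to C \ {1} of the Dirichlet series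
   sum_{n >= 1} n^(-s), Re s > 1.  By the identity theorem this determines f
   everywhere except for its irrelevant value at the pole 1. *)
Definition is_Riemann_zeta (f : C -> C) : Prop :=
  (forall s : C, s <> RtoC 1 -> analytic_at f s) /\
  (forall s : C, 1 < Re s ->
     @is_series C_AbsRing C_NormedModule
       (fun n : nat => cpower (INR (S n)) (- s)%C) (f s)).

(* Main.v *)
Require Import Defs.
From Stdlib Require Import Reals.
From Coquelicot Require Import Coquelicot.
From Stdlib Require Import Lra Lia Factorial.

Open Scope R_scope.

(** Write [L = ln a].  Each term of the left series is [coth x - 1] with
    [x = a^n], and each term of the series of [a^k - coth (a^-k)] is the opposite of
    [coth x - 1 / x] with [x = a^-k].  Replacing [x] by [x * a^t] gives the function

      [Q t = sum_(j >= 0) (coth (a^(t+j)) - 1)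
             + sum_(k >= 1) (coth (a^(t-k)) - a^(k-t)) - t - a / (a - 1) * a^(-t)]

    ([periodic_sum]), in which the last two terms make the sum 1-periodic.  The
    theorem is the Fourier expansion of [Q] at [t = 0]: the value [Q 0] is the
    difference of the two real series and of [a / (a - 1)], the mean of [Q] is
    [(gamma - ln PI) / L - 1/2], and the Fourier coefficient of index [- k],
    times [L / 2], is [zeta s * Gamma s * 2^(-s)] with [s = 2 i PI k / L].

    Convergence ([fourier_series_at_0]).  As [Q] is differentiable,
    [Q t - Q 0 = h t * sin (PI t)] with [h] continuous, and the partial sums of the
    cosine and sine series at [0] are, up to constants, integrals of [h] against
    [sin ((2 n + 1) PI t)] and [cos ((2 n + 1) PI t)]; these tend to [0] by Bessel's
    inequality.  The two series are the real and imaginary parts of the theorem's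
    complex series.

    Mean value ([RInt_periodic_sum]).  Unfolding, it is a limit of integrals of
    [(coth x - 1 / x) / x].  The same Fourier theorem, for
    [cosh (x (2 t - 1))], yields the partial fractions of [coth]; integrated, they
    give [sum (2 / (PI n)) atan (x / (PI n))], which is a harmonic sum cut off
    around [n = x / PI] and so behaves like [ln (x / PI) + gamma]
    ([coth_primitive_asymptotics]).

    Fourier coefficients ([zeta_Gamma_term_fourier]).  With [f = coth (exp u)], the
    function [f'' + f'] ([regular_weight], up to sign) forgets the singular parts
    [1] and [exp (- u)].  Two integrations by parts and unfolding turn [s (s - 1)]
    times a coefficient into a multiple of the transform [N s] of [regular_weight]
    ([RInt_periodic_sum_trig]).  On the other side, expanding [1 / sinh^2] in
    exponentials gives [2 (s - 1) zeta s Gamma (s + 1) 2^(-s) = - N s] for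
    [3 <= Re s < 4].  Both sides are analytic along horizontal lines
    ([laplace_ranalytic], [analytic_at_horizontal]), and the identity theorem on a
    real segment ([ranalytic_identity]) carries the equation to the imaginary axis
    ([zeta_mellin]), where one step of the functional equation relates Euler's
    integral to [Gamma]. *)

(** * Integrals of continuous real functions *)

Lemma continuous_Rplus (f g : R -> R) (x : R) :
  continuous f x -> continuous g x -> continuous (fun y => f y + g y) x.
Proof. intros hf hg; exact (continuous_plus f g x hf hg). Qed.

Lemma continuous_Rminus (f g : R -> R) (x : R) :
  continuous f x -> continuous g x -> continuous (fun y => f y - g y) x.
Proof. intros hf hg; exact (continuous_minus f g x hf hg). Qed.

Lemma continuous_Rmult (f g : R -> R) (x : R) :
  continuous f x -> continuous g x -> continuous (fun y => f y * g y) x.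
Proof. intros hf hg; exact (continuous_mult f g x hf hg). Qed.

Lemma continuous_Rabs_comp (f : R -> R) (x : R) :
  continuous f x -> continuous (fun y => Rabs (f y)) x.
Proof. intros hf; exact (continuous_comp f Rabs x hf (continuous_Rabs (f x))). Qed.

(* Integrals are typed in the carrier of a module, where [ring] and [field]
   do not see the real numbers. *)
Ltac toR := match goal with |- @eq _ ?x ?y => change (@eq R x y) end.

(* Continuity of expressions built by the field operations from explicit
   differentiable functions and from functions known to be continuous. *)
Ltac cont :=
  match goal with
  | h : forall x, continuous ?f x |- continuous ?f _ => apply h
  | h : forall n x, continuous (?f n) x |- continuous (?f _) _ => apply h
  | h : forall n x, continuous (?f n) x |- continuous (fun y => ?f _ y) _ => apply h
  | h : forall n x, _ -> continuous (?f n) x |- continuous (?f _) _ => apply h; lra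
  | h : forall n x, _ -> continuous (?f n) x |- continuous (fun y => ?f _ y) _ => apply h; lra
  | h : forall x, continuous ?f x |- continuous (fun y => ?f y) _ => apply h
  | h : forall x, _ -> continuous ?f x |- continuous ?f _ => apply h; lra
  | h : forall x, _ -> continuous ?f x |- continuous (fun y => ?f y) _ => apply h; lra
  | |- continuous (fun _ => ?c) _ => apply continuous_const
  | |- continuous (fun y => y) _ => apply continuous_id
  | |- continuous _ _ => solve [apply @ex_derive_continuous; auto_derive; auto]
  | |- continuous (fun y => _ + _) _ => apply continuous_Rplus; cont
  | |- continuous (fun y => _ - _) _ => apply continuous_Rminus; cont
  | |- continuous (fun y => _ * _) _ => apply continuous_Rmult; cont
  | |- continuous (fun y => Rabs _) _ => apply continuous_Rabs_comp; cont
  end.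

Lemma ex_RInt_segment (f : R -> R) (a b : R) :
  a <= b -> (forall x, a <= x <= b -> continuous f x) -> ex_RInt f a b.
Proof.
  intros hab hf; apply (@ex_RInt_continuous R_CompleteNormedModule).
  rewrite Rmin_left, Rmax_right by lra; exact hf.
Qed.

Lemma ex_RInt_cont (f : R -> R) (a b : R) :
  (forall x, continuous f x) -> ex_RInt f a b.
Proof. intros hf; apply (@ex_RInt_continuous R_CompleteNormedModule); auto. Qed.

Lemma RInt_Rplus (f g : R -> R) (a b : R) :
  ex_RInt f a b -> ex_RInt g a b ->
  RInt (fun x => f x + g x) a b = RInt f a b + RInt g a b.
Proof. exact (RInt_plus f g a b). Qed.

Lemma RInt_Rminus (f g : R -> R) (a b : R) :
  ex_RInt f a b -> ex_RInt g a b ->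
  RInt (fun x => f x - g x) a b = RInt f a b - RInt g a b.
Proof. exact (RInt_minus f g a b). Qed.

Lemma RInt_Rscal (k : R) (f : R -> R) (a b : R) :
  ex_RInt f a b -> RInt (fun x => k * f x) a b = k * RInt f a b.
Proof. exact (RInt_scal f a b k). Qed.

Lemma RInt_Rext (f g : R -> R) (a b : R) :
  a <= b -> (forall x, a < x < b -> f x = g x) -> RInt f a b = RInt g a b.
Proof.
  intros hab h; apply RInt_ext; rewrite Rmin_left, Rmax_right by lra; exact h.
Qed.

Lemma RInt_eq (f g : R -> R) (a b : R) :
  (forall x, f x = g x) -> RInt f a b = RInt g a b.
Proof. intros h; apply RInt_ext; intros; apply h. Qed.

Lemma RInt_primitive (F f : R -> R) (a b : R) :
  (forall x, is_derive F x (f x)) -> (forall x, continuous f x) ->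
  RInt f a b = F b - F a.
Proof.
  intros hF hf; apply is_RInt_unique.
  apply (is_RInt_derive F f a b); auto.
Qed.

Lemma sum_SnR (f : nat -> R) (n : nat) : sum_n f (S n) = sum_n f n + f (S n) :> R.
Proof. exact (sum_Sn f n). Qed.

Lemma is_series_telescope (r : nat -> R) (l : R) :
  is_lim_seq r l -> is_series (fun n => r (S n) - r n) (l - r 0%nat).
Proof.
  intros hr; change (is_lim_seq (sum_n (fun n => r (S n) - r n)) (l - r 0%nat)).
  apply is_lim_seq_ext with (fun n => r (S n) - r 0%nat).
  { induction n as [|n IH]; [now rewrite sum_O|rewrite sum_SnR, <- IH; ring]. }
  apply is_lim_seq_minus'; [apply -> is_lim_seq_incr_1; exact hr|apply is_lim_seq_const].
Qed.

(** * Fourier series at a point of differentiability *)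

(** The projections on the members of the family are subtracted one after the
    other: Bessel's inequality is then an induction on the squared norm. *)
Fixpoint bessel_rest (e : nat -> R -> R) (h : R -> R) (n : nat) (t : R) : R :=
  match n with
  | O => h t
  | S m => bessel_rest e h m t - 2 * RInt (fun x => h x * e m x) 0 1 * e m t
  end.

(** The squared norm of the remainder is nonnegative and drops by
    [2 * (coefficient)^2] at each step, so the coefficients tend to [0]. *)
Lemma bessel_tendsto_0 (e : nat -> R -> R) (h : R -> R) :
  (forall n t, continuous (e n) t) ->
  (forall n m, RInt (fun t => e n t * e m t) 0 1 = if Nat.eqb n m then 1 / 2 else 0) ->
  (forall t, 0 <= t <= 1 -> continuous h t) ->
  is_lim_seq (fun n => RInt (fun t => h t * e n t) 0 1) 0.
Proof.
  intros ce orth ch.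
  set (b := (fun n => RInt (fun t => h t * e n t) 0 1) : nat -> R).
  set (r := bessel_rest e h).
  assert (cr : forall n t, 0 <= t <= 1 -> continuous (r n) t).
  { induction n as [|n IH]; intros t ht; simpl.
    - apply ch; auto.
    - apply continuous_Rminus; [apply IH; auto|].
      apply continuous_Rmult; [apply continuous_const|apply ce]. }
  assert (ex : forall f : R -> R, (forall t, 0 <= t <= 1 -> continuous f t) -> ex_RInt f 0 1).
  { intros f hf; apply ex_RInt_segment; [lra|auto]. }
  assert (proj : forall n m, (n <= m)%nat -> RInt (fun t => r n t * e m t) 0 1 = b m).
  { induction n as [|n IH]; intros m hm; [reflexivity|].
    rewrite (RInt_eq _ (fun t => r n t * e m t - 2 * b n * (e n t * e m t))).
    2:{ intros t; change (r (S n) t) with (r n t - 2 * b n * e n t); ring. }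
    rewrite RInt_Rminus, RInt_Rscal, IH, orth by
      (try lia; apply ex; intros; cont).
    destruct (Nat.eqb_spec n m); [lia|toR; ring]. }
  set (E := (fun n => RInt (fun t => r n t * r n t) 0 1) : nat -> R).
  assert (Estep : forall n, E (S n) = E n - 2 * (b n * b n)).
  { intros n; unfold E.
    rewrite (RInt_eq _ (fun t => r n t * r n t
              - (4 * b n * (r n t * e n t) - 4 * b n * b n * (e n t * e n t)))).
    2:{ intros t; change (r (S n) t) with (r n t - 2 * b n * e n t); ring. }
    rewrite RInt_Rminus, RInt_Rminus, !RInt_Rscal, proj, orth, Nat.eqb_refl by
      (try lia; apply ex; intros; cont).
    toR; field. }
  assert (Epos : forall n, 0 <= E n).
  { intros n; apply RInt_ge_0; [lra| |].
    - apply ex; intros; apply continuous_Rmult; auto.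
    - intros; nra. }
  assert (Elim : ex_finite_lim_seq E).
  { apply ex_finite_lim_seq_decr with 0; [|apply Epos].
    intros n; rewrite Estep; nra. }
  destruct Elim as [l hl].
  assert (h2 : is_lim_seq (fun n => Rsqr (b n)) 0).
  { apply is_lim_seq_ext with (fun n => / 2 * (E n - E (S n))).
    { intros n; rewrite Estep; unfold Rsqr; field. }
    replace (Finite 0) with (Rbar_mult (/ 2) (l - l)) by (simpl; f_equal; ring).
    apply is_lim_seq_scal_l, is_lim_seq_minus'; [exact hl|].
    apply -> is_lim_seq_incr_1; exact hl. }
  apply is_lim_seq_abs_0.
  apply is_lim_seq_ext with (fun n => sqrt (Rsqr (b n))).
  { intros n; apply sqrt_Rsqr_abs. }
  rewrite <- sqrt_0.
  apply (is_lim_seq_continuous sqrt); [|exact h2].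
  apply continuity_pt_sqrt; lra.
Qed.

Lemma cos_2nat_PI (n : nat) : cos (INR n * (2 * PI)) = 1.
Proof.
  replace (INR n * (2 * PI)) with (0 + 2 * INR n * PI) by ring.
  rewrite cos_period; apply cos_0.
Qed.

Lemma sin_2nat_PI (n : nat) : sin (INR n * (2 * PI)) = 0.
Proof.
  replace (INR n * (2 * PI)) with (0 + 2 * INR n * PI) by ring.
  rewrite sin_period; apply sin_0.
Qed.

Lemma RInt_cos_period (n : nat) :
  RInt (fun t => cos (INR (S n) * (2 * PI) * t)) 0 1 = 0.
Proof.
  assert (hn := lt_0_INR (S n) (Nat.lt_0_succ n)); assert (hp := PI_RGT_0).
  set (w := INR (S n) * (2 * PI)).
  assert (hw : w <> 0) by (unfold w; apply Rgt_not_eq; nra).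
  rewrite (RInt_primitive (fun t => sin (w * t) / w)).
  - rewrite Rmult_1_r, Rmult_0_r, sin_0; unfold w at 1; rewrite sin_2nat_PI.
    toR; field; exact hw.
  - intros t; auto_derive; [auto|toR; field; exact hw].
  - intros t; cont.
Qed.

Lemma RInt_sin_period (n : nat) :
  RInt (fun t => sin (INR (S n) * (2 * PI) * t)) 0 1 = 0.
Proof.
  assert (hn := lt_0_INR (S n) (Nat.lt_0_succ n)); assert (hp := PI_RGT_0).
  set (w := INR (S n) * (2 * PI)).
  assert (hw : w <> 0) by (unfold w; apply Rgt_not_eq; nra).
  rewrite (RInt_primitive (fun t => - cos (w * t) / w)).
  - rewrite Rmult_1_r, Rmult_0_r, cos_0; unfold w at 1; rewrite cos_2nat_PI.
    toR; field; exact hw.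
  - intros t; auto_derive; [auto|toR; field; exact hw].
  - intros t; cont.
Qed.

Lemma RInt_const_01 (c : R) : RInt (fun _ => c) 0 1 = c.
Proof. rewrite RInt_const; unfold scal; simpl; unfold mult; simpl; ring. Qed.

(** The frequencies [(2 n + 1) PI] of the numerator of the Dirichlet kernel. *)
Definition half_freq (n : nat) : R := (2 * INR n + 1) * PI.

Lemma half_freq_sum (n m : nat) :
  half_freq n + half_freq m = INR (S (n + m)) * (2 * PI).
Proof. unfold half_freq; rewrite S_INR, plus_INR; ring. Qed.

Lemma half_freq_diff (n m : nat) : n <> m -> exists k, forall t,
  cos ((half_freq n - half_freq m) * t) = cos (INR (S k) * (2 * PI) * t).
Proof.
  intros hnm; destruct (Nat.lt_total n m) as [h|[h|h]]; [| lia |].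
  - exists (m - n - 1)%nat; intros t.
    replace (S (m - n - 1)) with (m - n)%nat by lia.
    rewrite minus_INR by lia; rewrite <- cos_neg; f_equal; unfold half_freq; ring.
  - exists (n - m - 1)%nat; intros t.
    replace (S (n - m - 1)) with (n - m)%nat by lia.
    rewrite minus_INR by lia; f_equal; unfold half_freq; ring.
Qed.

Lemma RInt_cos_half_freq_diff (n m : nat) :
  RInt (fun t => cos ((half_freq n - half_freq m) * t)) 0 1
  = if Nat.eqb n m then 1 else 0.
Proof.
  destruct (Nat.eqb_spec n m) as [->|h].
  - rewrite (RInt_eq _ (fun _ => 1)), RInt_const_01; [reflexivity|].
    intros t; rewrite Rminus_diag, Rmult_0_l; apply cos_0.
  - destruct (half_freq_diff n m h) as [k hk].
    rewrite (RInt_eq _ _ 0 1 hk); apply RInt_cos_period.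
Qed.

Lemma sin_half_freq_orthogonal (n m : nat) :
  RInt (fun t => sin (half_freq n * t) * sin (half_freq m * t)) 0 1
  = if Nat.eqb n m then 1 / 2 else 0.
Proof.
  rewrite (RInt_eq _ (fun t => / 2 * (cos ((half_freq n - half_freq m) * t)
                              - cos (INR (S (n + m)) * (2 * PI) * t)))).
  2:{ intros t; rewrite <- half_freq_sum.
      replace ((half_freq n - half_freq m) * t)
        with (half_freq n * t - half_freq m * t) by ring.
      replace ((half_freq n + half_freq m) * t)
        with (half_freq n * t + half_freq m * t) by ring.
      rewrite cos_minus, cos_plus; field. }
  rewrite RInt_Rscal, RInt_Rminus, RInt_cos_half_freq_diff, RInt_cos_period
    by (apply ex_RInt_cont; intros; cont).
  toR; destruct (Nat.eqb n m); field.
Qed.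

Lemma cos_half_freq_orthogonal (n m : nat) :
  RInt (fun t => cos (half_freq n * t) * cos (half_freq m * t)) 0 1
  = if Nat.eqb n m then 1 / 2 else 0.
Proof.
  rewrite (RInt_eq _ (fun t => / 2 * (cos ((half_freq n - half_freq m) * t)
                              + cos (INR (S (n + m)) * (2 * PI) * t)))).
  2:{ intros t; rewrite <- half_freq_sum.
      replace ((half_freq n - half_freq m) * t)
        with (half_freq n * t - half_freq m * t) by ring.
      replace ((half_freq n + half_freq m) * t)
        with (half_freq n * t + half_freq m * t) by ring.
      rewrite cos_minus, cos_plus; field. }
  rewrite RInt_Rscal, RInt_Rplus, RInt_cos_half_freq_diff, RInt_cos_period
    by (apply ex_RInt_cont; intros; cont).
  toR; destruct (Nat.eqb n m); field.
Qed.

Definition slope (f : R -> R) (x d t : R) : R :=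
  if Req_EM_T t x then d else (f t - f x) / (t - x).

Lemma slope_continuous (f : R -> R) (x d : R) :
  is_derive f x d -> continuous (slope f x d) x.
Proof.
  intros hd; apply continuity_pt_filterlim.
  apply is_derive_Reals in hd.
  intros eps heps; destruct (hd eps heps) as [delta hdelta].
  exists delta; split; [apply cond_pos|].
  intros t [[_ hne] ht]; simpl in *; unfold R_dist in *.
  unfold slope; destruct (Req_EM_T t x) as [e|ne]; [congruence|].
  destruct (Req_EM_T x x) as [_|n]; [|congruence].
  specialize (hdelta (t - x) ltac:(lra) ht).
  replace (x + (t - x)) with t in hdelta by ring; exact hdelta.
Qed.

Lemma sin_PI_neq_0 (t : R) : -1 < t < 2 -> t <> 0 -> t <> 1 -> sin (PI * t) <> 0.
Proof.
  intros ht h0 h1; assert (hp := PI_RGT_0).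
  destruct (Rlt_le_dec t 0); [apply Rlt_not_eq, sin_lt_0_var; nra|].
  destruct (Rlt_le_dec t 1); [apply Rgt_not_eq, sin_gt_0; nra|].
  apply Rlt_not_eq, sin_lt_0; nra.
Qed.

(** At the two zeros of the sine in the period, the quotient of the slopes of
    [f] and of the sine is a continuous completion, [f] being differentiable
    there. *)
Lemma sine_quotient (f : R -> R) (d0 d1 : R) :
  (forall t, 0 <= t <= 1 -> continuous f t) -> f 1 = f 0 ->
  is_derive f 0 d0 -> is_derive f 1 d1 ->
  exists h : R -> R, (forall t, 0 <= t <= 1 -> continuous h t) /\
    (forall t, 0 <= t <= 1 -> h t * sin (PI * t) = f t - f 0).
Proof.
  intros cf per hd0 hd1; assert (hp := PI_RGT_0).
  set (sn := fun t => sin (PI * t)).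
  assert (s0 : is_derive sn 0 PI).
  { unfold sn; auto_derive; auto; rewrite Rmult_0_r, cos_0; toR; ring. }
  assert (s1 : is_derive sn 1 (- PI)).
  { unfold sn; auto_derive; auto; rewrite Rmult_1_r, cos_PI; toR; ring. }
  assert (sn0 : sn 0 = 0) by (unfold sn; rewrite Rmult_0_r; apply sin_0).
  assert (sn1 : sn 1 = 0) by (unfold sn; rewrite Rmult_1_r; apply sin_PI).
  exists (fun t => if Req_EM_T t 0 then d0 / PI
               else if Req_EM_T t 1 then d1 / - PI else (f t - f 0) / sn t).
  split.
  2:{ intros t ht; fold (sn t); destruct (Req_EM_T t 0) as [->|n0].
      - rewrite sn0; toR; ring.
      - destruct (Req_EM_T t 1) as [->|n1]; [rewrite sn1, per; toR; ring|].
        toR; field; apply sin_PI_neq_0; auto; lra. }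
  intros t ht.
  destruct (Req_dec t 0) as [->|n0].
  { apply continuous_ext_loc with (fun t => slope f 0 d0 t * / slope sn 0 PI t).
    - exists (mkposreal 1 Rlt_0_1); intros y hy.
      unfold ball in hy; simpl in hy; unfold AbsRing_ball, abs, minus, plus, opp in hy.
      simpl in hy; apply Rabs_def2 in hy.
      unfold slope; destruct (Req_EM_T y 0) as [->|ny]; [reflexivity|].
      destruct (Req_EM_T y 1); [lra|]; rewrite sn0.
      toR; field; repeat split; try lra; apply sin_PI_neq_0; auto; lra.
    - apply continuous_Rmult; [apply slope_continuous; auto|].
      apply continuous_comp; [apply slope_continuous; auto|].
      apply continuous_Rinv; unfold slope; destruct (Req_EM_T 0 0); lra. }
  destruct (Req_dec t 1) as [->|n1].
  { apply continuous_ext_loc with (fun t => slope f 1 d1 t * / slope sn 1 (-PI) t).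
    - exists (mkposreal 1 Rlt_0_1); intros y hy.
      unfold ball in hy; simpl in hy; unfold AbsRing_ball, abs, minus, plus, opp in hy.
      simpl in hy; apply Rabs_def2 in hy.
      unfold slope; destruct (Req_EM_T y 0) as [->|ny]; [lra|].
      destruct (Req_EM_T y 1); [reflexivity|]; rewrite sn1, per.
      toR; field; repeat split; try lra; apply sin_PI_neq_0; auto; lra.
    - apply continuous_Rmult; [apply slope_continuous; auto|].
      apply continuous_comp; [apply slope_continuous; auto|].
      apply continuous_Rinv; unfold slope; destruct (Req_EM_T 1 1); lra. }
  apply continuous_ext_loc with (fun t => (f t - f 0) * / sn t).
  - assert (hm : 0 < Rmin t (1 - t)) by (apply Rmin_glb_lt; lra).
    exists (mkposreal _ hm); intros y hy.
    unfold ball in hy; simpl in hy; unfold AbsRing_ball, abs, minus, plus, opp in hy.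
    simpl in hy; apply Rabs_def2 in hy.
    assert (h1 := Rmin_l t (1 - t)); assert (h2 := Rmin_r t (1 - t)).
    destruct (Req_EM_T y 0); [lra|]; destruct (Req_EM_T y 1); [lra|reflexivity].
  - apply continuous_Rmult; [cont|].
    apply continuous_comp; [unfold sn; cont|].
    apply continuous_Rinv, sin_PI_neq_0; auto; lra.
Qed.

(** Riemann's localisation in its simplest form: with [h] the quotient of
    [f - f 0] by [sin (PI t)], consecutive integrals of [h] against
    [sin ((2 n + 1) PI t)] differ by twice a Fourier coefficient, so the series
    telescopes and Bessel's inequality gives its sum.  The sine series telescopes
    along [cos ((2 n + 1) PI t)]. *)
Lemma fourier_series_at_0 (f : R -> R) (d0 d1 : R) :
  (forall t, 0 <= t <= 1 -> continuous f t) -> f 1 = f 0 ->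
  is_derive f 0 d0 -> is_derive f 1 d1 ->
  is_series (fun n => 2 * RInt (fun t => f t * cos (INR (S n) * (2 * PI) * t)) 0 1)
            (f 0 - RInt f 0 1) /\
  ex_series (fun n => RInt (fun t => f t * sin (INR (S n) * (2 * PI) * t)) 0 1).
Proof.
  intros cf per hd0 hd1.
  destruct (sine_quotient f d0 d1 cf per hd0 hd1) as [h [ch hh]].
  set (r := (fun n => RInt (fun t => h t * sin (half_freq n * t)) 0 1) : nat -> R).
  set (q := (fun n => RInt (fun t => h t * cos (half_freq n * t)) 0 1) : nat -> R).
  assert (ex : forall g : R -> R, (forall t, 0 <= t <= 1 -> continuous g t) -> ex_RInt g 0 1).
  { intros g hg; apply ex_RInt_segment; [lra|auto]. }
  assert (hr : is_lim_seq r 0).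
  { apply (bessel_tendsto_0 (fun n t => sin (half_freq n * t))); auto.
    - intros; cont.
    - apply sin_half_freq_orthogonal. }
  assert (hq : is_lim_seq q 0).
  { apply (bessel_tendsto_0 (fun n t => cos (half_freq n * t))); auto.
    - intros; cont.
    - apply cos_half_freq_orthogonal. }
  assert (r0 : r 0%nat = RInt f 0 1 - f 0).
  { unfold r; rewrite (RInt_Rext _ (fun t => f t - f 0)); [|lra|].
    - rewrite RInt_Rminus, RInt_const_01; [reflexivity| |]; apply ex; intros; cont.
    - intros t ht; rewrite <- hh by lra; unfold half_freq; simpl INR.
      replace ((2 * 0 + 1) * PI * t) with (PI * t) by ring; reflexivity. }
  assert (hm : forall n t, INR (S n) * (2 * PI) * t
            = half_freq n * t + PI * t).
  { intros; unfold half_freq; rewrite S_INR; ring. }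
  assert (hp : forall n t, half_freq (S n) * t = (half_freq n * t + PI * t) + PI * t).
  { intros; unfold half_freq; rewrite S_INR; ring. }
  assert (rstep : forall n, r (S n) - r n
     = 2 * RInt (fun t => f t * cos (INR (S n) * (2 * PI) * t)) 0 1).
  { intros n; unfold r.
    rewrite <- RInt_Rminus by (apply ex; intros; cont).
    rewrite (RInt_Rext _ (fun t => 2 * (f t * cos (INR (S n) * (2 * PI) * t))
                     - 2 * f 0 * cos (INR (S n) * (2 * PI) * t))); [|lra|].
    - rewrite RInt_Rminus, !RInt_Rscal, RInt_cos_period;
        [toR; ring| | | |]; apply ex; intros; cont.
    - intros t ht.
      replace (2 * (f t * cos (INR (S n) * (2 * PI) * t))
         - 2 * f 0 * cos (INR (S n) * (2 * PI) * t))
        with (2 * (f t - f 0) * cos (INR (S n) * (2 * PI) * t)) by ring.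
      rewrite <- hh, hm, hp by lra.
      replace (half_freq n * t) with ((half_freq n * t + PI * t) - PI * t) at 2 by ring.
      rewrite (sin_plus (half_freq n * t + PI * t)), (sin_minus (half_freq n * t + PI * t)).
      toR; ring. }
  assert (qstep : forall n, - / 2 * (q (S n) - q n)
     = RInt (fun t => f t * sin (INR (S n) * (2 * PI) * t)) 0 1).
  { intros n; unfold q.
    rewrite <- RInt_Rminus, <- RInt_Rscal by (apply ex; intros; cont).
    rewrite (RInt_Rext _ (fun t => (f t * sin (INR (S n) * (2 * PI) * t))
                     - f 0 * sin (INR (S n) * (2 * PI) * t))); [|lra|].
    - rewrite RInt_Rminus, RInt_Rscal, RInt_sin_period;
        [toR; ring| | |]; apply ex; intros; cont.
    - intros t ht.
      replace (f t * sin (INR (S n) * (2 * PI) * t)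
         - f 0 * sin (INR (S n) * (2 * PI) * t))
        with ((f t - f 0) * sin (INR (S n) * (2 * PI) * t)) by ring.
      rewrite <- hh, hm, hp by lra.
      replace (half_freq n * t) with ((half_freq n * t + PI * t) - PI * t) at 2 by ring.
      rewrite (cos_plus (half_freq n * t + PI * t)), (cos_minus (half_freq n * t + PI * t)).
      toR; field. }
  split.
  - apply is_series_ext with (fun n => r (S n) - r n); [exact rstep|].
    replace (f 0 - RInt f 0 1) with (0 - r 0%nat) by (rewrite r0; ring).
    apply is_series_telescope, hr.
  - exists (- / 2 * (0 - q 0%nat)).
    apply is_series_ext with (fun n => - / 2 * (q (S n) - q n)); [exact qstep|].
    apply (is_series_scal (- / 2) (fun n => q (S n) - q n)), is_series_telescope, hq.
Qed.

(** * Hyperbolic functions *)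

Lemma is_derive_sinh (x : R) : is_derive sinh x (cosh x).
Proof. apply is_derive_Reals, derivable_pt_lim_sinh. Qed.

Lemma is_derive_cosh (x : R) : is_derive cosh x (sinh x).
Proof. apply is_derive_Reals, derivable_pt_lim_cosh. Qed.

Lemma mean_value (f df : R -> R) (a b : R) :
  a <= b -> (forall x, a <= x <= b -> is_derive f x (df x)) ->
  exists c, a <= c <= b /\ f b - f a = df c * (b - a).
Proof.
  intros hab hf.
  assert (h := MVT_gen f a b df); cbv zeta in h.
  rewrite Rmin_left, Rmax_right in h by lra; apply h.
  - intros x hx; apply hf; lra.
  - intros x hx; apply continuity_pt_filterlim, (ex_derive_continuous f).
    exists (df x); apply hf; exact hx.
Qed.

Lemma derive_nonneg_le (f df : R -> R) (a b : R) :
  a <= b -> (forall x, a <= x <= b -> is_derive f x (df x)) ->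
  (forall x, a <= x <= b -> 0 <= df x) -> f a <= f b.
Proof.
  intros hab hf hp; destruct (mean_value f df a b hab hf) as [c [hc e]].
  specialize (hp c hc); nra.
Qed.

Lemma cosh_ge_1 (x : R) : 1 <= cosh x.
Proof. unfold cosh; assert (h := exp_ineq1_le x); assert (h' := exp_ineq1_le (-x)); lra. Qed.

Lemma sinh_ge (x : R) : 0 <= x -> x <= sinh x.
Proof.
  intros hx.
  assert (h : sinh 0 - 0 <= sinh x - x).
  { apply (derive_nonneg_le (fun y => sinh y - y) (fun y => cosh y - 1)); auto.
    - intros y _; apply (is_derive_minus sinh (fun y => y)); [apply is_derive_sinh|].
      apply (is_derive_id (K := R_AbsRing)).
    - intros y _; assert (h := cosh_ge_1 y); lra. }
  rewrite sinh_0 in h; lra.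
Qed.

Lemma sinh_pos (x : R) : 0 < x -> 0 < sinh x.
Proof. intros hx; assert (h := sinh_ge x); lra. Qed.

Lemma cosh_sqr (x : R) : cosh x * cosh x = 1 + sinh x * sinh x.
Proof.
  unfold cosh, sinh.
  assert (h : exp x * exp (- x) = 1) by (rewrite <- exp_plus, Rplus_opp_r; apply exp_0).
  nra.
Qed.

Lemma sinh_le_x_cosh (x : R) : 0 <= x -> sinh x <= x * cosh x.
Proof.
  intros hx.
  assert (h : 0 * cosh 0 - sinh 0 <= x * cosh x - sinh x).
  { apply (derive_nonneg_le (fun y => y * cosh y - sinh y) (fun y => y * sinh y)); auto.
    - intros y _.
      replace (y * sinh y) with (1 * cosh y + y * sinh y - cosh y) by ring.
      apply (is_derive_minus (fun y => y * cosh y) sinh); [|apply is_derive_sinh].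
      apply (is_derive_mult (fun y => y) cosh); try apply Rmult_comm; try apply is_derive_cosh.
      apply (is_derive_id (K := R_AbsRing)).
    - intros y hy; assert (h := sinh_ge y); nra. }
  rewrite sinh_0 in h; lra.
Qed.

(** With the previous lemma, this bounds [coth x - 1 / x] near [0] and the third
    order zero in the numerator of the weight of the Mellin integral. *)
Lemma x_cosh_sub_sinh_le (x : R) : 0 <= x -> x * cosh x - sinh x <= x * x * sinh x.
Proof.
  intros hx.
  assert (h : 0 * 0 * sinh 0 - (0 * cosh 0 - sinh 0)
          <= x * x * sinh x - (x * cosh x - sinh x)).
  { apply (derive_nonneg_le (fun y => y * y * sinh y - (y * cosh y - sinh y))
             (fun y => y * sinh y + y * y * cosh y)); auto.
    - intros y _; unfold sinh, cosh; auto_derive; auto; field.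
    - intros y hy; assert (h := sinh_ge y); assert (h' := cosh_ge_1 y).
      assert (0 <= y * y) by nra; nra. }
  rewrite sinh_0 in h; lra.
Qed.

Lemma coth_sub_inv_bounds (x : R) : 0 < x -> 0 <= coth x - / x <= x.
Proof.
  intros hx; assert (hs := sinh_pos x hx).
  assert (h1 := sinh_le_x_cosh x); assert (h2 := x_cosh_sub_sinh_le x).
  replace (coth x - / x) with ((x * cosh x - sinh x) / (x * sinh x))
    by (unfold coth; field; lra).
  split; [apply Rdiv_le_0_compat; nra|].
  apply (Rle_div_l _ _ (x * sinh x)); nra.
Qed.

Lemma coth_sub_1 (x : R) : 0 < x -> coth x - 1 = exp (- x) / sinh x.
Proof.
  intros hx; assert (hs := sinh_pos x hx).
  unfold coth; apply (Rmult_eq_reg_r (sinh x)); [|lra].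
  field_simplify; [|lra|lra]; unfold sinh, cosh; field.
Qed.

Lemma exp_le (x y : R) : x <= y -> exp x <= exp y.
Proof. intros [h| ->]; [left; apply exp_increasing; exact h|right; reflexivity]. Qed.

Lemma exp_neg_le_1 (x : R) : 0 <= x -> exp (- x) <= 1.
Proof. intros hx; rewrite <- exp_0; apply exp_le; lra. Qed.

Lemma coth_sub_1_bounds (x : R) : 0 < x -> 0 <= coth x - 1 <= / x.
Proof.
  intros hx; rewrite coth_sub_1 by auto.
  assert (hs := sinh_ge x); assert (he := exp_pos (- x)); assert (he' := exp_neg_le_1 x).
  split; [apply Rdiv_le_0_compat; lra|].
  apply Rle_div_l; [lra|].
  apply Rle_trans with (/ x * x); [|apply Rmult_le_compat_l; try lra].
  - rewrite Rinv_l; lra.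
  - apply Rlt_le, Rinv_0_lt_compat; auto.
Qed.

(** * Series dominated by the inverse squares *)

Lemma is_series_inv_consecutive :
  is_series (fun n => / INR (S n) - / INR (S (S n))) 1.
Proof.
  apply is_series_ext with
    (fun n => (fun n => - / INR (S n)) (S n) - (fun n => - / INR (S n)) n).
  { intros n; toR; ring. }
  replace 1 with (0 - - / INR 1) by (simpl; field).
  apply (is_series_telescope (fun n => - / INR (S n)) 0).
  replace (Finite 0) with (Rbar_opp 0) by (simpl; f_equal; ring).
  apply -> is_lim_seq_opp.
  apply (is_lim_seq_incr_1 (fun n => / INR n)).
  apply (is_lim_seq_inv INR p_infty); [apply is_lim_seq_INR|discriminate].
Qed.

Lemma ex_series_inv_sqr (f : nat -> R) (c : R) :
  (forall n, Rabs (f n) <= c / INR (S n) ^ 2) -> ex_series f.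
Proof.
  intros hf; apply (ex_series_le f (fun n => 2 * c * (/ INR (S n) - / INR (S (S n))))).
  - intros n; eapply Rle_trans; [apply hf|].
    assert (hn := pos_INR n).
    assert (hc : 0 <= c).
    { assert (h := hf O); assert (h' := Rabs_pos (f O)); simpl in h; lra. }
    rewrite !S_INR.
    replace (2 * c * (/ (INR n + 1) - / (INR n + 1 + 1)))
      with (c / (INR n + 1) ^ 2 * (2 * (INR n + 1) / (INR n + 2))) by (field; lra).
    rewrite <- (Rmult_1_r (c / (INR n + 1) ^ 2)) at 1.
    apply Rmult_le_compat_l.
    + apply Rdiv_le_0_compat; [auto|nra].
    + apply Rle_div_r; lra.
  - apply (ex_series_scal (2 * c) (fun n => / INR (S n) - / INR (S (S n)))).
    exists 1; apply is_series_inv_consecutive.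
Qed.

(** An explicit Weierstrass test: the sums over poles, over the terms of the
    Dirichlet series and over translates are all dominated by [c / (n + 1)^2]. *)
Lemma series_tail_inv_sqr (f : nat -> R) (c l : R) :
  (forall n, Rabs (f n) <= c / INR (S n) ^ 2) -> is_series f l ->
  forall N, Rabs (l - sum_n f N) <= c / INR (S N).
Proof.
  intros hf hl N.
  assert (hc : 0 <= c).
  { assert (h := hf O); assert (h' := Rabs_pos (f O)); simpl in h; lra. }
  assert (h : forall k, Rabs (sum_n f (N + k) - sum_n f N)
                 <= c / INR (S N) - c / INR (S (N + k))).
  { induction k as [|k IH].
    - rewrite Nat.add_0_r, !Rminus_diag, Rabs_R0; lra.
    - rewrite Nat.add_succ_r, sum_SnR.
      replace (sum_n f (N + k) + f (S (N + k)) - sum_n f N)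
        with ((sum_n f (N + k) - sum_n f N) + f (S (N + k))) by ring.
      eapply Rle_trans; [apply Rabs_triang|].
      assert (h1 := hf (S (N + k))); assert (hn := pos_INR (N + k)).
      apply Rle_trans with (c / INR (S N) - c / INR (S (N + k)) + c / INR (S (S (N + k))) ^ 2);
        [lra|].
      rewrite !(S_INR (S (N + k))), !(S_INR (N + k)).
      assert (c / (INR (N + k) + 1 + 1) ^ 2
              <= c / (INR (N + k) + 1) - c / (INR (N + k) + 1 + 1)); [|lra].
      replace (c / (INR (N + k) + 1) - c / (INR (N + k) + 1 + 1))
        with (c * (/ ((INR (N + k) + 1) * (INR (N + k) + 1 + 1)))) by (field; lra).
      apply Rmult_le_compat_l; [auto|]; apply Rinv_le_contravar; nra. }
  apply (is_lim_seq_le (fun k => Rabs (sum_n f (N + k) - sum_n f N))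
           (fun _ => c / INR (S N)) (Rabs (l - sum_n f N)) (c / INR (S N))).
  - intros k; eapply Rle_trans; [apply h|].
    assert (0 < / INR (S (N + k))) by (apply Rinv_0_lt_compat, lt_0_INR; lia).
    unfold Rdiv; nra.
  - apply (is_lim_seq_abs _ (l - sum_n f N)), is_lim_seq_minus'; [|apply is_lim_seq_const].
    apply is_lim_seq_ext with (fun k => sum_n f (k + N)).
    { intros k; now rewrite Nat.add_comm. }
    apply is_lim_seq_incr_n; exact hl.
  - apply is_lim_seq_const.
Qed.

Lemma is_lim_seq_div_S (c : R) : is_lim_seq (fun n => c / INR (S n)) 0.
Proof.
  replace (Finite 0) with (Rbar_mult c 0) by (simpl; f_equal; ring).
  apply is_lim_seq_scal_l.
  apply (is_lim_seq_incr_1 (fun n => / INR n)).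
  apply (is_lim_seq_inv INR p_infty); [apply is_lim_seq_INR|discriminate].
Qed.

(** * Partial fractions of the hyperbolic cotangent *)

Definition pole (n : nat) : R := PI * INR (S n).

Lemma pole_pos (n : nat) : 0 < pole n.
Proof. apply Rmult_lt_0_compat; [apply PI_RGT_0|apply lt_0_INR; lia]. Qed.

Lemma pole_ge (n : nat) : 3 * INR (S n) <= pole n.
Proof.
  apply Rmult_le_compat_r; [apply pos_INR|].
  assert (h := PI2_3_2); unfold PI2 in h; lra.
Qed.

(** The Fourier series of [t |-> cosh (x (2 t - 1))] on [[0, 1]], at [0]. *)
Lemma coth_partial_fractions (x : R) : 0 < x ->
  is_series (fun n => 2 * x / (x ^ 2 + pole n ^ 2)) (coth x - / x).
Proof.
  intros hx; assert (hs := sinh_pos x hx).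
  set (f := fun t => cosh (x * (2 * t - 1))).
  set (df := fun t => 2 * x * sinh (x * (2 * t - 1))).
  assert (hd : forall t : R, is_derive f t (df t)).
  { intros t; unfold f, df, cosh, sinh; auto_derive; auto; toR; unfold Rminus; field. }
  assert (cf : forall t, continuous f t).
  { intros t; apply (ex_derive_continuous f); exists (df t); apply hd. }
  assert (cneg : forall y, cosh (- y) = cosh y).
  { intros y; unfold cosh; rewrite Ropp_involutive; field. }
  assert (sneg : forall y, sinh (- y) = - sinh y).
  { intros y; unfold sinh; rewrite Ropp_involutive; field. }
  assert (f0 : f 0 = cosh x).
  { unfold f; replace (x * (2 * 0 - 1)) with (- x) by ring; apply cneg. }
  assert (f1 : f 1 = f 0).
  { rewrite f0; unfold f; f_equal; ring. }
  assert (I0 : RInt f 0 1 = sinh x / x).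
  { rewrite (RInt_primitive (fun t => sinh (x * (2 * t - 1)) / (2 * x))); auto.
    - replace (x * (2 * 1 - 1)) with x by ring.
      replace (x * (2 * 0 - 1)) with (- x) by ring.
      rewrite sneg; toR; field; lra.
    - intros t; unfold f, cosh, sinh; auto_derive; auto; toR; unfold Rminus; field; lra. }
  destruct (fourier_series_at_0 f (df 0) (df 1) (fun t _ => cf t) f1 (hd 0) (hd 1)) as [h _].
  rewrite f0, I0 in h.
  apply (is_series_scal (/ sinh x)) in h.
  replace (coth x - / x) with (/ sinh x * (cosh x - sinh x / x))
    by (unfold coth; field; lra).
  revert h; apply is_series_ext; intros n.
  change (/ sinh x * (2 * RInt (fun t => f t * cos (INR (S n) * (2 * PI) * t)) 0 1)
          = 2 * x / (x ^ 2 + pole n ^ 2)).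
  assert (hp := pole_pos n).
  set (w := INR (S n) * (2 * PI)).
  assert (hw : w = 2 * pole n) by (unfold w, pole; ring).
  rewrite (RInt_primitive (fun t =>
     (2 * x * sinh (x * (2 * t - 1)) * cos (w * t) + w * cosh (x * (2 * t - 1)) * sin (w * t))
     / (4 * x ^ 2 + w ^ 2))).
  - rewrite !Rmult_0_r, !Rmult_1_r, sin_0, cos_0.
    replace (cos w) with 1 by (symmetry; apply cos_2nat_PI).
    replace (sin w) with 0 by (symmetry; apply sin_2nat_PI).
    replace (x * (2 - 1)) with x by ring.
    replace (x * (0 - 1)) with (- x) by ring.
    rewrite sneg, hw; toR; field; repeat split; nra.
  - intros t; unfold f, cosh, sinh; auto_derive; auto; toR; unfold Rminus; field; nra.
  - intros t; cont.
Qed.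

(** The primitive, vanishing at [0], of [(coth x - 1 / x) / x]. *)
Definition coth_primitive (x : R) : R :=
  Series (fun n => 2 / pole n * atan (x / pole n)).

Lemma atan_lower (z : R) : 0 <= z -> z / (1 + z ^ 2) <= atan z.
Proof.
  intros hz.
  destruct (mean_value atan (fun x => / (1 + x ^ 2)) 0 z hz) as [c [hc e]].
  { intros x _; apply is_derive_Reals, derivable_pt_lim_atan. }
  rewrite atan_0, !Rminus_0_r in e; rewrite e; unfold Rdiv; rewrite (Rmult_comm z).
  apply Rmult_le_compat_r; [auto|]; apply Rinv_le_contravar; nra.
Qed.

Lemma atan_bounds (z : R) : 0 <= z -> 0 <= atan z <= z.
Proof.
  intros hz.
  destruct (mean_value atan (fun x => / (1 + x ^ 2)) 0 z hz) as [c [hc e]].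
  { intros x _; apply is_derive_Reals, derivable_pt_lim_atan. }
  rewrite atan_0, !Rminus_0_r in e; rewrite e.
  assert (0 < / (1 + c ^ 2)) by (apply Rinv_0_lt_compat; nra).
  assert (/ (1 + c ^ 2) <= 1) by (rewrite <- Rinv_1 at 2; apply Rinv_le_contravar; nra).
  nra.
Qed.

Lemma coth_primitive_term_bound (x : R) (n : nat) : 0 <= x ->
  Rabs (2 / pole n * atan (x / pole n)) <= x / INR (S n) ^ 2.
Proof.
  intros hx; assert (hp := pole_pos n); assert (hg := pole_ge n).
  assert (hn : 0 < INR (S n)) by (apply lt_0_INR; lia).
  assert (hz : 0 <= x / pole n) by (apply Rdiv_le_0_compat; auto).
  assert (ha := atan_bounds _ hz).
  assert (h2 : 0 <= 2 / pole n) by (apply Rdiv_le_0_compat; lra).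
  rewrite Rabs_pos_eq by nra.
  apply Rle_trans with (2 / pole n * (x / pole n)); [nra|].
  replace (2 / pole n * (x / pole n)) with (x * (2 / pole n ^ 2)) by (field; lra).
  apply Rmult_le_compat_l; [auto|].
  apply Rle_div_l; [nra|].
  replace (/ INR (S n) ^ 2 * pole n ^ 2) with ((pole n / INR (S n)) ^ 2) by (field; lra).
  assert (3 <= pole n / INR (S n)) by (apply Rle_div_r; lra).
  nra.
Qed.

Lemma is_series_coth_primitive (x : R) : 0 <= x ->
  is_series (fun n => 2 / pole n * atan (x / pole n)) (coth_primitive x).
Proof.
  intros hx; apply Series_correct, ex_series_inv_sqr with x.
  intros n; apply coth_primitive_term_bound; auto.
Qed.

Lemma coth_primitive_bounds (x : R) : 0 <= x -> Rabs (coth_primitive x) <= 2 * x.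
Proof.
  intros hx.
  assert (h := series_tail_inv_sqr _ x _ (fun n => coth_primitive_term_bound x n hx)
                 (is_series_coth_primitive x hx) 0).
  assert (h0 := coth_primitive_term_bound x 0 hx).
  rewrite sum_O in h; change (INR 1) with 1 in *; rewrite pow1, Rdiv_1_r in *.
  apply Rabs_le_between in h, h0; apply Rabs_le_between.
  lra.
Qed.

Lemma RInt_uniform_limit (f : nat -> R -> R) (g : R -> R) (e : nat -> R) (a b : R) :
  a <= b ->
  (forall n x, a <= x <= b -> continuous (f n) x) ->
  (forall x, a <= x <= b -> continuous g x) ->
  (forall n x, a <= x <= b -> Rabs (f n x - g x) <= e n) ->
  is_lim_seq e 0 ->
  is_lim_seq (fun n => RInt (f n) a b) (RInt g a b).
Proof.
  intros hab cf cg hfg he.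
  apply (is_lim_seq_spec _ (RInt g a b)); intros eps.
  assert (heps : 0 < eps / (b - a + 1)) by (apply Rdiv_lt_0_compat; [apply cond_pos|lra]).
  apply is_lim_seq_spec in he; destruct (he (mkposreal _ heps)) as [N hN]; simpl in hN.
  exists N; intros n hn; specialize (hN n hn); rewrite Rminus_0_r in hN.
  rewrite <- RInt_Rminus by (apply ex_RInt_segment; auto).
  assert (h : Rabs (RInt (fun x => f n x - g x) a b) <= (b - a) * e n).
  { apply abs_RInt_le_const; auto.
    apply ex_RInt_segment; auto; intros; apply continuous_Rminus; auto. }
  apply Rabs_def2 in hN.
  assert (h1 : (b - a) * (eps / (b - a + 1)) < eps).
  { replace (pos eps) with ((b - a + 1) * (eps / (b - a + 1))) at 2 by (field; lra).
    apply Rmult_lt_compat_r; lra. }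
  assert (0 <= (b - a) * (eps / (b - a + 1) - e n)) by (apply Rmult_le_pos; lra).
  lra.
Qed.

(** The partial fractions, at [x = exp u], integrated term by term. *)
Lemma RInt_coth_sub_inv_exp (p q : R) : p <= q ->
  RInt (fun u => coth (exp u) - exp (- u)) p q
  = coth_primitive (exp q) - coth_primitive (exp p).
Proof.
  intros hpq.
  set (P := fun n u => 2 / pole n * atan (exp u / pole n)).
  set (d := fun n u => 2 * exp u / (exp u ^ 2 + pole n ^ 2)).
  assert (hP : forall n u, is_derive (P n) u (d n u)).
  { intros n u; assert (h := pole_pos n); unfold P, d; auto_derive; auto.
    unfold Rsqr; toR; field; repeat split; nra. }
  assert (hS : forall N u, is_derive (fun u => sum_n (fun n => P n u) N) u
                                     (sum_n (fun n => d n u) N)).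
  { intros N u; apply (is_derive_sum_n (fun n u => P n u) N u (fun n => d n u)); auto. }
  assert (cd : forall n u, continuous (d n) u).
  { intros n u; assert (h := pole_pos n); apply (ex_derive_continuous (d n)).
    unfold d; auto_derive; repeat split; nra. }
  assert (cS : forall N u, continuous (fun u => sum_n (fun n => d n u) N) u).
  { induction N as [|N IH]; intros u.
    - apply (continuous_ext (d 0%nat)); [intros y; now rewrite sum_O|apply cd].
    - apply (continuous_ext (fun u => sum_n (fun n => d n u) N + d (S N) u)).
      + intros y; now rewrite sum_SnR.
      + apply continuous_Rplus; [apply IH|apply cd]. }
  assert (lim1 : is_lim_seq (fun N => RInt (fun u => sum_n (fun n => d n u) N) p q)
                            (RInt (fun u => coth (exp u) - exp (- u)) p q)).
  { apply RInt_uniform_limit with (fun N => exp q / INR (S N)); auto.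
    - intros u _.
      apply (ex_derive_continuous (fun u => coth (exp u) - exp (- u))).
      unfold coth, cosh, sinh; auto_derive.
      assert (h := sinh_pos _ (exp_pos u)); unfold sinh in h; repeat split; lra.
    - intros N u hu; rewrite Rabs_minus_sym.
      assert (hb : forall n, Rabs (d n u) <= exp q / INR (S n) ^ 2).
      { intros n; assert (h := pole_pos n); assert (hg := pole_ge n).
        assert (hn : 0 < INR (S n)) by (apply lt_0_INR; lia).
        assert (he := exp_pos u); assert (hle := exp_le _ _ (proj2 hu)).
        unfold d; rewrite Rabs_pos_eq by (apply Rdiv_le_0_compat; nra).
        apply Rle_trans with (2 * exp u / (9 * INR (S n) ^ 2)).
        - apply Rmult_le_compat_l; [lra|]; apply Rinv_le_contravar; nra.
        - replace (2 * exp u / (9 * INR (S n) ^ 2))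
            with (2 / 9 * exp u / INR (S n) ^ 2) by (field; lra).
          apply Rmult_le_compat_r; [|lra].
          apply Rlt_le, Rinv_0_lt_compat; nra. }
      apply (series_tail_inv_sqr (fun n => d n u)); auto.
      rewrite exp_Ropp; apply coth_partial_fractions, exp_pos.
    - apply is_lim_seq_div_S. }
  assert (lim2 : is_lim_seq (fun N => RInt (fun u => sum_n (fun n => d n u) N) p q)
                   (coth_primitive (exp q) - coth_primitive (exp p))).
  { apply is_lim_seq_ext with
      (fun N => sum_n (fun n => P n q) N - sum_n (fun n => P n p) N).
    - intros N; symmetry; apply (RInt_primitive (fun u => sum_n (fun n => P n u) N)); auto.
    - apply is_lim_seq_minus'; apply is_series_coth_primitive, Rlt_le, exp_pos. }
  apply is_lim_seq_unique in lim1, lim2; rewrite lim1 in lim2; now injection lim2.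
Qed.

(** * Asymptotics of the primitive, and Euler's constant *)

Lemma is_lim_euler_gamma :
  is_lim_seq (fun n => sum_n (fun k => / INR (S k)) n - ln (INR (S n))) euler_gamma.
Proof.
  set (u := fun n => sum_n (fun k => / INR (S k)) n - ln (INR (S n))).
  assert (hln : forall n, / INR (S (S n)) <= ln (INR (S (S n))) - ln (INR (S n)) <= / INR (S n)).
  { intros n; rewrite (S_INR (S n)); assert (hn : 0 < INR (S n)) by (apply lt_0_INR; lia).
    destruct (mean_value ln Rinv (INR (S n)) (INR (S n) + 1)) as [c [hc e]]; [lra| |].
    - intros x hx; apply is_derive_Reals, derivable_pt_lim_ln; lra.
    - rewrite e; replace (/ c * (INR (S n) + 1 - INR (S n))) with (/ c) by ring.
      split; apply Rinv_le_contravar; lra. }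
  assert (hu : ex_finite_lim_seq u).
  { apply ex_finite_lim_seq_decr with 0.
    - intros n; unfold u; rewrite sum_SnR.
      assert (h := hln n); lra.
    - intros n; unfold u; apply Rle_trans with (/ INR (S n)).
      { apply Rlt_le, Rinv_0_lt_compat, lt_0_INR; lia. }
      induction n as [|n IH].
      + rewrite sum_O; simpl INR; rewrite ln_1; lra.
      + rewrite sum_SnR; assert (h := hln n); lra. }
  apply Lim_seq_correct' in hu.
  replace euler_gamma with (real (Lim_seq u)); [exact hu|].
  unfold euler_gamma; f_equal; apply Lim_seq_ext; intros n.
  unfold u; now rewrite sum_n_Reals.
Qed.

Definition atan_quot (z : R) : R := atan z / z.

(** The inverse tangent integral, based at [1]. *)
Definition Ti2 (v : R) : R := RInt atan_quot 1 v.

Lemma atan_quot_continuous (z : R) : 0 < z -> continuous atan_quot z.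
Proof.
  intros hz; apply (ex_derive_continuous atan_quot); unfold atan_quot.
  auto_derive; lra.
Qed.

Lemma atan_quot_bounds (z : R) : 0 < z -> 0 <= atan_quot z <= 1.
Proof.
  intros hz; assert (h := atan_bounds z); unfold atan_quot.
  split; [apply Rdiv_le_0_compat; lra|apply Rle_div_l; lra].
Qed.

Lemma atan_quot_decr (p q : R) : 0 < p <= q -> atan_quot q <= atan_quot p.
Proof.
  intros hpq; unfold atan_quot.
  destruct (mean_value atan (fun x => / (1 + x ^ 2)) p q) as [c [hc e]]; [lra| |].
  { intros x _; apply is_derive_Reals, derivable_pt_lim_atan. }
  assert (h := atan_lower p); unfold Rdiv in h.
  assert (hi : / (1 + c ^ 2) <= / (1 + p ^ 2)) by (apply Rinv_le_contravar; nra).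
  assert (h0 : 0 < / (1 + p ^ 2)) by (apply Rinv_0_lt_compat; nra).
  apply Rle_div_l; [lra|].
  replace (atan p / p * q) with (q * atan p / p) by (field; lra).
  apply Rle_div_r; [lra|].
  assert (p * (/ (1 + c ^ 2) * (q - p)) <= p * (/ (1 + p ^ 2) * (q - p))).
  { apply Rmult_le_compat_l; [lra|]; apply Rmult_le_compat_r; lra. }
  assert ((p * / (1 + p ^ 2)) * (q - p) <= atan p * (q - p)).
  { apply Rmult_le_compat_r; lra. }
  nra.
Qed.

Lemma is_derive_Ti2 (v : R) : 0 < v -> is_derive Ti2 v (atan_quot v).
Proof.
  intros hv; apply is_derive_RInt with (a := 1).
  - exists (mkposreal v hv); intros y hy.
    unfold ball in hy; simpl in hy; unfold AbsRing_ball, abs, minus, plus, opp in hy.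
    simpl in hy; apply Rabs_def2 in hy.
    apply (RInt_correct (V := R_CompleteNormedModule)).
    apply (@ex_RInt_continuous R_CompleteNormedModule).
    intros z hz; apply atan_quot_continuous.
    assert (h := Rmin_glb_lt 1 y 0); lra.
  - apply atan_quot_continuous; auto.
Qed.

Lemma Ti2_increment (p q : R) : 0 < p <= q ->
  (q - p) * atan_quot q <= Ti2 q - Ti2 p <= (q - p) * atan_quot p.
Proof.
  intros hpq.
  destruct (mean_value Ti2 atan_quot p q) as [c [hc e]]; [lra| |].
  { intros x hx; apply is_derive_Ti2; lra. }
  assert (h1 := atan_quot_decr p c); assert (h2 := atan_quot_decr c q).
  rewrite e; split; rewrite Rmult_comm; [apply Rmult_le_compat_r|apply Rmult_le_compat_l]; lra.
Qed.

Lemma Ti2_lipschitz (p q : R) : 0 < p -> 0 < q -> Rabs (Ti2 q - Ti2 p) <= p + q.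
Proof.
  intros hp hq; apply Rabs_le_between.
  destruct (Rle_dec p q) as [h|h].
  - assert (hi := Ti2_increment p q); assert (h1 := atan_quot_bounds p); assert (h2 := atan_quot_bounds q).
    assert (0 <= (q - p) * atan_quot q) by (apply Rmult_le_pos; lra).
    assert ((q - p) * atan_quot p <= (q - p) * 1) by (apply Rmult_le_compat_l; lra).
    lra.
  - assert (hi := Ti2_increment q p); assert (h1 := atan_quot_bounds p); assert (h2 := atan_quot_bounds q).
    assert (0 <= (p - q) * atan_quot p) by (apply Rmult_le_pos; lra).
    assert ((p - q) * atan_quot q <= (p - q) * 1) by (apply Rmult_le_compat_l; lra).
    lra.
Qed.

(** The reflection [atan v + atan (1 / v) = PI / 2], integrated. *)
Lemma Ti2_inversion (v : R) : 0 < v -> Ti2 v - Ti2 (/ v) = PI / 2 * ln v.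
Proof.
  intros hv.
  set (D := fun v => Ti2 v - Ti2 (/ v) - PI / 2 * ln v).
  assert (hD : forall v, 0 < v -> is_derive D v 0).
  { intros x hx; assert (hx' := Rinv_0_lt_compat x hx).
    assert (h1 := is_derive_Ti2 x hx); assert (h2 := is_derive_Ti2 (/ x) hx').
    assert (h3 : is_derive (fun x => Ti2 (/ x)) x (- / x ^ 2 * atan_quot (/ x))).
    { apply (is_derive_comp Ti2 Rinv x _ (- / x ^ 2) h2).
      apply (is_derive_ext (fun y => / y)); [auto|auto_derive; [lra|toR; field; lra]]. }
    assert (h4 : is_derive (fun x => PI / 2 * ln x) x (PI / 2 * / x)).
    { apply (is_derive_scal ln x (PI / 2)), is_derive_Reals, derivable_pt_lim_ln; auto. }
    replace 0 with (atan_quot x - (- / x ^ 2 * atan_quot (/ x)) - PI / 2 * / x).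
    - apply (is_derive_minus (fun v => Ti2 v - Ti2 (/ v)) (fun v => PI / 2 * ln v)); auto.
      apply (is_derive_minus Ti2 (fun v => Ti2 (/ v))); auto.
    - unfold atan_quot; rewrite atan_inv by auto; field; lra. }
  assert (D1 : D 1 = 0).
  { unfold D; rewrite Rinv_1, ln_1; ring. }
  assert (e : D v = D 1).
  { destruct (Rtotal_order v 1) as [h|[->|h]]; [|reflexivity|].
    - apply eq_is_derive; [|exact h]; intros t ht; apply hD; lra.
    - symmetry; apply eq_is_derive; [|exact h]; intros t ht; apply hD; lra. }
  rewrite D1 in e; unfold D in e; lra.
Qed.

(** Since [(1/n) atan (Y/n) = PI/(2 n) - (1/n) atan (n/Y)], the series is a
    harmonic sum minus a Riemann sum of the decreasing function [atan z / z],
    which the integral [Ti2] approximates up to [1/Y]; the logarithms come from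
    [Ti2_inversion]. *)
Lemma sum_atan_asymptotics (Y : R) (M : nat) : 0 < Y ->
  Rabs (sum_n (fun n => 2 / pole n * atan (PI * Y / pole n)) M
        - (sum_n (fun k => / INR (S k)) M - ln (INR (S M))) - ln Y)
  <= Y / INR (S M) + 2 / Y.
Proof.
  intros hY; assert (hp := PI_RGT_0).
  assert (hp3 := PI2_3_2); unfold PI2 in hp3.
  set (A := fun n => INR (S n) / Y).
  assert (hn : forall n, 0 < INR (S n)) by (intros; apply lt_0_INR; lia).
  assert (hA : forall n, 0 < A n) by (intros; apply Rdiv_lt_0_compat; auto).
  (* That is, atan ((n + 1) / Y) / (n + 1). *)
  set (rho := fun n => atan_quot (A n) / Y).
  assert (split : forall m, sum_n (fun n => 2 / pole n * atan (PI * Y / pole n)) m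
     = sum_n (fun k => / INR (S k)) m - 2 / PI * sum_n rho m).
  { assert (term : forall n, 2 / pole n * atan (PI * Y / pole n)
              = / INR (S n) - 2 / PI * rho n).
    { intros n; specialize (hn n); specialize (hA n).
      replace (PI * Y / pole n) with (/ A n) by (unfold A, pole; field; lra).
      rewrite atan_inv by auto; unfold rho, atan_quot.
      replace (pole n) with (PI * INR (S n)) by reflexivity.
      set (z := atan (A n)); unfold A; field; lra. }
    induction m as [|m IH]; [rewrite !sum_O; apply term|].
    rewrite !sum_SnR, IH, term; toR; ring. }
  assert (hY' : 0 < / Y) by (apply Rinv_0_lt_compat; auto).
  assert (step : forall n, A (S n) - A n = / Y).
  { intros n; unfold A; rewrite (S_INR (S n)); field; lra. }
  assert (cmp : forall m, rho m <= sum_n rho m - (Ti2 (A m) - Ti2 (A 0%nat)) <= rho 0%nat).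
  { induction m as [|m IH]; [rewrite sum_O; lra|].
    rewrite sum_SnR.
    assert (h := Ti2_increment (A m) (A (S m))); rewrite step in h.
    specialize (hA m); specialize (step m); unfold rho, Rdiv in *; lra. }
  specialize (cmp M).
  assert (b0 : rho 0%nat <= / Y).
  { assert (h := atan_quot_bounds (A 0%nat) (hA _)); unfold rho, Rdiv; nra. }
  assert (bM : 0 <= rho M).
  { assert (h := atan_quot_bounds (A M) (hA _)); unfold rho, Rdiv; nra. }
  assert (inv := Ti2_inversion (A M) (hA M)).
  assert (lip := Ti2_lipschitz (A 0%nat) (/ A M) (hA _) (Rinv_0_lt_compat _ (hA M))).
  assert (lnA : ln (A M) = ln (INR (S M)) - ln Y).
  { unfold A, Rdiv; rewrite ln_mult, ln_Rinv; auto; ring. }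
  assert (A0 : A 0%nat = / Y) by (unfold A; simpl; field; lra).
  assert (iA : / A M = Y / INR (S M)) by (unfold A; specialize (hn M); field; lra).
  rewrite lnA in inv; rewrite A0 in *; rewrite iA in *.
  rewrite split.
  set (H := sum_n (fun k => / INR (S k)) M) in *; set (S := sum_n rho M) in *.
  replace (H - 2 / PI * S - (H - ln (INR (Datatypes.S M))) - ln Y)
    with (2 / PI * (PI / 2 * (ln (INR (Datatypes.S M)) - ln Y) - S)) by (field; lra).
  rewrite Rabs_mult, (Rabs_pos_eq (2 / PI)) by (apply Rdiv_le_0_compat; lra).
  assert (hq : 2 / PI <= 1) by (apply Rle_div_l; lra).
  assert (hq0 : 0 <= 2 / PI) by (apply Rdiv_le_0_compat; lra).
  apply Rabs_le_between in lip.
  assert (hb : Rabs (PI / 2 * (ln (INR (Datatypes.S M)) - ln Y) - S)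
               <= Y / INR (Datatypes.S M) + 2 / Y).
  { apply Rabs_le_between; unfold Rdiv at 2 5; lra. }
  assert (h0 := Rabs_pos (PI / 2 * (ln (INR (Datatypes.S M)) - ln Y) - S)).
  nra.
Qed.

(** This is where Euler's constant and [ln PI] enter the theorem. *)
Lemma coth_primitive_asymptotics (x : R) : 0 < x ->
  Rabs (coth_primitive x - euler_gamma - (ln x - ln PI)) <= 8 / x.
Proof.
  intros hx; assert (hp := PI_RGT_0); assert (hp4 := PI_4).
  set (Y := x / PI).
  assert (hY : 0 < Y) by (apply Rdiv_lt_0_compat; auto).
  assert (e : PI * Y = x) by (unfold Y; field; lra).
  apply Rle_trans with (2 / Y).
  2:{ unfold Y; replace (2 / (x / PI)) with (2 * PI / x) by (field; lra).
      apply Rmult_le_compat_r; [apply Rlt_le, Rinv_0_lt_compat; auto|lra]. }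
  replace (ln x - ln PI) with (ln Y)
    by (unfold Y, Rdiv; rewrite ln_mult, ln_Rinv; auto using Rinv_0_lt_compat; ring).
  apply (is_lim_seq_le
    (fun M => Rabs (sum_n (fun n => 2 / pole n * atan (PI * Y / pole n)) M
        - (sum_n (fun k => / INR (S k)) M - ln (INR (S M))) - ln Y))
    (fun M => Y / INR (S M) + 2 / Y)
    (Rabs (coth_primitive x - euler_gamma - ln Y)) (2 / Y)).
  - intros M; apply sum_atan_asymptotics; auto.
  - apply (is_lim_seq_abs _ (coth_primitive x - euler_gamma - ln Y)).
    apply is_lim_seq_minus'; [|apply is_lim_seq_const].
    apply is_lim_seq_minus'; [|apply is_lim_euler_gamma].
    rewrite e; apply is_series_coth_primitive; lra.
  - replace (Finite (2 / Y)) with (Finite (0 + 2 / Y)) by (f_equal; ring).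
    apply is_lim_seq_plus'; [apply is_lim_seq_div_S|apply is_lim_seq_const].
Qed.

(** * Integrals over the line *)

(** The integrands to come decay at rate [1] (predicate [decays1]); working at
    rate [1/2] leaves room for polynomial factors and small exponentials. *)
Definition decays (B : R) (f : R -> R) : Prop :=
  (forall u, continuous f u) /\ forall u, Rabs (f u) <= B * exp (- (Rabs u / 2)).

Definition line_integral (f : R -> R) : R :=
  real (Lim_seq (fun n => RInt f (- INR n) (INR n))).

Lemma decays_nonneg (B : R) (f : R -> R) : decays B f -> 0 <= B.
Proof.
  intros [_ h]; specialize (h 0); assert (h' := Rabs_pos (f 0)).
  rewrite Rabs_R0 in h; replace (- (0 / 2)) with 0 in h by field.
  rewrite exp_0 in h; lra.
Qed.

Lemma RInt_Chasles_cont (f : R -> R) (a b c : R) : (forall u, continuous f u) ->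
  RInt f a c = RInt f a b + RInt f b c.
Proof. intros cf; symmetry; apply (RInt_Chasles f a b c); apply ex_RInt_cont; auto. Qed.

Lemma RInt_abs_le (f g : R -> R) (a b : R) : a <= b ->
  (forall u, continuous f u) -> (forall u, continuous g u) ->
  (forall u, a <= u <= b -> Rabs (f u) <= g u) -> Rabs (RInt f a b) <= RInt g a b.
Proof.
  intros hab cf cg h.
  assert (cabs : forall u, continuous (fun u => Rabs (f u)) u) by (intros; cont).
  apply Rle_trans with (RInt (fun u => Rabs (f u)) a b).
  - apply abs_RInt_le; auto; apply ex_RInt_cont; auto.
  - apply RInt_le; auto; try (apply ex_RInt_cont; auto).
    intros u hu; apply h; lra.
Qed.

Lemma decays_tail_right (B : R) (f : R -> R) (q q' : R) : decays B f -> 0 <= q <= q' ->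
  Rabs (RInt f q q') <= 2 * B * exp (- (q / 2)).
Proof.
  intros hf hq; assert (hB := decays_nonneg B f hf); destruct hf as [cf bf].
  eapply Rle_trans.
  - apply (RInt_abs_le f (fun u => B * exp (- (u / 2)))); [lra|auto|intros; cont|].
    intros u hu; specialize (bf u); rewrite (Rabs_pos_eq u) in bf by lra; exact bf.
  - rewrite (RInt_primitive (fun u => - (2 * B) * exp (- (u / 2)))).
    + assert (0 < exp (- (q' / 2))) by apply exp_pos; nra.
    + intros u; auto_derive; auto; toR; unfold Rdiv; field.
    + intros u; cont.
Qed.

Lemma decays_tail_left (B : R) (f : R -> R) (p p' : R) : decays B f -> p' <= p <= 0 ->
  Rabs (RInt f p' p) <= 2 * B * exp (p / 2).
Proof.
  intros hf hq; assert (hB := decays_nonneg B f hf); destruct hf as [cf bf].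
  eapply Rle_trans.
  - apply (RInt_abs_le f (fun u => B * exp (u / 2))); [lra|auto|intros; cont|].
    intros u hu; specialize (bf u); rewrite (Rabs_left1 u) in bf by lra.
    replace (u / 2) with (- (- u / 2)) by field; exact bf.
  - rewrite (RInt_primitive (fun u => 2 * B * exp (u / 2))).
    + assert (0 < exp (p' / 2)) by apply exp_pos; nra.
    + intros u; auto_derive; auto; toR; unfold Rdiv; field.
    + intros u; cont.
Qed.

Lemma decays_RInt_cauchy (B : R) (f : R -> R) (p q p' q' : R) :
  decays B f -> p' <= p <= 0 -> 0 <= q <= q' ->
  Rabs (RInt f p' q' - RInt f p q) <= 2 * B * (exp (p / 2) + exp (- (q / 2))).
Proof.
  intros hf hp hq.
  rewrite (RInt_Chasles_cont f p' p q'), (RInt_Chasles_cont f p q q') by apply hf.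
  replace (RInt f p' p + (RInt f p q + RInt f q q') - RInt f p q)
    with (RInt f p' p + RInt f q q') by ring.
  eapply Rle_trans; [apply Rabs_triang|].
  assert (h1 := decays_tail_right B f q q' hf hq).
  assert (h2 := decays_tail_left B f p p' hf hp); lra.
Qed.

Lemma is_lim_seq_exp_neg (c : R) (u : nat -> R) :
  0 < c -> is_lim_seq u p_infty -> is_lim_seq (fun n => exp (- (c * u n))) 0.
Proof.
  intros hc hu; apply (is_lim_comp_seq exp (fun n => - (c * u n)) m_infty 0).
  - apply is_lim_exp_m.
  - exists 0%nat; intros; discriminate.
  - apply (is_lim_seq_opp (fun n => c * u n) p_infty).
    assert (h := is_lim_seq_scal_l u c p_infty hu); simpl in h.
    destruct (Rle_dec 0 c); [|lra]; destruct (Rle_lt_or_eq_dec 0 c r); [exact h|lra].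
Qed.

Lemma line_integral_correct (B : R) (f : R -> R) : decays B f ->
  is_lim_seq (fun n => RInt f (- INR n) (INR n)) (line_integral f).
Proof.
  intros hf; apply Lim_seq_correct', ex_lim_seq_cauchy_corr; intros eps.
  assert (hB := decays_nonneg B f hf).
  assert (h0 : is_lim_seq (fun n => 4 * B * exp (- (/ 2 * INR n))) 0).
  { replace (Finite 0) with (Rbar_mult (4 * B) 0) by (simpl; f_equal; ring).
    apply is_lim_seq_scal_l, is_lim_seq_exp_neg; [lra|apply is_lim_seq_INR]. }
  apply is_lim_seq_spec in h0; destruct (h0 eps) as [N hN]; exists N.
  assert (h : forall n m, (N <= n)%nat -> (n <= m)%nat ->
     Rabs (RInt f (- INR m) (INR m) - RInt f (- INR n) (INR n)) < eps).
  { intros n m hn hm; specialize (hN n hn); rewrite Rminus_0_r in hN.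
    apply Rabs_def2 in hN; assert (hnm := le_INR n m hm); assert (h := pos_INR n).
    eapply Rle_lt_trans; [apply (decays_RInt_cauchy B); auto; lra|].
    replace (- INR n / 2) with (- (/ 2 * INR n)) by field.
    replace (INR n / 2) with (/ 2 * INR n) by field; lra. }
  intros n m hn hm; destruct (Nat.le_ge_cases n m).
  - rewrite Rabs_minus_sym; auto.
  - auto.
Qed.

Lemma line_integral_approx (B : R) (f : R -> R) (p q : R) :
  decays B f -> p <= 0 -> 0 <= q ->
  Rabs (line_integral f - RInt f p q) <= 2 * B * (exp (p / 2) + exp (- (q / 2))).
Proof.
  intros hf hp hq.
  destruct (nfloor_ex (Rmax (- p) q)) as [N hN].
  { eapply Rle_trans; [exact hq|apply Rmax_r]. }
  assert (h1 := Rmax_l (- p) q); assert (h2 := Rmax_r (- p) q).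
  set (v := fun n => RInt f (- INR (n + S N)) (INR (n + S N)) : R).
  apply (is_lim_seq_le (fun n => Rabs (v n - RInt f p q)) (fun _ => 2 * B * (exp (p / 2) + exp (- (q / 2))))
    (Rabs (line_integral f - RInt f p q)) (2 * B * (exp (p / 2) + exp (- (q / 2))))).
  - intros n; apply decays_RInt_cauchy; auto.
    + rewrite plus_INR, S_INR; assert (h := pos_INR n); lra.
    + rewrite plus_INR, S_INR; assert (h := pos_INR n); lra.
  - apply (is_lim_seq_abs _ (line_integral f - RInt f p q)).
    apply is_lim_seq_minus'; [|apply is_lim_seq_const].
    apply (is_lim_seq_incr_n (fun n => RInt f (- INR n) (INR n)) (S N)).
    eapply line_integral_correct; eauto.
  - apply is_lim_seq_const.
Qed.

Lemma line_integral_bound (B : R) (f : R -> R) : decays B f ->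
  Rabs (line_integral f) <= 4 * B.
Proof.
  intros hf; assert (h := line_integral_approx B f 0 0 hf (Rle_refl 0) (Rle_refl 0)).
  rewrite RInt_point in h; unfold zero in h; simpl in h.
  replace (- (0 / 2)) with 0 in h by field; replace (0 / 2) with 0 in h by field.
  rewrite exp_0, Rminus_0_r in h; lra.
Qed.

Lemma line_integral_lim (B : R) (f : R -> R) (p q : nat -> R) :
  decays B f -> is_lim_seq p p_infty -> is_lim_seq q p_infty ->
  is_lim_seq (fun n => RInt f (- p n) (q n)) (line_integral f).
Proof.
  intros hf hp hq.
  assert (h0 : is_lim_seq (fun n => 2 * B * (exp (- (/ 2 * p n)) + exp (- (/ 2 * q n)))) 0).
  { replace (Finite 0) with (Rbar_mult (2 * B) (0 + 0)) by (simpl; f_equal; ring).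
    apply is_lim_seq_scal_l, is_lim_seq_plus'; apply is_lim_seq_exp_neg; auto; lra. }
  apply is_lim_seq_spec; intros eps.
  apply is_lim_seq_spec in h0, hp, hq.
  destruct (h0 eps) as [N1 H1]; destruct (hp 0) as [N2 H2]; destruct (hq 0) as [N3 H3].
  exists (N1 + N2 + N3)%nat; intros n hn.
  specialize (H1 n ltac:(lia)); specialize (H2 n ltac:(lia)); specialize (H3 n ltac:(lia)).
  rewrite Rminus_0_r in H1; apply Rabs_def2 in H1.
  rewrite Rabs_minus_sym; eapply Rle_lt_trans.
  - apply (line_integral_approx B); auto; lra.
  - replace (- p n / 2) with (- (/ 2 * p n)) by field.
    replace (q n / 2) with (/ 2 * q n) by field; lra.
Qed.

Lemma decays_plus (B C : R) (f g : R -> R) :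
  decays B f -> decays C g -> decays (B + C) (fun u => f u + g u).
Proof.
  intros [cf bf] [cg bg]; split; [intros; cont|].
  intros u; eapply Rle_trans; [apply Rabs_triang|].
  specialize (bf u); specialize (bg u); lra.
Qed.

Lemma decays_scal (B k : R) (f : R -> R) :
  decays B f -> decays (Rabs k * B) (fun u => k * f u).
Proof.
  intros [cf bf]; split; [intros; cont|].
  intros u; rewrite Rabs_mult, Rmult_assoc; apply Rmult_le_compat_l; auto; apply Rabs_pos.
Qed.

Lemma line_integral_ext (f g : R -> R) :
  (forall u, f u = g u) -> line_integral f = line_integral g.
Proof.
  intros h; unfold line_integral; f_equal; apply Lim_seq_ext; intros n.
  apply RInt_eq; exact h.
Qed.

Lemma line_integral_plus (B C : R) (f g : R -> R) : decays B f -> decays C g ->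
  line_integral (fun u => f u + g u) = line_integral f + line_integral g.
Proof.
  intros hf hg.
  assert (h := line_integral_correct _ _ (decays_plus B C f g hf hg)).
  apply is_lim_seq_unique in h.
  assert (h' : is_lim_seq (fun n => RInt (fun u => f u + g u) (- INR n) (INR n))
                 (line_integral f + line_integral g)).
  { apply is_lim_seq_ext with (fun n => RInt f (- INR n) (INR n) + RInt g (- INR n) (INR n)).
    - intros n; symmetry; apply RInt_Rplus; apply ex_RInt_cont; [apply hf|apply hg].
    - apply is_lim_seq_plus'; eapply line_integral_correct; eauto. }
  apply is_lim_seq_unique in h'; rewrite h in h'; now injection h'.
Qed.

Lemma line_integral_scal (B k : R) (f : R -> R) : decays B f ->
  line_integral (fun u => k * f u) = k * line_integral f.
Proof.
  intros hf; assert (h := line_integral_correct _ _ (decays_scal B k f hf)).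
  apply is_lim_seq_unique in h.
  assert (h' : is_lim_seq (fun n => RInt (fun u => k * f u) (- INR n) (INR n))
                 (k * line_integral f)).
  { apply is_lim_seq_ext with (fun n => k * RInt f (- INR n) (INR n)).
    - intros n; symmetry; apply RInt_Rscal, ex_RInt_cont, hf.
    - apply (is_lim_seq_scal_l _ k (line_integral f)); eapply line_integral_correct; eauto. }
  apply is_lim_seq_unique in h'; rewrite h in h'; now injection h'.
Qed.

Lemma decays_minus (B C : R) (f g : R -> R) :
  decays B f -> decays C g -> decays (B + C) (fun u => f u - g u).
Proof.
  intros [cf bf] [cg bg]; split; [intros; cont|].
  intros u; eapply Rle_trans; [apply Rabs_triang|].
  rewrite Rabs_Ropp; specialize (bf u); specialize (bg u); lra.
Qed.

Lemma line_integral_minus (B C : R) (f g : R -> R) : decays B f -> decays C g ->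
  line_integral (fun u => f u - g u) = line_integral f - line_integral g.
Proof.
  intros hf hg.
  rewrite (line_integral_ext _ (fun u => f u + -1 * g u)) by (intros; ring).
  rewrite (line_integral_plus B (Rabs (-1) * C)), (line_integral_scal C); auto using decays_scal.
  ring.
Qed.

Lemma RInt_shift (f : R -> R) (v a b : R) : (forall u, continuous f u) ->
  RInt (fun t => f (t + v)) a b = RInt f (a + v) (b + v).
Proof.
  intros cf; assert (h := RInt_comp_lin f 1 v a b).
  rewrite !Rmult_1_l in h; rewrite <- h by (apply ex_RInt_cont; auto).
  apply RInt_eq; intros t; unfold scal; simpl; unfold mult; simpl.
  now rewrite !Rmult_1_l.
Qed.

Lemma line_integral_shift (B v : R) (f : R -> R) : decays B f ->
  line_integral (fun u => f (u + v)) = line_integral f.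
Proof.
  intros hf.
  assert (h : is_lim_seq (fun n => RInt (fun u => f (u + v)) (- INR n) (INR n)) (line_integral f)).
  { apply is_lim_seq_ext with (fun n => RInt f (- (INR n - v)) (INR n + v)).
    - intros n; rewrite RInt_shift by apply hf; f_equal; ring.
    - apply (line_integral_lim B); auto.
      + apply (is_lim_seq_minus _ _ p_infty v); [apply is_lim_seq_INR|apply is_lim_seq_const|reflexivity].
      + apply (is_lim_seq_plus _ _ p_infty v); [apply is_lim_seq_INR|apply is_lim_seq_const|reflexivity]. }
  unfold line_integral at 1; now rewrite (is_lim_seq_unique _ _ h).
Qed.

(** * Two-sided Laplace transforms are analytic *)

Lemma exp_partial_sum_le (v : R) (N : nat) : 0 <= v ->
  sum_n (fun n => v ^ n / INR (fact n)) N <= exp v.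
Proof.
  intros hv; apply (is_lim_seq_incr_compare (sum_n (fun n => v ^ n / INR (fact n)))).
  - apply (is_series_ext (fun n => scal (pow_n v n) (/ INR (fact n)))).
    + intros n; rewrite pow_n_pow; reflexivity.
    + apply is_exp_Reals.
  - intros n; rewrite sum_SnR.
    assert (0 <= v ^ S n / INR (fact (S n))); [|lra].
    apply Rdiv_le_0_compat; [apply pow_le; auto|apply INR_fact_lt_0].
Qed.

Lemma exp_term_le (v : R) (n : nat) : 0 <= v -> v ^ n / INR (fact n) <= exp v.
Proof.
  intros hv; apply Rle_trans with (sum_n (fun n => v ^ n / INR (fact n)) n);
    [|apply exp_partial_sum_le; auto].
  assert (hp : forall m, 0 <= v ^ m / INR (fact m)).
  { intros m; apply Rdiv_le_0_compat; [apply pow_le; auto|apply INR_fact_lt_0]. }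
  destruct n as [|n]; [rewrite sum_O; lra|rewrite sum_SnR].
  assert (0 <= sum_n (fun n => v ^ n / INR (fact n)) n); [|lra].
  induction n as [|n IH]; [rewrite sum_O; auto|rewrite sum_SnR].
  specialize (hp (S n)); lra.
Qed.

(** Beyond rank [N], the terms are at most [2^-N] times those of [exp (2 |v|)]. *)
Lemma exp_taylor_remainder (v : R) (N : nat) :
  Rabs (exp v - sum_n (fun n => v ^ n / INR (fact n)) N) <= (/ 2) ^ N * exp (2 * Rabs v).
Proof.
  set (T := sum_n (fun n => v ^ n / INR (fact n))).
  set (A := sum_n (fun n => (2 * Rabs v) ^ n / INR (fact n))).
  assert (hv := Rabs_pos v).
  assert (h : forall k, Rabs (T (N + k)%nat - T N) <= (/ 2) ^ N * (A (N + k)%nat - A N)).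
  { induction k as [|k IH].
    - rewrite Nat.add_0_r, !Rminus_diag, Rabs_R0; lra.
    - rewrite Nat.add_succ_r; unfold T, A; rewrite !sum_SnR; fold T; fold A.
      set (n := S (N + k)).
      replace (T (N + k)%nat + v ^ n / INR (fact n) - T N)
        with ((T (N + k)%nat - T N) + v ^ n / INR (fact n)) by ring.
      eapply Rle_trans; [apply Rabs_triang|].
      assert (hf := INR_fact_lt_0 n).
      assert (e : Rabs (v ^ n / INR (fact n)) <= (/ 2) ^ N * ((2 * Rabs v) ^ n / INR (fact n))).
      { unfold Rdiv; rewrite Rabs_mult, <- RPow_abs, (Rabs_pos_eq (/ _))
          by (apply Rlt_le, Rinv_0_lt_compat; auto).
        rewrite <- Rmult_assoc; apply Rmult_le_compat_r;
          [apply Rlt_le, Rinv_0_lt_compat; auto|].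
        rewrite Rpow_mult_distr, <- Rmult_assoc.
        rewrite <- (Rmult_1_l (Rabs v ^ n)) at 1.
        apply Rmult_le_compat_r; [apply pow_le; auto|].
        unfold n; rewrite <- Nat.add_succ_r, pow_add, <- Rmult_assoc, <- Rpow_mult_distr.
        replace (/ 2 * 2) with 1 by field; rewrite pow1, Rmult_1_l.
        apply pow_R1_Rle; lra. }
      lra. }
  assert (hA : forall k, A (N + k)%nat - A N <= exp (2 * Rabs v)).
  { intros k; assert (h1 := exp_partial_sum_le (2 * Rabs v) (N + k) ltac:(lra)).
    assert (0 <= A N); [|unfold A in *; lra].
    clear -hv; assert (hp : forall m, 0 <= (2 * Rabs v) ^ m / INR (fact m)).
    { intros m; apply Rdiv_le_0_compat; [apply pow_le; lra|apply INR_fact_lt_0]. }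
    unfold A; induction N as [|n IH]; [rewrite sum_O; auto|rewrite sum_SnR].
    specialize (hp (S n)); lra. }
  apply (is_lim_seq_le (fun k => Rabs (T (N + k)%nat - T N))
    (fun _ => (/ 2) ^ N * exp (2 * Rabs v))
    (Rabs (exp v - T N)) ((/ 2) ^ N * exp (2 * Rabs v))).
  - intros k; eapply Rle_trans; [apply h|].
    apply Rmult_le_compat_l; [apply pow_le; lra|apply hA].
  - apply (is_lim_seq_abs _ (exp v - T N)), is_lim_seq_minus'; [|apply is_lim_seq_const].
    apply is_lim_seq_ext with (fun k => T (k + N)%nat).
    { intros k; now rewrite Nat.add_comm. }
    apply is_lim_seq_incr_n.
    apply (is_series_ext (fun n => scal (pow_n v n) (/ INR (fact n)))).
    + intros n; rewrite pow_n_pow; reflexivity.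
    + apply is_exp_Reals.
  - apply is_lim_seq_const.
Qed.

Definition decays1 (B : R) (f : R -> R) : Prop :=
  (forall u, continuous f u) /\ forall u, Rabs (f u) <= B * exp (- Rabs u).

Lemma decays1_mult (B K : R) (f g : R -> R) :
  decays1 B f -> (forall u, continuous g u) -> 
  (forall u, Rabs (g u) <= K * exp (Rabs u / 2)) -> decays (B * K) (fun u => f u * g u).
Proof.
  intros [cf bf] cg bg; split; [intros; cont|].
  intros u; rewrite Rabs_mult.
  replace (B * K * exp (- (Rabs u / 2)))
    with ((B * exp (- Rabs u)) * (K * exp (Rabs u / 2))).
  - apply Rmult_le_compat; auto using Rabs_pos.
  - replace (- (Rabs u / 2)) with (- Rabs u + Rabs u / 2) by field; rewrite exp_plus; ring.
Qed.

Lemma decays1_bounded (B : R) (f g : R -> R) :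
  decays1 B f -> (forall u, continuous g u) -> 
  (forall u, Rabs (g u) <= 1) -> decays B (fun u => f u * g u).
Proof.
  intros hf cg bg; rewrite <- (Rmult_1_r B); apply decays1_mult; auto.
  intros u; eapply Rle_trans; [apply bg|].
  assert (h := exp_ineq1_le (Rabs u / 2)); assert (h' := Rabs_pos u); lra.
Qed.

(** The exponential series is integrated term by term: for [|h| <= 1/4] its
    remainder is at most [2^-N exp (|u| / 2)], which the decay of [f] absorbs
    uniformly in [N]. *)
Lemma is_pseries_line_integral_exp (B h : R) (f : R -> R) :
  decays1 B f -> Rabs h <= / 4 ->
  is_pseries (fun n => line_integral (fun u => f u * (u ^ n / INR (fact n)))) h
             (line_integral (fun u => f u * exp (h * u))).
Proof.
  intros hf hh.
  assert (cpow : forall n u, continuous (fun u => u ^ n / INR (fact n)) u).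
  { intros n u; apply (ex_derive_continuous (fun u => u ^ n / INR (fact n))).
    auto_derive; auto. }
  assert (bpow : forall n u, Rabs (u ^ n / INR (fact n)) <= 2 ^ n * exp (Rabs u / 2)).
  { intros n u; assert (hu := Rabs_pos u); assert (hn := INR_fact_lt_0 n).
    unfold Rdiv; rewrite Rabs_mult, <- RPow_abs, (Rabs_pos_eq (/ _))
      by (apply Rlt_le, Rinv_0_lt_compat; auto).
    replace (Rabs u ^ n * / INR (fact n)) with (2 ^ n * ((Rabs u / 2) ^ n / INR (fact n))).
    - apply Rmult_le_compat_l; [apply pow_le; lra|apply exp_term_le; lra].
    - unfold Rdiv; rewrite Rpow_mult_distr, pow_inv.
      assert (0 < 2 ^ n) by (apply pow_lt; lra); field; lra. }
  set (t := fun n u => f u * (u ^ n / INR (fact n))).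
  assert (ht : forall n, decays (B * 2 ^ n) (t n)).
  { intros n; apply decays1_mult; auto. }
  assert (sums : forall N, sum_n (fun n => h ^ n * line_integral (t n)) N
     = line_integral (fun u => f u * sum_n (fun n => (h * u) ^ n / INR (fact n)) N)
    /\ exists C, decays C (fun u => f u * sum_n (fun n => (h * u) ^ n / INR (fact n)) N)).
  { assert (e : forall n u, h ^ n * t n u = f u * ((h * u) ^ n / INR (fact n))).
    { intros n u; unfold t; rewrite Rpow_mult_distr; field; apply INR_fact_neq_0. }
    assert (hs : forall n, decays (Rabs (h ^ n) * (B * 2 ^ n)) (fun u => h ^ n * t n u)).
    { intros n; apply decays_scal; auto. }
    induction N as [|N [IH [C hC]]].
    - split.
      + rewrite sum_O, <- (line_integral_scal (B * 2 ^ 0)) by auto.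
        apply line_integral_ext; intros u; rewrite sum_O; apply e.
      + exists (Rabs (h ^ 0) * (B * 2 ^ 0)); destruct (hs 0%nat) as [c b]; split.
        * intros u; apply (continuous_ext (fun u => h ^ 0 * t 0%nat u)); [|apply c].
          intros x; rewrite sum_O; apply e.
        * intros u; rewrite sum_O, <- e; apply b.
    - assert (e' : forall u, f u * sum_n (fun n => (h * u) ^ n / INR (fact n)) N + h ^ S N * t (S N) u
                = f u * sum_n (fun n => (h * u) ^ n / INR (fact n)) (S N)).
      { intros u; rewrite sum_SnR, e; ring. }
      split.
      + rewrite sum_SnR, IH, <- (line_integral_scal (B * 2 ^ S N)) by auto.
        rewrite <- (line_integral_plus _ _ _ _ hC (hs (S N))).
        apply line_integral_ext; exact e'.
      + destruct (decays_plus _ _ _ _ hC (hs (S N))) as [c b].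
        eexists; split.
        * intros u; eapply continuous_ext; [exact e'|apply c].
        * intros u; rewrite <- e'; apply b. }
  assert (hexp : decays (B * 1) (fun u => f u * exp (h * u))).
  { apply decays1_mult; [auto|intros; cont|]; intros u.
    rewrite Rabs_pos_eq, Rmult_1_l by (apply Rlt_le, exp_pos).
    apply exp_le; eapply Rle_trans; [apply Rle_abs|].
    rewrite Rabs_mult; assert (hu := Rabs_pos u); nra. }
  apply is_pseries_R.
  apply (is_series_ext (fun n => h ^ n * line_integral (t n))).
  { intros n; apply Rmult_comm. }
  change (is_lim_seq (sum_n (fun n => h ^ n * line_integral (t n)))
            (line_integral (fun u => f u * exp (h * u)))).
  assert (bound : forall N,
     Rabs (sum_n (fun n => h ^ n * line_integral (t n)) N
           - line_integral (fun u => f u * exp (h * u))) <= 4 * B * (/ 2) ^ N).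
  { intros N; destruct (sums N) as [-> [C hC]].
    rewrite Rabs_minus_sym, <- (line_integral_minus _ _ _ _ hexp hC).
    rewrite (line_integral_ext _ (fun u => f u * (exp (h * u)
              - sum_n (fun n => (h * u) ^ n / INR (fact n)) N))) by (intros; ring).
    rewrite Rmult_assoc; apply line_integral_bound.
    destruct (decays_minus _ _ _ _ hexp hC) as [c _].
    split.
    - intros u; eapply continuous_ext; [|apply c]; intros x; simpl; ring.
    - intros u; rewrite Rabs_mult; destruct hf as [cf bf]; specialize (bf u).
      eapply Rle_trans.
      + apply Rmult_le_compat; try apply Rabs_pos; [exact bf|apply exp_taylor_remainder].
      + replace (B * exp (- Rabs u) * ((/ 2) ^ N * exp (2 * Rabs (h * u))))
          with (B * (/ 2) ^ N * (exp (- Rabs u) * exp (2 * Rabs (h * u)))) by ring.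
        assert (hB : 0 <= B).
        { assert (h1 := Rabs_pos (f u)); assert (h2 := exp_pos (- Rabs u)); nra. }
        apply Rmult_le_compat_l.
        * apply Rmult_le_pos; [auto|apply pow_le; lra].
        * rewrite <- exp_plus; apply exp_le; rewrite Rabs_mult.
          assert (hu := Rabs_pos u); nra. }
  apply is_lim_seq_spec; intros eps.
  assert (h0 : is_lim_seq (fun n => 4 * B * (/ 2) ^ n) 0).
  { replace (Finite 0) with (Rbar_mult (4 * B) 0) by (simpl; f_equal; ring).
    apply is_lim_seq_scal_l, is_lim_seq_geom; rewrite Rabs_pos_eq; lra. }
  apply is_lim_seq_spec in h0; destruct (h0 eps) as [N hN]; exists N; intros n hn.
  specialize (hN n hn); rewrite Rminus_0_r in hN; apply Rabs_def2 in hN.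
  eapply Rle_lt_trans; [apply bound|]; lra.
Qed.

(** * The identity theorem on a real segment *)

(** Real analyticity is all that is needed of a holomorphic function along a
    horizontal line, and real power series can be multiplied. *)
Definition ranalytic (f : R -> R) (x : R) : Prop :=
  exists (a : nat -> R) (r : R), 0 < r /\
    forall h, Rabs h < r -> is_pseries a h (f (x + h)).

Lemma CV_radius_gt (a : nat -> R) (r h : R) :
  (forall k, 0 < k < r -> ex_pseries a k) -> Rabs h < r -> Rbar_lt (Rabs h) (CV_radius a).
Proof.
  intros ha hh; assert (hp := Rabs_pos h).
  set (k := (Rabs h + r) / 2).
  assert (hk : Rabs h < k < r) by (unfold k; lra).
  apply Rbar_lt_le_trans with k; [simpl; lra|].
  apply Rbar_not_lt_le; intros hlt.
  apply (CV_disk_outside a k).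
  - rewrite Rabs_pos_eq by lra; exact hlt.
  - apply ex_series_lim_0; destruct (ha k ltac:(lra)) as [l hl].
    exists l; exact (proj1 (is_pseries_R a k l) hl).
Qed.

Lemma ranalytic_ext (f g : R -> R) (x : R) :
  (forall t, f t = g t) -> ranalytic f x -> ranalytic g x.
Proof.
  intros e [a [r [hr ha]]]; exists a, r; split; auto.
  intros h hh; rewrite <- e; auto.
Qed.

Lemma ranalytic_plus (f g : R -> R) (x : R) :
  ranalytic f x -> ranalytic g x -> ranalytic (fun t => f t + g t) x.
Proof.
  intros [a [r [hr ha]]] [b [s [hs hb]]].
  exists (PS_plus a b), (Rmin r s); split; [apply Rmin_glb_lt; auto|].
  intros h hh; assert (h1 := Rmin_l r s); assert (h2 := Rmin_r r s).
  apply (is_pseries_plus a b); [apply ha|apply hb]; lra.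
Qed.

Lemma ranalytic_mult (f g : R -> R) (x : R) :
  ranalytic f x -> ranalytic g x -> ranalytic (fun t => f t * g t) x.
Proof.
  intros [a [r [hr ha]]] [b [s [hs hb]]].
  exists (PS_mult a b), (Rmin r s); split; [apply Rmin_glb_lt; auto|].
  intros h hh; assert (h1 := Rmin_l r s); assert (h2 := Rmin_r r s).
  apply is_pseries_mult; [apply ha; lra|apply hb; lra| |].
  - apply CV_radius_gt with r; [|lra].
    intros k hk; exists (f (x + k)); apply ha; rewrite Rabs_pos_eq; lra.
  - apply CV_radius_gt with s; [|lra].
    intros k hk; exists (g (x + k)); apply hb; rewrite Rabs_pos_eq; lra.
Qed.

Lemma is_series_finite (a : nat -> R) (N : nat) :
  (forall n, (N < n)%nat -> a n = 0) -> is_series a (sum_n a N).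
Proof.
  intros ha; change (is_lim_seq (sum_n a) (sum_n a N)).
  apply (is_lim_seq_ext_loc (fun _ => sum_n a N)); [|apply is_lim_seq_const].
  exists N; intros n hn; induction hn as [|n hn IH]; [reflexivity|].
  rewrite sum_SnR, <- IH, ha by lia; symmetry; apply Rplus_0_r.
Qed.

Lemma ranalytic_affine (p q x : R) : ranalytic (fun t => p * t + q) x.
Proof.
  exists (fun n => match n with O => p * x + q | 1%nat => p | _ => 0 end), 1; split; [lra|].
  intros h _; apply is_pseries_R.
  match goal with |- is_series ?a ?l => replace l with (sum_n a 1) end.
  - apply is_series_finite; intros [|[|n]] hn; try lia; ring.
  - rewrite sum_SnR, sum_O; simpl; ring.
Qed.

Lemma ranalytic_scal (c : R) (f : R -> R) (x : R) :
  ranalytic f x -> ranalytic (fun t => c * f t) x.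
Proof.
  intros hf; apply (ranalytic_ext (fun t => (0 * t + c) * f t)); [intros; ring|].
  apply ranalytic_mult; auto using ranalytic_affine.
Qed.

Lemma pseries_zero_right_const (r : R) (a : nat -> R) : 0 < r ->
  (forall h, 0 < h < r -> is_pseries a h 0) -> a 0%nat = 0.
Proof.
  intros hr ha.
  assert (hc : continuity_pt (PSeries a) 0).
  { apply PSeries_continuity, (CV_radius_gt a r 0); [|rewrite Rabs_R0; auto].
    intros k hk; exists 0; apply ha; exact hk. }
  destruct (Req_dec (a 0%nat) 0) as [e|ne]; [exact e|exfalso].
  destruct (hc (Rabs (a 0%nat)) (Rabs_pos_lt _ ne)) as [d [hd hc']].
  set (h := Rmin d r / 2).
  assert (h1 := Rmin_l d r); assert (h2 := Rmin_r d r).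
  assert (h3 : 0 < Rmin d r) by (apply Rmin_glb_lt; auto).
  specialize (hc' h); simpl in hc'; unfold R_dist in hc'.
  rewrite PSeries_0, (is_pseries_unique _ _ _ (ha h ltac:(unfold h; lra))) in hc'.
  replace (0 - a 0%nat) with (- a 0%nat) in hc' by ring.
  rewrite Rabs_Ropp in hc'; apply (Rlt_irrefl (Rabs (a 0%nat))), hc'.
  split; [split; [exact I|unfold h; lra]|].
  rewrite Rminus_0_r, Rabs_pos_eq; unfold h; lra.
Qed.

(** The constant coefficient is a limit from the right, and the other
    coefficients are those of the quotient by the variable. *)
Lemma pseries_zero_right (r : R) : 0 < r -> forall (n : nat) (a : nat -> R),
  (forall h, 0 < h < r -> is_pseries a h 0) -> a n = 0.
Proof.
  intros hr; induction n as [|n IH]; intros a ha;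
    assert (a0 := pseries_zero_right_const r a hr ha); [exact a0|].
  change (PS_decr_1 a n = 0); apply IH; intros h hh.
  assert (h0 := is_pseries_decr_1 a h (/ h) 0
                  ltac:(unfold mult, one; simpl; field; lra) (ha h hh)).
  replace 0 with (scal (/ h) (plus 0 (opp (a 0%nat)))); [exact h0|].
  unfold scal, plus, opp; simpl; unfold mult; simpl; rewrite a0; toR; field; lra.
Qed.

(** At the left end of the largest interval of zeros, the power series vanishes
    on the right, hence on the left as well. *)
Lemma ranalytic_identity (f : R -> R) (a m b : R) : a <= m < b ->
  (forall x, a <= x <= m -> ranalytic f x) ->
  (forall x, m <= x < b -> f x = 0) -> f a = 0.
Proof.
  intros hab han hz.
  set (E := fun d => 0 <= d <= m - a /\ forall x, m - d <= x < b -> f x = 0).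
  destruct (completeness E) as [d [hub hlub]].
  { exists (m - a); intros d [hd _]; lra. }
  { exists 0; split; [lra|]; intros x hx; apply hz; lra. }
  assert (hd : 0 <= d <= m - a).
  { split.
    - apply hub; split; [lra|]; intros x hx; apply hz; lra.
    - apply hlub; intros d' [h _]; lra. }
  assert (hright : forall x, m - d < x < b -> f x = 0).
  { intros x hx; destruct (Req_dec (f x) 0) as [e|ne]; [exact e|exfalso].
    assert (hx' : d <= m - x); [|lra].
    apply hlub; intros d' [h h']; apply Rnot_lt_le; intros hlt.
    apply ne, h'; lra. }
  destruct (han (m - d) ltac:(lra)) as [c [r [hr hc]]].
  set (r' := Rmin r (b - (m - d))).
  assert (h1 := Rmin_l r (b - (m - d))); assert (h2 := Rmin_r r (b - (m - d))).
  assert (hr' : 0 < r') by (apply Rmin_glb_lt; lra); fold r' in h1, h2.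
  assert (c0 : forall n, c n = 0).
  { intros n; apply (pseries_zero_right r' hr').
    intros h hh; rewrite <- (hright (m - d + h)) by lra.
    apply hc; rewrite Rabs_pos_eq; lra. }
  assert (hloc : forall h, Rabs h < r -> f (m - d + h) = 0).
  { intros h hh; rewrite <- (is_pseries_unique _ _ _ (hc h hh)).
    rewrite (PSeries_ext c (fun _ => 0)) by auto; apply PSeries_const_0. }
  destruct (Req_dec d (m - a)) as [e|ne].
  - replace a with (m - d + 0) by lra; apply hloc; rewrite Rabs_R0; auto.
  - exfalso.
    assert (h3 : 0 < Rmin (r / 2) (m - a - d)) by (apply Rmin_glb_lt; lra).
    assert (h4 := Rmin_l (r / 2) (m - a - d)); assert (h5 := Rmin_r (r / 2) (m - a - d)).
    assert (hE : d + Rmin (r / 2) (m - a - d) <= d); [|lra].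
    apply hub; split; [lra|]; intros x hx.
    destruct (Rlt_le_dec (m - d) x); [apply hright; lra|].
    replace x with (m - d + (x - (m - d))) by ring; apply hloc.
    apply Rabs_def1; lra.
Qed.

(** * Complex series and the Laplace transform *)

Lemma sum_n_C (a : nat -> C) (N : nat) :
  sum_n a N = (sum_n (fun n => fst (a n)) N, sum_n (fun n => snd (a n)) N).
Proof.
  induction N as [|N IH]; [rewrite !sum_O; apply surjective_pairing|].
  rewrite !sum_Sn, IH; reflexivity.
Qed.

Lemma filterlim_C {T : Type} (F : (T -> Prop) -> Prop) {FF : Filter F}
    (f g : T -> R) (l m : R) :
  filterlim f F (locally l) -> filterlim g F (locally m) ->
  filterlim (fun t => (f t, g t) : C) F (@locally C_UniformSpace (l, m)).
Proof.
  intros hf hg P [eps hP].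
  assert (h1 : locally l (fun y => ball l eps y)) by (exists eps; auto).
  assert (h2 : locally m (fun y => ball m eps y)) by (exists eps; auto).
  apply hf in h1; apply hg in h2; unfold filtermap in *.
  generalize (filter_and _ _ h1 h2); apply filter_imp.
  intros t [k1 k2]; apply hP; split; assumption.
Qed.

Lemma is_series_C (a : nat -> C) (l : C) :
  @is_series C_AbsRing C_NormedModule a l <->
  is_series (fun n => fst (a n)) (fst l) /\ is_series (fun n => snd (a n)) (snd l).
Proof.
  split.
  - intros h; split; intros P [eps hP].
    + assert (h' := h (fun z : C => P (fst z)) (ex_intro _ eps (fun z hz => hP _ (proj1 hz)))).
      revert h'; unfold filtermap; apply filter_imp; intros n; now rewrite sum_n_C.
    + assert (h' := h (fun z : C => P (snd z)) (ex_intro _ eps (fun z hz => hP _ (proj2 hz)))).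
      revert h'; unfold filtermap; apply filter_imp; intros n; now rewrite sum_n_C.
  - intros [h1 h2]; destruct l as [l m].
    apply (filterlim_ext (fun N => (sum_n (fun n => fst (a n)) N, sum_n (fun n => snd (a n)) N) : C)).
    + intros N; now rewrite sum_n_C.
    + apply (filterlim_C eventually); assumption.
Qed.

Lemma analytic_at_horizontal (f : C -> C) (x y : R) : analytic_at f (x, y) ->
  ranalytic (fun t => fst (f (t, y))) x /\ ranalytic (fun t => snd (f (t, y))) x.
Proof.
  intros [c [r [hr hc]]].
  assert (h : forall h, Rabs h < r ->
    is_series (fun n => fst (c n) * h ^ n) (fst (f (x + h, y))) /\
    is_series (fun n => snd (c n) * h ^ n) (snd (f (x + h, y)))).
  { intros h hh.
    assert (e : Cminus (x + h, y) (x, y) = RtoC h).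
    { apply injective_projections; simpl; ring. }
    specialize (hc (x + h, y)); rewrite e, Cmod_R in hc; specialize (hc hh).
    apply is_series_C in hc.
    assert (p : forall n, @pow_n C_Ring (RtoC h) n = RtoC (h ^ n)).
    { induction n as [|n IH]; [reflexivity|].
      change (Cmult (RtoC h) (@pow_n C_Ring (RtoC h) n) = RtoC (h * h ^ n)).
      now rewrite IH, RtoC_mult. }
    destruct hc as [h1 h2]; split.
    - revert h1; apply is_series_ext; intros n; rewrite p; simpl; ring.
    - revert h2; apply is_series_ext; intros n; rewrite p; simpl; ring. }
  split; [exists (fun n => fst (c n)), r|exists (fun n => snd (c n)), r];
    (split; [exact hr|intros k hk]).
  - apply is_pseries_R; exact (proj1 (h k hk)).
  - apply is_pseries_R; exact (proj2 (h k hk)).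
Qed.

(** The two-sided Laplace transform, with the sign of a Mellin transform:
    for [x = exp u] it integrates [w u] against [x^(s - 1) dx]. *)
Definition laplace (w : R -> R) (s : C) : C :=
  (line_integral (fun u => w u * exp (fst s * u) * cos (snd s * u)),
   line_integral (fun u => w u * exp (fst s * u) * sin (snd s * u))).

Definition laplace_domain (w : R -> R) (x : R) : Prop :=
  exists B, decays1 B (fun u => w u * exp (x * u)).

Lemma Rabs_cos_le_1 (t : R) : Rabs (cos t) <= 1.
Proof. apply Rabs_le_between; assert (h := COS_bound t); lra. Qed.

Lemma Rabs_sin_le_1 (t : R) : Rabs (sin t) <= 1.
Proof. apply Rabs_le_between; assert (h := SIN_bound t); lra. Qed.

Lemma decays_cos (B x y : R) (w : R -> R) : decays1 B (fun u => w u * exp (x * u)) ->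
  decays B (fun u => w u * exp (x * u) * cos (y * u)).
Proof.
  intros h; apply decays1_bounded; auto; intros u; [cont|apply Rabs_cos_le_1].
Qed.

Lemma decays_sin (B x y : R) (w : R -> R) : decays1 B (fun u => w u * exp (x * u)) ->
  decays B (fun u => w u * exp (x * u) * sin (y * u)).
Proof.
  intros h; apply decays1_bounded; auto; intros u; [cont|apply Rabs_sin_le_1].
Qed.

Lemma decays1_trig (B : R) (f g : R -> R) : decays1 B f ->
  (forall u, continuous g u) -> (forall u, Rabs (g u) <= 1) ->
  decays1 B (fun u => f u * g u).
Proof.
  intros [cf bf] cg bg; split; [intros; cont|].
  intros u; rewrite Rabs_mult, <- (Rmult_1_r (B * _)).
  apply Rmult_le_compat; auto using Rabs_pos.
Qed.

Lemma laplace_ranalytic (w : R -> R) (x y : R) : laplace_domain w x ->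
  ranalytic (fun t => fst (laplace w (t, y))) x /\
  ranalytic (fun t => snd (laplace w (t, y))) x.
Proof.
  intros [B hB].
  assert (gen : forall g, (forall u, continuous g u) -> (forall u, Rabs (g u) <= 1) ->
     ranalytic (fun t => line_integral (fun u => w u * exp (t * u) * g u)) x).
  { intros g cg bg; assert (h := decays1_trig B _ g hB cg bg).
    eexists; exists (/ 4); split; [lra|]; intros k hk.
    assert (e : forall u, w u * exp ((x + k) * u) * g u
        = (fun u => w u * exp (x * u) * g u) u * exp (k * u)).
    { intros u; simpl; rewrite Rmult_plus_distr_r, exp_plus; ring. }
    rewrite (line_integral_ext _ _ e).
    apply (is_pseries_line_integral_exp B); [exact h|lra]. }
  split.
  - apply (gen (fun u => cos (y * u))); intros u; [cont|apply Rabs_cos_le_1].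
  - apply (gen (fun u => sin (y * u))); intros u; [cont|apply Rabs_sin_le_1].
Qed.

Lemma laplace_plus (v w : R -> R) (s : C) :
  laplace_domain v (fst s) -> laplace_domain w (fst s) ->
  laplace (fun u => v u + w u) s = (laplace v s + laplace w s)%C.
Proof.
  intros [B hv] [B' hw]; unfold laplace, Cplus; simpl; f_equal.
  - rewrite <- (line_integral_plus B B') by (apply decays_cos; auto).
    apply line_integral_ext; intros; ring.
  - rewrite <- (line_integral_plus B B') by (apply decays_sin; auto).
    apply line_integral_ext; intros; ring.
Qed.

Lemma laplace_ext (v w : R -> R) (s : C) :
  (forall u, v u = w u) -> laplace v s = laplace w s.
Proof.
  intros e; unfold laplace; f_equal; apply line_integral_ext; intros u; now rewrite e.
Qed.

Lemma laplace_domain_plus (v w : R -> R) (x : R) :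
  laplace_domain v x -> laplace_domain w x -> laplace_domain (fun u => v u + w u) x.
Proof.
  intros [B [cv bv]] [B' [cw bw]]; exists (B + B'); split.
  - intros u; apply (continuous_ext (fun u => v u * exp (x * u) + w u * exp (x * u))).
    + intros; toR; ring.
    + cont.
  - intros u; rewrite Rmult_plus_distr_r; eapply Rle_trans; [apply Rabs_triang|].
    specialize (bv u); specialize (bw u); lra.
Qed.

(** A translation of [u] dilates [x]: this produces the factors [n^(-s)]. *)
Lemma laplace_shift (w : R -> R) (b : R) (s : C) : laplace_domain w (fst s) ->
  laplace (fun u => w (u + b)) s = (Cexp (- s * RtoC b) * laplace w s)%C.
Proof.
  intros [B hw]; destruct s as [x y]; simpl in hw.
  assert (hc := decays_cos B x y w hw); assert (hs := decays_sin B x y w hw).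
  assert (hlin : forall p q,
     exists C, decays C (fun u => p * (w u * exp (x * u) * cos (y * u))
                                + q * (w u * exp (x * u) * sin (y * u)))).
  { intros p q; eexists; apply decays_plus; apply decays_scal; eassumption. }
  assert (hval : forall p q,
     line_integral (fun u => p * (w u * exp (x * u) * cos (y * u))
                           + q * (w u * exp (x * u) * sin (y * u)))
     = p * line_integral (fun u => w u * exp (x * u) * cos (y * u))
       + q * line_integral (fun u => w u * exp (x * u) * sin (y * u))).
  { intros p q; rewrite <- (line_integral_scal B p), <- (line_integral_scal B q) by auto.
    apply (line_integral_plus (Rabs p * B) (Rabs q * B)); apply decays_scal; auto. }
  assert (hsh : forall p q, 
     line_integral (fun u => p * (w (u + b) * exp (x * (u + b)) * cos (y * (u + b)))
                           + q * (w (u + b) * exp (x * (u + b)) * sin (y * (u + b))))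
     = p * line_integral (fun u => w u * exp (x * u) * cos (y * u))
       + q * line_integral (fun u => w u * exp (x * u) * sin (y * u))).
  { intros p q; destruct (hlin p q) as [C hC]; rewrite <- hval.
    exact (line_integral_shift C b _ hC). }
  assert (e1 : forall u, exp (x * u) = exp (- (x * b)) * exp (x * (u + b))).
  { intros u; rewrite <- exp_plus; f_equal; ring. }
  assert (e2 : forall u, y * u = y * (u + b) - y * b) by (intros; ring).
  unfold laplace, Cexp, Cmult, Copp, RtoC, Re, Im; simpl.
  replace (- x * b - - y * 0) with (- (x * b)) by ring.
  replace (- x * 0 + - y * b) with (- (y * b)) by ring.
  rewrite cos_neg, sin_neg.
  f_equal.
  - rewrite (line_integral_ext _ (fun u =>
        (exp (- (x * b)) * cos (y * b)) * (w (u + b) * exp (x * (u + b)) * cos (y * (u + b)))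
      + (exp (- (x * b)) * sin (y * b)) * (w (u + b) * exp (x * (u + b)) * sin (y * (u + b))))).
    + rewrite hsh; ring.
    + intros u; rewrite (e1 u), (e2 u), cos_minus; ring.
  - rewrite (line_integral_ext _ (fun u =>
        (- (exp (- (x * b)) * sin (y * b))) * (w (u + b) * exp (x * (u + b)) * cos (y * (u + b)))
      + (exp (- (x * b)) * cos (y * b)) * (w (u + b) * exp (x * (u + b)) * sin (y * (u + b))))).
    + rewrite hsh; ring.
    + intros u; rewrite (e1 u), (e2 u), sin_minus; ring.
Qed.

(** The exponential rates of [w] at both ends determine a strip where [laplace]
    converges with decay of rate [1]. *)
Lemma laplace_domain_of_rates (w : R -> R) (B p q x : R) :
  (forall u, continuous w u) ->
  (forall u, u <= 0 -> Rabs (w u) <= B * exp (p * u)) ->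
  (forall u, 0 <= u -> Rabs (w u) <= B * exp (- (q * u))) ->
  1 <= p + x -> 1 <= q - x -> decays1 B (fun u => w u * exp (x * u)).
Proof.
  intros cw bl br hp hq; split; [intros; cont|].
  assert (hB : 0 <= B).
  { assert (h := bl 0 (Rle_refl 0)); rewrite Rmult_0_r, exp_0 in h.
    assert (h' := Rabs_pos (w 0)); lra. }
  intros u; assert (he := exp_pos (x * u)).
  rewrite Rabs_mult, (Rabs_pos_eq (exp _)) by lra.
  destruct (Rle_lt_dec u 0) as [hu|hu].
  - apply Rle_trans with (B * exp (p * u) * exp (x * u)).
    + apply Rmult_le_compat_r; [lra|auto].
    + rewrite Rmult_assoc, <- exp_plus, Rabs_left1 by auto.
      apply Rmult_le_compat_l; auto; apply exp_le; nra.
  - apply Rle_trans with (B * exp (- (q * u)) * exp (x * u)).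
    + apply Rmult_le_compat_r; [lra|apply br; lra].
    + rewrite Rmult_assoc, <- exp_plus, Rabs_pos_eq by lra.
      apply Rmult_le_compat_l; auto; apply exp_le; nra.
Qed.

(** * The weights *)

(** Its transform at [s] is [Gamma (s + 1)]: Euler's integral with [t = exp u]. *)
Definition gamma_weight (u : R) : R := exp u * exp (- exp u).

(** The opposite of the derivative of [u |-> coth (exp u)]. *)
Definition csch2_weight (u : R) : R := exp u / sinh (exp u) ^ 2.

(** The sum of [csch2_weight] and its derivative.  The combination kills the
    behaviour [exp (- u)] of [csch2_weight] at minus infinity, so its transform
    converges for [Re s > -1] while that of [csch2_weight] needs [Re s > 1]. *)
Definition regular_weight (u : R) : R :=
  2 * exp u * (sinh (exp u) - exp u * cosh (exp u)) / sinh (exp u) ^ 3.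

Lemma sinh_exp_pos (u : R) : 0 < sinh (exp u).
Proof. apply sinh_pos, exp_pos. Qed.

Lemma is_derive_csch2_weight (u : R) :
  is_derive csch2_weight u (regular_weight u - csch2_weight u).
Proof.
  assert (h := sinh_exp_pos u); unfold sinh in h.
  unfold csch2_weight, regular_weight, cosh, sinh; auto_derive.
  - apply Rgt_not_eq; repeat apply Rmult_lt_0_compat; lra.
  - toR; unfold Rdiv, Rminus in *; field; lra.
Qed.

Lemma csch2_weight_continuous (u : R) : continuous csch2_weight u.
Proof.
  apply (ex_derive_continuous csch2_weight); eexists; apply is_derive_csch2_weight.
Qed.

Lemma regular_weight_continuous (u : R) : continuous regular_weight u.
Proof.
  assert (h := sinh_exp_pos u); unfold sinh in h.
  apply (ex_derive_continuous regular_weight); unfold regular_weight, cosh, sinh.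
  auto_derive; apply Rgt_not_eq; repeat apply Rmult_lt_0_compat; lra.
Qed.

Lemma gamma_weight_continuous (u : R) : continuous gamma_weight u.
Proof. unfold gamma_weight; cont. Qed.

Lemma exp_mult_nat (n : nat) (u : R) : exp (INR n * u) = exp u ^ n.
Proof.
  induction n as [|n IH]; [rewrite Rmult_0_l, exp_0; reflexivity|].
  rewrite S_INR, Rmult_plus_distr_r, exp_plus, IH, Rmult_1_l; simpl; ring.
Qed.

Lemma pow_exp_neg_le (n : nat) (z : R) : 0 < z -> exp (- z) <= INR (fact n) / z ^ n.
Proof.
  intros hz; rewrite exp_Ropp.
  assert (hf := INR_fact_lt_0 n); assert (hp : 0 < z ^ n) by (apply pow_lt; auto).
  replace (INR (fact n) / z ^ n) with (/ (z ^ n / INR (fact n))) by (field; lra).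
  apply Rinv_le_contravar; [apply Rdiv_lt_0_compat; auto|apply exp_term_le; lra].
Qed.

Lemma exp_1_mult (u : R) : exp (1 * u) = exp u.
Proof. now rewrite Rmult_1_l. Qed.

Lemma exp_neg_5 (u : R) : exp (- (5 * u)) = / exp u ^ 5.
Proof.
  rewrite exp_Ropp; f_equal; replace 5 with (INR 5) by (simpl; ring); apply exp_mult_nat.
Qed.

Lemma gamma_weight_decays (x : R) : 0 <= x <= 4 ->
  decays1 720 (fun u => gamma_weight u * exp (x * u)).
Proof.
  intros hx; apply (laplace_domain_of_rates _ _ 1 5); try lra;
    [apply gamma_weight_continuous| |]; intros u hu;
    assert (hX := exp_pos u); assert (h1 := exp_pos (- exp u));
    unfold gamma_weight; rewrite Rabs_pos_eq by nra.
  - rewrite exp_1_mult; assert (h2 := exp_neg_le_1 (exp u)); nra.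
  - rewrite exp_neg_5.
    apply Rle_trans with (exp u * (INR (fact 6) / exp u ^ 6)).
    + apply Rmult_le_compat_l; [lra|apply pow_exp_neg_le; auto].
    + replace (INR (fact 6)) with 720 by (simpl; ring); right; field; lra.
Qed.

Lemma sinh_ge_pow4 (x : R) : 1 <= x -> x ^ 4 / 96 <= sinh x.
Proof.
  intros hx.
  assert (h1 : exp (- x) * exp (- x) <= / 2).
  { rewrite <- exp_plus; replace (- x + - x) with (- (2 * x)) by ring.
    rewrite exp_Ropp; apply Rinv_le_contravar; [lra|].
    assert (h := exp_ineq1_le (2 * x)); lra. }
  assert (h2 : exp (- x) * exp x = 1) by (rewrite <- exp_plus, Rplus_opp_l; apply exp_0).
  assert (h3 := exp_pos x); assert (h4 := exp_pos (- x)).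
  assert (h5 := exp_term_le x 4 ltac:(lra)).
  replace (INR (fact 4)) with 24 in h5 by (simpl; ring).
  unfold sinh; assert (exp (- x) <= exp x / 2); [|lra].
  replace (exp (- x)) with ((exp (- x) * exp (- x)) * exp x) by (rewrite Rmult_assoc, h2; ring).
  nra.
Qed.

Lemma regular_weight_decays (x : R) : 0 <= x <= 4 ->
  decays1 18432 (fun u => regular_weight u * exp (x * u)).
Proof.
  intros hx.
  assert (b : forall u, Rabs (regular_weight u) <= 2 * exp u ^ 3 / sinh (exp u) ^ 2).
  { intros u; set (X := exp u); assert (hX : 0 < X) by apply exp_pos.
    assert (hs : 0 < sinh X) by (apply sinh_pos; auto).
    assert (h1 := sinh_le_x_cosh X); assert (h2 := x_cosh_sub_sinh_le X).
    replace (regular_weight u) with (- (2 * X * (X * cosh X - sinh X) / sinh X ^ 3))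
      by (unfold regular_weight; fold X; field; lra).
    assert (hp : 0 < sinh X ^ 3) by (apply pow_lt; auto).
    rewrite Rabs_Ropp, Rabs_pos_eq by (apply Rdiv_le_0_compat; [apply Rmult_le_pos; lra|auto]).
    replace (2 * X ^ 3 / sinh X ^ 2) with (2 * X * (X * X * sinh X) / sinh X ^ 3) by (field; lra).
    apply Rmult_le_compat_r; [apply Rlt_le, Rinv_0_lt_compat; auto|].
    apply Rmult_le_compat_l; lra. }
  apply (laplace_domain_of_rates _ _ 1 5); try lra;
    [apply regular_weight_continuous| |]; intros u hu; eapply Rle_trans; try apply b;
    assert (hX := exp_pos u); assert (hs := sinh_exp_pos u).
  - rewrite exp_1_mult.
    assert (h := sinh_ge (exp u)).
    apply Rle_div_l; [apply pow_lt; auto|].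
    assert (exp u ^ 2 <= sinh (exp u) ^ 2) by (apply pow_incr; lra).
    replace (2 * exp u ^ 3) with (2 * exp u * exp u ^ 2) by ring.
    assert (0 <= exp u * (sinh (exp u) ^ 2)) by (apply Rmult_le_pos; nra).
    nra.
  - rewrite exp_neg_5.
    assert (hX1 : 1 <= exp u) by (rewrite <- exp_0; apply exp_le; auto).
    assert (h := sinh_ge_pow4 (exp u) hX1).
    assert (h4 : 0 < exp u ^ 4) by (apply pow_lt; auto).
    apply Rle_div_l; [apply pow_lt; auto|].
    assert (h2 : (exp u ^ 4 / 96) ^ 2 <= sinh (exp u) ^ 2) by (apply pow_incr; lra).
    (* 18432 = 2 * 96 ^ 2, with 96 from the lower bound of sinh. *)
    apply Rle_trans with (18432 * / exp u ^ 5 * (exp u ^ 4 / 96) ^ 2).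
    + right; field; lra.
    + apply Rmult_le_compat_l; auto.
      apply Rmult_le_pos; [lra|apply Rlt_le, Rinv_0_lt_compat, pow_lt; auto].
Qed.

(** * The Dirichlet series and the exponential series *)

(** Its transform at [s] is [2^(-s) Gamma (s + 1)]. *)
Definition gamma_weight2 (u : R) : R := gamma_weight (u + ln 2).

Lemma gamma_weight_ln (c u : R) : 0 < c ->
  gamma_weight (u + ln c) = c * exp u * exp (- (c * exp u)).
Proof.
  intros hc; unfold gamma_weight; rewrite exp_plus, exp_ln by auto.
  now rewrite (Rmult_comm (exp u) c).
Qed.

Lemma gamma_weight2_decays (x : R) : 0 <= x <= 4 ->
  decays1 720 (fun u => gamma_weight2 u * exp (x * u)).
Proof.
  intros hx; unfold gamma_weight2; apply (laplace_domain_of_rates _ _ 1 5); try lra; [| |].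
  - intros u; unfold gamma_weight; cont.
  - intros u hu; assert (hX := exp_pos u).
    rewrite gamma_weight_ln by lra; rewrite exp_1_mult.
    assert (h1 := exp_pos (- (2 * exp u))); assert (h2 := exp_neg_le_1 (2 * exp u)).
    rewrite Rabs_pos_eq by nra; nra.
  - intros u hu; assert (hX := exp_pos u).
    rewrite gamma_weight_ln by lra; rewrite exp_neg_5.
    assert (h1 := exp_pos (- (2 * exp u))).
    rewrite Rabs_pos_eq by nra.
    assert (h2 := pow_exp_neg_le 6 (2 * exp u) ltac:(lra)).
    replace (INR (fact 6)) with 720 in h2 by (simpl; ring).
    apply Rle_trans with (2 * exp u * (720 / (2 * exp u) ^ 6)).
    + apply Rmult_le_compat_l; [lra|exact h2].
    + replace (2 * exp u * (720 / (2 * exp u) ^ 6)) with (45 / 2 * / exp u ^ 5) by (field; lra).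
      apply Rmult_le_compat_r; [apply Rlt_le, Rinv_0_lt_compat, pow_lt; auto|lra].
Qed.

(** Its transform at [s] is the [n]-th term of the Dirichlet series of zeta
    times [2^(-s) Gamma (s + 1)]. *)
Definition dirichlet_weight (n : nat) (u : R) : R := gamma_weight2 (u + ln (INR (S n))).

Lemma dirichlet_weight_eq (n : nat) (u : R) :
  dirichlet_weight n u = 2 * INR (S n) * exp u * exp (- (2 * INR (S n) * exp u)).
Proof.
  assert (hn : 0 < INR (S n)) by (apply lt_0_INR; lia).
  unfold dirichlet_weight, gamma_weight2.
  rewrite Rplus_assoc, <- ln_mult, gamma_weight_ln by lra.
  rewrite (Rmult_comm (INR (S n)) 2); reflexivity.
Qed.

(** From [z exp (-z) <= 6 / z^2] and [z exp (-z) <= 720 / z^5], with [z = 2 n exp u]: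
    the two rates are what [Re s] between [3] and [4] asks for. *)
Lemma dirichlet_weight_bound (n : nat) (u : R) :
  Rabs (dirichlet_weight n u) <= 23 * exp (- (2 * u)) / INR (S n) ^ 2 /\
  Rabs (dirichlet_weight n u) <= 23 * exp (- (5 * u)) / INR (S n) ^ 2.
Proof.
  assert (hn : 1 <= INR (S n)) by (rewrite S_INR; assert (h := pos_INR n); lra).
  assert (hX := exp_pos u).
  rewrite dirichlet_weight_eq, exp_neg_5.
  replace (exp (- (2 * u))) with (/ exp u ^ 2)
    by (rewrite exp_Ropp; f_equal; symmetry; replace 2 with (INR 2) by (simpl; ring);
        apply exp_mult_nat).
  set (X := exp u) in *; set (m := INR (S n)) in *; set (z := 2 * m * X).
  assert (hm : 0 < m) by lra.
  assert (hz : 0 < z) by (unfold z; apply Rmult_lt_0_compat; lra).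
  rewrite Rabs_pos_eq by (apply Rmult_le_pos; [lra|apply Rlt_le, exp_pos]).
  split.
  - apply Rle_trans with (z * (INR (fact 3) / z ^ 3)).
    + apply Rmult_le_compat_l; [lra|apply pow_exp_neg_le; auto].
    + replace (INR (fact 3)) with 6 by (simpl; ring).
      replace (z * (6 / z ^ 3)) with (3 / 2 * / X ^ 2 / m ^ 2) by (unfold z; field; lra).
      apply Rmult_le_compat_r; [apply Rlt_le, Rinv_0_lt_compat, pow_lt; auto|].
      apply Rmult_le_compat_r; [apply Rlt_le, Rinv_0_lt_compat, pow_lt; auto|lra].
  - apply Rle_trans with (z * (INR (fact 6) / z ^ 6)).
    + apply Rmult_le_compat_l; [lra|apply pow_exp_neg_le; auto].
    + replace (INR (fact 6)) with 720 by (simpl; ring).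
      replace (z * (720 / z ^ 6)) with ((45 / 2 * / X ^ 5) * / m ^ 5) by (unfold z; field; lra).
      apply Rmult_le_compat.
      * apply Rmult_le_pos; [lra|apply Rlt_le, Rinv_0_lt_compat, pow_lt; auto].
      * apply Rlt_le, Rinv_0_lt_compat, pow_lt; auto.
      * apply Rmult_le_compat_r; [apply Rlt_le, Rinv_0_lt_compat, pow_lt; auto|lra].
      * apply Rinv_le_contravar; [apply pow_lt; auto|apply Rle_pow; [auto|lia]].
Qed.

(** With [q = exp (- 2 X)], the series is [2 X] times [sum n q^n], which
    telescopes to [q / (1 - q)^2 = 1 / (4 sinh X ^ 2)]. *)
Lemma dirichlet_weight_series (u : R) :
  is_series (fun n => dirichlet_weight n u) (csch2_weight u / 2).
Proof.
  assert (hX := exp_pos u); set (X := exp u) in *.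
  set (q := exp (- (2 * X))).
  assert (hq0 : 0 < q) by apply exp_pos.
  assert (hq : q < 1) by (unfold q; rewrite <- exp_0; apply exp_increasing; lra).
  assert (term : forall n, dirichlet_weight n u = 2 * X * (INR (S n) * q ^ S n)).
  { intros n; rewrite dirichlet_weight_eq; fold X; unfold q.
    replace (- (2 * INR (S n) * X)) with (INR (S n) * - (2 * X)) by ring.
    rewrite exp_mult_nat; ring. }
  assert (ser : ex_series (fun n => dirichlet_weight n u)).
  { apply (ex_series_inv_sqr _ (23 * exp (- (2 * u)))); intros n; apply dirichlet_weight_bound. }
  (* The sum of the terms of rank at least n. *)
  set (r := fun n => 2 * X * q ^ S n * (INR (S n) / (1 - q) + q / (1 - q) ^ 2)).
  assert (lim : is_lim_seq r 0).
  { apply (is_lim_seq_ext (fun n => dirichlet_weight n u * / (1 - q) + (2 * X * q ^ S n) * (q / (1 - q) ^ 2))).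
    { intros n; rewrite term; unfold r; field; lra. }
    replace (Finite 0) with (Finite (0 * / (1 - q) + (2 * X * 0) * (q / (1 - q) ^ 2)))
      by (f_equal; ring).
    apply is_lim_seq_plus'.
    - apply (is_lim_seq_scal_r _ (/ (1 - q)) 0), ex_series_lim_0, ser.
    - apply (is_lim_seq_scal_r _ (q / (1 - q) ^ 2) (2 * X * 0)).
      apply (is_lim_seq_scal_l _ (2 * X) 0), (is_lim_seq_incr_1 (fun n => q ^ n)).
      apply is_lim_seq_geom; rewrite Rabs_pos_eq; lra. }
  apply (is_series_ext (fun n => - (r (S n) - r n))).
  { intros n; rewrite term; unfold r; rewrite !(S_INR (S n)); simpl pow; toR; field; lra. }
  replace (csch2_weight u / 2) with (- (0 - r 0%nat)).
  - apply (is_series_opp (fun n => r (S n) - r n)), is_series_telescope, lim.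
  - unfold r, csch2_weight; fold X; simpl INR; simpl pow.
    assert (hs : 0 < sinh X) by (apply sinh_pos; auto).
    assert (e : (1 - q) * (1 - q) = 4 * q * (sinh X * sinh X)).
    { unfold q, sinh; replace (- (2 * X)) with (- X + - X) by ring.
      rewrite exp_plus.
      assert (h : exp (- X) * exp X = 1) by (rewrite <- exp_plus, Rplus_opp_l; apply exp_0).
      set (p := exp X) in *; set (p' := exp (- X)) in *.
      replace (4 * (p' * p') * ((p - p') / 2 * ((p - p') / 2)))
        with ((p' * p - p' * p') * (p' * p - p' * p')) by field.
      rewrite h; ring. }
    replace (- (0 - 2 * X * (q * 1) * (1 / (1 - q) + q / ((1 - q) * ((1 - q) * 1)))))
      with (2 * X * q / ((1 - q) * (1 - q))) by (field; lra).
    rewrite e; field; lra.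
Qed.

Lemma dirichlet_weight_continuous (n : nat) (u : R) : continuous (dirichlet_weight n) u.
Proof.
  apply (continuous_ext (fun u => 2 * INR (S n) * exp u * exp (- (2 * INR (S n) * exp u)))).
  - intros t; symmetry; apply dirichlet_weight_eq.
  - cont.
Qed.

Definition dirichlet_rest (N : nat) (u : R) : R :=
  csch2_weight u / 2 - sum_n (fun n => dirichlet_weight n u) N.

Lemma dirichlet_rest_decays (N : nat) (x : R) : 3 <= x <= 4 ->
  decays1 (23 / INR (S N)) (fun u => dirichlet_rest N u * exp (x * u)).
Proof.
  intros hx.
  assert (hN : 0 < INR (S N)) by (apply lt_0_INR; lia).
  assert (cs : forall N u, continuous (fun u => sum_n (fun n => dirichlet_weight n u) N) u).
  { clear; induction N as [|N IH]; intros u.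
    - apply (continuous_ext (dirichlet_weight 0%nat));
        [intros y; now rewrite sum_O|apply dirichlet_weight_continuous].
    - apply (continuous_ext
        (fun u => sum_n (fun n => dirichlet_weight n u) N + dirichlet_weight (S N) u)).
      + intros y; now rewrite sum_SnR.
      + apply continuous_Rplus; [apply IH|apply dirichlet_weight_continuous]. }
  apply (laplace_domain_of_rates _ _ (-2) 5); try lra.
  - intros u; unfold dirichlet_rest; apply continuous_Rminus; [|apply cs].
    apply continuous_Rmult; [apply csch2_weight_continuous|apply continuous_const].
  - intros u _; replace (-2 * u) with (- (2 * u)) by ring.
    replace (23 / INR (S N) * exp (- (2 * u))) with (23 * exp (- (2 * u)) / INR (S N))
      by (field; lra).
    apply (series_tail_inv_sqr (fun n => dirichlet_weight n u)).
    + intros n; apply dirichlet_weight_bound.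
    + apply dirichlet_weight_series.
  - intros u _.
    replace (23 / INR (S N) * exp (- (5 * u))) with (23 * exp (- (5 * u)) / INR (S N))
      by (field; lra).
    apply (series_tail_inv_sqr (fun n => dirichlet_weight n u)).
    + intros n; apply dirichlet_weight_bound.
    + apply dirichlet_weight_series.
Qed.

Lemma laplace_dirichlet_sum (N : nat) (s : C) : 0 <= fst s <= 4 ->
  laplace (fun u => sum_n (fun n => dirichlet_weight n u) N) s
  = (sum_n (fun n => cpower (INR (S n)) (- s)%C) N * laplace gamma_weight2 s)%C /\
  laplace_domain (fun u => sum_n (fun n => dirichlet_weight n u) N) (fst s).
Proof.
  intros hx.
  assert (dom : laplace_domain gamma_weight2 (fst s)).
  { exists 720; apply gamma_weight2_decays; auto. }
  assert (one : forall n, laplace (dirichlet_weight n) s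
                  = (cpower (INR (S n)) (- s)%C * laplace gamma_weight2 s)%C).
  { intros n; apply (laplace_shift gamma_weight2 (ln (INR (S n))) s dom). }
  assert (done : forall n, laplace_domain (dirichlet_weight n) (fst s)).
  { intros n.
    assert (hn : 0 <= ln (INR (S n))).
    { rewrite <- ln_1; apply ln_le; [lra|rewrite S_INR; assert (h := pos_INR n); lra]. }
    destruct dom as [B [c b]].
    exists (B * exp (- (fst s * ln (INR (S n)))) * exp (ln (INR (S n)))).
    split.
    - intros u; apply continuous_Rmult; [apply dirichlet_weight_continuous|cont].
    - intros u; specialize (b (u + ln (INR (S n)))).
      replace (dirichlet_weight n u * exp (fst s * u))
        with (exp (- (fst s * ln (INR (S n))))
          * (gamma_weight2 (u + ln (INR (S n))) * exp (fst s * (u + ln (INR (S n)))))).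
      2:{ unfold dirichlet_weight.
          rewrite (Rmult_plus_distr_l (fst s)), exp_plus, exp_Ropp; field.
          apply Rgt_not_eq, exp_pos. }
      assert (he := exp_pos (- (fst s * ln (INR (S n))))).
      rewrite Rabs_mult, (Rabs_pos_eq (exp _)) by lra.
      replace (B * exp (- (fst s * ln (INR (S n)))) * exp (ln (INR (S n))) * exp (- Rabs u))
        with (exp (- (fst s * ln (INR (S n)))) * (B * exp (ln (INR (S n)) - Rabs u)))
        by (unfold Rminus; rewrite exp_plus; ring).
      apply Rmult_le_compat_l; [lra|].
      eapply Rle_trans; [apply b|].
      apply Rmult_le_compat_l.
      + assert (h := Rabs_pos (gamma_weight2 (u + ln (INR (S n)))
                        * exp (fst s * (u + ln (INR (S n)))))).
        assert (h' := exp_pos (- Rabs (u + ln (INR (S n))))); nra.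
      + apply exp_le.
        assert (h := Rabs_triang (u + ln (INR (S n))) (- ln (INR (S n)))).
        rewrite Rabs_Ropp, (Rabs_pos_eq (ln _)) in h by auto.
        replace (u + ln (INR (S n)) + - ln (INR (S n))) with u in h by ring; lra. }
  induction N as [|N [IH1 IH2]].
  - split.
    + rewrite (laplace_ext _ (dirichlet_weight 0%nat)), one, sum_O; [reflexivity|].
      intros; now rewrite sum_O.
    + destruct (done 0%nat) as [B [c b]]; exists B; split; intros u.
      * eapply continuous_ext; [|apply c]; intros t; simpl; now rewrite sum_O.
      * rewrite sum_O; apply b.
  - split.
    + rewrite (laplace_ext _ (fun u => sum_n (fun n => dirichlet_weight n u) N
          + dirichlet_weight (S N) u)) by (intros; apply sum_SnR).
      rewrite laplace_plus, IH1, one, sum_Sn by auto.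
      unfold plus; simpl; ring.
    + destruct (laplace_domain_plus _ _ _ IH2 (done (S N))) as [B [c b]].
      exists B; split; intros u.
      * eapply continuous_ext; [|apply c]; intros t; simpl; now rewrite sum_SnR.
      * rewrite sum_SnR; apply b.
Qed.

Lemma half_csch2_weight_domain (x : R) : 3 <= x <= 4 ->
  laplace_domain (fun u => csch2_weight u / 2) x.
Proof.
  intros hx; assert (hx' : 0 <= fst (x, 0) <= 4) by (simpl; lra).
  assert (dr : laplace_domain (dirichlet_rest 0) x)
    by (eexists; apply dirichlet_rest_decays; exact hx).
  destruct (laplace_domain_plus _ _ _ (proj2 (laplace_dirichlet_sum 0 (x, 0) hx')) dr)
    as [B [c b]].
  assert (e0 : forall u, sum_n (fun n => dirichlet_weight n u) 0 + dirichlet_rest 0 u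
                = csch2_weight u / 2) by (intros; unfold dirichlet_rest; ring).
  exists B; split; intros u.
  - eapply continuous_ext; [|apply c]; intros t; simpl; now rewrite e0.
  - rewrite <- e0; apply b.
Qed.

Lemma csch2_weight_domain (x : R) : 3 <= x <= 4 -> laplace_domain csch2_weight x.
Proof.
  intros hx; assert (h := half_csch2_weight_domain x hx).
  destruct (laplace_domain_plus _ _ _ h h) as [B [c b]]; exists B; split; intros u.
  - eapply continuous_ext; [|apply c]; intros t; simpl; toR; field.
  - replace (csch2_weight u) with (csch2_weight u / 2 + csch2_weight u / 2) by field; apply b.
Qed.

(** Summation under the integral: the remainder of the series of weights is
    [O(1/N)], uniformly against an integrable function. *)
Lemma laplace_csch2_weight (l s : C) : 3 <= fst s <= 4 ->
  @is_series C_AbsRing C_NormedModule (fun n => cpower (INR (S n)) (- s)%C) l ->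
  laplace csch2_weight s = (2 * (l * laplace gamma_weight2 s))%C.
Proof.
  intros hx hl; assert (hx' : 0 <= fst s <= 4) by lra.
  set (G := laplace gamma_weight2 s).
  apply is_series_C in hl; destruct hl as [hl1 hl2].
  set (Z1 := fun N => sum_n (fun n => fst (cpower (INR (S n)) (- s)%C)) N : R).
  set (Z2 := fun N => sum_n (fun n => snd (cpower (INR (S n)) (- s)%C)) N : R).
  assert (dr : forall N, laplace_domain (dirichlet_rest N) (fst s)).
  { intros N; eexists; apply dirichlet_rest_decays; auto. }
  assert (e : forall N, laplace (fun u => csch2_weight u / 2) s
     = ((Z1 N, Z2 N) * G + laplace (dirichlet_rest N) s)%C).
  { intros N; destruct (laplace_dirichlet_sum N s hx') as [h1 h2].
    rewrite (laplace_ext _ (fun u => sum_n (fun n => dirichlet_weight n u) N + dirichlet_rest N u))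
      by (intros u; unfold dirichlet_rest; ring).
    rewrite laplace_plus, h1, sum_n_C by auto; reflexivity. }
  assert (small : forall N, Rabs (fst (laplace (dirichlet_rest N) s)) <= 92 / INR (S N)
                  /\ Rabs (snd (laplace (dirichlet_rest N) s)) <= 92 / INR (S N)).
  { intros N; replace (92 / INR (S N)) with (4 * (23 / INR (S N)))
      by (field; apply not_0_INR; lia).
    split; apply line_integral_bound;
      [apply decays_cos|apply decays_sin]; apply dirichlet_rest_decays; auto. }
  assert (tends : forall v : nat -> R, (forall N, Rabs (v N) <= 92 / INR (S N)) -> is_lim_seq v 0).
  { intros v hv; apply is_lim_seq_abs_0.
    apply (is_lim_seq_le_le (fun _ => 0) _ (fun N => 92 / INR (S N))).
    - intros N; split; [apply Rabs_pos|apply hv].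
    - apply is_lim_seq_const.
    - apply is_lim_seq_div_S. }
  assert (half : laplace (fun u => csch2_weight u / 2) s = (l * G)%C).
  { apply injective_projections.
    - assert (h : is_lim_seq (fun N => Z1 N * fst G - Z2 N * snd G
                     + fst (laplace (dirichlet_rest N) s))
                 (fst l * fst G - snd l * snd G + 0)).
      { apply is_lim_seq_plus'; [apply is_lim_seq_minus'|apply tends; apply small].
        - apply (is_lim_seq_scal_r _ (fst G) (fst l)); exact hl1.
        - apply (is_lim_seq_scal_r _ (snd G) (snd l)); exact hl2. }
      apply (is_lim_seq_ext _ (fun _ => fst (laplace (fun u => csch2_weight u / 2) s))) in h.
      + apply is_lim_seq_unique in h; rewrite Lim_seq_const in h; injection h as h.
        etransitivity; [exact h|simpl; ring].
      + intros N; rewrite (e N); simpl; ring.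
    - assert (h : is_lim_seq (fun N => Z1 N * snd G + Z2 N * fst G
                     + snd (laplace (dirichlet_rest N) s))
                 (fst l * snd G + snd l * fst G + 0)).
      { apply is_lim_seq_plus'; [apply is_lim_seq_plus'|apply tends; apply small].
        - apply (is_lim_seq_scal_r _ (snd G) (fst l)); exact hl1.
        - apply (is_lim_seq_scal_r _ (fst G) (snd l)); exact hl2. }
      apply (is_lim_seq_ext _ (fun _ => snd (laplace (fun u => csch2_weight u / 2) s))) in h.
      + apply is_lim_seq_unique in h; rewrite Lim_seq_const in h; injection h as h.
        etransitivity; [exact h|simpl; ring].
      + intros N; rewrite (e N); simpl; ring. }
  assert (hd : laplace_domain (fun u => csch2_weight u / 2) (fst s))
    by (apply half_csch2_weight_domain; exact hx).
  rewrite (laplace_ext _ (fun u => csch2_weight u / 2 + csch2_weight u / 2)) by (intros; field).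
  rewrite laplace_plus, half by auto; ring.
Qed.

(** The derivative of [csch2_weight u * exp (s u)] integrates to [0]. *)
Lemma laplace_regular_weight (s : C) : 3 <= fst s <= 4 ->
  ((s - 1) * laplace csch2_weight s = - laplace regular_weight s)%C.
Proof.
  intros hx; destruct s as [x y]; simpl in hx.
  destruct (csch2_weight_domain x hx) as [B hB].
  assert (hR := regular_weight_decays x ltac:(lra)).
  assert (zero_int : forall F f C C', decays C F -> decays C' f ->
     (forall u, is_derive F u (f u)) -> line_integral f = 0).
  { clear; intros F f C C' hF hf hd.
    assert (l1 := line_integral_correct _ _ hf).
    assert (l2 : is_lim_seq (fun n => RInt f (- INR n) (INR n)) 0).
    { apply is_lim_seq_abs_0.
      apply (is_lim_seq_le_le (fun _ => 0) _ (fun n => 2 * C * exp (- (/ 2 * INR n)))).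
      - intros n; split; [apply Rabs_pos|].
        rewrite (RInt_primitive F) by (auto; apply hf).
        eapply Rle_trans; [apply Rabs_triang|]; rewrite Rabs_Ropp.
        destruct hF as [_ b]; assert (b1 := b (INR n)); assert (b2 := b (- INR n)).
        rewrite Rabs_Ropp in b2; rewrite (Rabs_pos_eq (INR n)) in b1, b2 by apply pos_INR.
        replace (/ 2 * INR n) with (INR n / 2) by field; lra.
      - apply is_lim_seq_const.
      - replace (Finite 0) with (Rbar_mult (2 * C) 0) by (simpl; f_equal; ring).
        apply is_lim_seq_scal_l, is_lim_seq_exp_neg; [lra|apply is_lim_seq_INR]. }
    apply is_lim_seq_unique in l1, l2; rewrite l1 in l2; now injection l2. }
  assert (c1 := decays_cos _ x y _ hB); assert (s1 := decays_sin _ x y _ hB).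
  assert (c2 := decays_cos _ x y _ hR); assert (s2 := decays_sin _ x y _ hR).
  assert (lin : forall (B B' : R) (f g h : R -> R) (p q : R), decays B' f -> decays B g -> decays B h ->
    exists C, decays C (fun u => f u + (p * g u + q * h u)) /\
    line_integral (fun u => f u + (p * g u + q * h u))
     = line_integral f + (p * line_integral g + q * line_integral h)).
  { clear; intros B B' f g h p q hf hg hh.
    assert (d1 := decays_scal B p g hg); assert (d2 := decays_scal B q h hh).
    assert (d3 := decays_plus _ _ _ _ d1 d2).
    eexists; split; [apply decays_plus; [exact hf|exact d3]|].
    rewrite (line_integral_plus _ _ _ _ hf d3), (line_integral_plus _ _ _ _ d1 d2).
    now rewrite (line_integral_scal B p), (line_integral_scal B q). }
  destruct (lin _ _ _ _ _ (x - 1) (- y) c2 c1 s1) as [C1 [dc ec]].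
  destruct (lin _ _ _ _ _ (x - 1) y s2 s1 c1) as [C2 [ds es]].
  assert (der := is_derive_csch2_weight).
  assert (exd : forall u, ex_derive csch2_weight u) by (intros u; eexists; apply der).
  assert (Der : forall u, Derive csch2_weight u = regular_weight u - csch2_weight u)
    by (intros u; apply is_derive_unique, der).
  rewrite (zero_int (fun u => csch2_weight u * exp (x * u) * cos (y * u)) _ _ _ c1 dc) in ec.
  2:{ intros u; auto_derive; [auto|]; rewrite Der; toR; ring. }
  rewrite (zero_int (fun u => csch2_weight u * exp (x * u) * sin (y * u)) _ _ _ s1 ds) in es.
  2:{ intros u; auto_derive; [auto|]; rewrite Der; toR; ring. }
  unfold laplace, Cmult, Cminus, Cplus, Copp, RtoC; simpl; f_equal; lra.
Qed.

(** For [Re s] between [3] and [4] this combines the two previous lemmas.  Both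
    sides are analytic along the horizontal line of height [y], which avoids the
    pole of zeta, so the identity extends to the imaginary axis. *)
Lemma zeta_mellin (zeta : C -> C) (y : R) : is_Riemann_zeta zeta -> y <> 0 ->
  (2 * ((0, y) - 1) * (zeta (0, y) * laplace gamma_weight2 (0, y))
   = - laplace regular_weight (0, y))%C.
Proof.
  intros [han hser] hy.
  set (z1 := fun x => fst (zeta (x, y))); set (z2 := fun x => snd (zeta (x, y))).
  set (g1 := fun x => fst (laplace gamma_weight2 (x, y))).
  set (g2 := fun x => snd (laplace gamma_weight2 (x, y))).
  set (n1 := fun x => fst (laplace regular_weight (x, y))).
  set (n2 := fun x => snd (laplace regular_weight (x, y))).
  set (p1 := fun x => (1 * x + -1) * z1 x + (- y) * z2 x).
  set (p2 := fun x => (1 * x + -1) * z2 x + y * z1 x).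
  set (H1 := fun x => 2 * (p1 x * g1 x + -1 * (p2 x * g2 x)) + n1 x).
  set (H2 := fun x => 2 * (p1 x * g2 x + p2 x * g1 x) + n2 x).
  assert (eqH : forall x, ((2 * ((x, y) - 1) * (zeta (x, y) * laplace gamma_weight2 (x, y))
      + laplace regular_weight (x, y)) = (H1 x, H2 x))%C).
  { intros x; unfold H1, H2, p1, p2, z1, z2, g1, g2, n1, n2.
    apply injective_projections; simpl; ring. }
  assert (an : forall x, 0 <= x <= 3 -> ranalytic H1 x /\ ranalytic H2 x).
  { intros x hx.
    destruct (analytic_at_horizontal zeta x y) as [az1 az2].
    { apply han; intros e; apply hy; injection e; auto. }
    destruct (laplace_ranalytic gamma_weight2 x y) as [ag1 ag2].
    { eexists; apply gamma_weight2_decays; lra. }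
    destruct (laplace_ranalytic regular_weight x y) as [an1 an2].
    { eexists; apply regular_weight_decays; lra. }
    assert (ap1 : ranalytic p1 x).
    { apply ranalytic_plus; [apply ranalytic_mult|apply ranalytic_scal];
        auto using ranalytic_affine. }
    assert (ap2 : ranalytic p2 x).
    { apply ranalytic_plus; [apply ranalytic_mult|apply ranalytic_scal];
        auto using ranalytic_affine. }
    split.
    - apply ranalytic_plus; [|exact an1]; apply ranalytic_scal, ranalytic_plus;
        [|apply ranalytic_scal]; apply ranalytic_mult; assumption.
    - apply ranalytic_plus; [|exact an2]; apply ranalytic_scal, ranalytic_plus;
        apply ranalytic_mult; assumption. }
  assert (zr : forall x, 3 <= x < 4 -> H1 x = 0 /\ H2 x = 0).
  { intros x hx; specialize (eqH x).
    assert (h1 := laplace_csch2_weight (zeta (x, y)) (x, y) ltac:(simpl; lra)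
                    (hser (x, y) ltac:(simpl; lra))).
    assert (h2 := laplace_regular_weight (x, y) ltac:(simpl; lra)).
    rewrite h1 in h2.
    replace (2 * ((x, y) - 1) * (zeta (x, y) * laplace gamma_weight2 (x, y)))%C
      with (- laplace regular_weight (x, y))%C in eqH by (rewrite <- h2; ring).
    simpl in eqH; injection eqH as e1 e2; split; lra. }
  specialize (eqH 0).
  assert (e1 : H1 0 = 0).
  { apply (ranalytic_identity H1 0 3 4); [lra| |]; intros x hx;
      [exact (proj1 (an x hx))|exact (proj1 (zr x hx))]. }
  assert (e2 : H2 0 = 0).
  { apply (ranalytic_identity H2 0 3 4); [lra| |]; intros x hx;
      [exact (proj2 (an x hx))|exact (proj2 (zr x hx))]. }
  rewrite e1, e2 in eqH.
  match type of eqH with (?A + ?B = _)%C => replace A with ((A + B) - B)%C by ring end.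
  rewrite eqH; apply injective_projections; simpl; ring.
Qed.

(** * The Gamma function on the imaginary axis *)

Lemma filterlim_line_integral (B : R) (f : R -> R) : decays B f ->
  filterlim (fun ab : R * R => RInt f (fst ab) (snd ab))
    (filter_prod (Rbar_locally m_infty) (Rbar_locally p_infty)) (locally (line_integral f)).
Proof.
  intros hf P [eps hP]; assert (hB := decays_nonneg B f hf); assert (he := cond_pos eps).
  (* Large enough for exp (M / 2) >= 1 + M / 2 > 4 B / eps. *)
  set (M := 2 * (4 * B + 1) / eps).
  assert (hM : 0 < M) by (apply Rdiv_lt_0_compat; lra).
  assert (hexp : exp (- (M / 2)) * (4 * B + 1) <= eps).
  { rewrite exp_Ropp, Rmult_comm; apply Rle_div_l; [apply exp_pos|].
    assert (h := exp_ineq1_le (M / 2)).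
    assert (e : eps * (M / 2) = 4 * B + 1) by (unfold M; field; lra).
    nra. }
  apply (Filter_prod _ _ _ (fun a => a < - M) (fun b => M < b)).
  - exists (- M); auto.
  - exists M; auto.
  - intros a b ha hb; apply hP; simpl.
    change (Rabs (RInt f a b - line_integral f) < eps).
    rewrite Rabs_minus_sym.
    eapply Rle_lt_trans; [apply (line_integral_approx B); auto; lra|].
    assert (h1 : exp (a / 2) <= exp (- (M / 2))) by (apply exp_le; lra).
    assert (h2 : exp (- (b / 2)) <= exp (- (M / 2))) by (apply exp_le; lra).
    assert (h3 := exp_pos (- (M / 2))).
    assert (2 * B * (exp (a / 2) + exp (- (b / 2))) <= 2 * B * (2 * exp (- (M / 2))))
      by (apply Rmult_le_compat_l; lra).
    lra.
Qed.

Lemma is_RInt_exp_subst (F : R -> R) (p q : R) : 0 < p -> 0 < q ->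
  (forall t, 0 < t -> continuous F t) ->
  is_RInt F p q (RInt (fun u => exp u * F (exp u)) (ln p) (ln q)).
Proof.
  intros hp hq cF.
  assert (h : RInt (fun u => exp u * F (exp u)) (ln p) (ln q) = RInt F (exp (ln p)) (exp (ln q))).
  { apply (RInt_comp F exp exp (ln p) (ln q)).
    - intros x _; apply cF, exp_pos.
    - intros x _; split; [apply is_derive_exp|cont]. }
  rewrite h, !exp_ln by auto.
  apply (RInt_correct (V := R_CompleteNormedModule)).
  apply (@ex_RInt_continuous R_CompleteNormedModule).
  intros z hz; apply cF; assert (h0 := Rmin_glb_lt p q 0); lra.
Qed.

Lemma gamma_integrand (t y : R) :
  (cpower t ((0, y) + RtoC (INR 1) - 1) * RtoC (exp (- t)))%C
  = (exp (- t) * cos (y * ln t), exp (- t) * sin (y * ln t)).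
Proof.
  unfold cpower.
  replace (((0, y) + RtoC (INR 1) - 1) * RtoC (ln t))%C with ((0, y * ln t) : C)
    by (apply injective_projections; simpl; ring).
  unfold Cexp, Re, Im; simpl fst; simpl snd; rewrite exp_0.
  apply injective_projections; simpl; ring.
Qed.

Lemma Gamma_integral_laplace (y : R) :
  Gamma_integral ((0, y) + RtoC (INR 1))%C = laplace gamma_weight (0, y).
Proof.
  assert (dec := gamma_weight_decays 0 ltac:(lra)).
  assert (dc := decays_cos _ 0 y _ dec); assert (ds := decays_sin _ 0 y _ dec).
  unfold Gamma_integral.
  apply (is_RInt_gen_unique (V := C_R_CompleteNormedModule)).
  apply (filterlimi_lim_ext_loc (fun ab : R * R =>
    (RInt (fun u => gamma_weight u * exp (0 * u) * cos (y * u)) (ln (fst ab)) (ln (snd ab)),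
     RInt (fun u => gamma_weight u * exp (0 * u) * sin (y * u)) (ln (fst ab)) (ln (snd ab))) : C)).
  - apply (Filter_prod _ _ _ (fun a => 0 < a) (fun b => 0 < b)).
    + exists (mkposreal 1 Rlt_0_1); auto.
    + exists 0; auto.
    + intros a b ha hb; simpl fst; simpl snd.
      assert (comp : forall g, (forall t, 0 < t -> continuous (fun t => g (y * ln t)) t) ->
         is_RInt (fun t => exp (- t) * g (y * ln t)) a b
           (RInt (fun u => gamma_weight u * exp (0 * u) * g (y * u)) (ln a) (ln b))).
      { intros g cg.
        rewrite (RInt_eq _ (fun u => exp u * (exp (- exp u) * g (y * ln (exp u))))).
        - apply (is_RInt_exp_subst (fun t => exp (- t) * g (y * ln t))); auto.
          intros t ht; specialize (cg t ht).
          apply (continuous_Rmult (fun t => exp (- t))); [cont|exact cg].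
        - intros u; rewrite ln_exp, Rmult_0_l, exp_0; unfold gamma_weight; ring. }
      assert (cc : forall t, 0 < t -> continuous (fun t => cos (y * ln t)) t).
      { intros t ht; apply (ex_derive_continuous (fun t => cos (y * ln t))); auto_derive; auto. }
      assert (cs : forall t, 0 < t -> continuous (fun t => sin (y * ln t)) t).
      { intros t ht; apply (ex_derive_continuous (fun t => sin (y * ln t))); auto_derive; auto. }
      apply (is_RInt_ext (V := C_R_CompleteNormedModule)
        (fun t => (exp (- t) * cos (y * ln t), exp (- t) * sin (y * ln t)) : C)).
      { intros t _; symmetry; apply gamma_integrand. }
      apply (is_RInt_fct_extend_pair (U := R_NormedModule) (V := R_NormedModule)
        (fun t => (exp (- t) * cos (y * ln t), exp (- t) * sin (y * ln t)))).
      * exact (comp cos cc).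
      * exact (comp sin cs).
  - assert (lim : forall g, decays 720 g ->
      filterlim (fun ab : R * R => RInt g (ln (fst ab)) (ln (snd ab)))
        (filter_prod (at_right 0) (Rbar_locally p_infty)) (locally (line_integral g))).
    { intros g hg.
      apply (filterlim_comp_2 (G := Rbar_locally m_infty) (H := Rbar_locally p_infty)
               (fun ab : R * R => ln (fst ab)) (fun ab => ln (snd ab)) (fun a b => RInt g a b)).
      - apply (filterlim_comp _ _ _ fst ln _ (at_right 0)); [apply filterlim_fst|apply is_lim_ln_0].
      - apply (filterlim_comp _ _ _ snd ln _ (Rbar_locally p_infty));
          [apply filterlim_snd|apply is_lim_ln_p].
      - apply (filterlim_line_integral 720); auto. }
    unfold laplace; apply (filterlim_C (filter_prod (at_right 0) (Rbar_locally p_infty)));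
      apply lim; assumption.
Qed.

(** One unit step brings the imaginary axis into the half-plane of Euler's
    integral. *)
Lemma Gamma_imaginary_axis (y : R) : y <> 0 ->
  ((0, y) * Gamma (0, y) = laplace gamma_weight (0, y))%C.
Proof.
  intros hy; unfold Gamma.
  assert (e : Gamma_shift (0, y) = 1%nat).
  { unfold Gamma_shift; simpl Re; rewrite <- (tech_up (- 0) 1); [reflexivity| |]; lra. }
  rewrite e, Gamma_integral_laplace; simpl rising; simpl INR.
  assert (ne : ((0, y) : C) <> RtoC 0) by (intros h; apply hy; injection h; auto).
  rewrite Cplus_0_r, Cmult_1_l; field; exact ne.
Qed.

(** The factor [s] of [Gamma (s + 1) = s Gamma s] removes the pole at [0]. *)
Lemma zeta_Gamma_term (zeta : C -> C) (y : R) : is_Riemann_zeta zeta -> y <> 0 ->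
  (2 * (0, y) * ((0, y) - 1) * (zeta (0, y) * Gamma (0, y) * cpower 2 (- (0, y)))
   = - laplace regular_weight (0, y))%C.
Proof.
  intros hz hy; rewrite <- (zeta_mellin zeta y hz hy).
  assert (h : laplace gamma_weight2 (0, y)
     = (cpower 2 (- (0, y)) * laplace gamma_weight (0, y))%C).
  { apply (laplace_shift gamma_weight (ln 2) (0, y)).
    eexists; apply gamma_weight_decays; simpl; lra. }
  rewrite h, <- (Gamma_imaginary_axis y hy); ring.
Qed.

(** * The periodic function *)

(** On the scale [x = exp (L t)], the cotangent minus its limit at infinity;
    next, minus its pole at [0]. *)
Definition coth_right (L t : R) : R := coth (exp (L * t)) - 1.
Definition coth_left (L t : R) : R := coth (exp (L * t)) - exp (- (L * t)).
Definition dcoth_right (L t : R) : R := - L * csch2_weight (L * t).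
Definition dcoth_left (L t : R) : R := L * (exp (- (L * t)) - csch2_weight (L * t)).

Lemma is_derive_coth_exp (L t : R) :
  is_derive (fun t => coth (exp (L * t))) t (- L * csch2_weight (L * t)).
Proof.
  assert (hs := sinh_exp_pos (L * t)).
  assert (hc := cosh_sqr (exp (L * t))).
  assert (d : is_derive coth (exp (L * t)) (- / sinh (exp (L * t)) ^ 2)).
  { set (x := exp (L * t)) in *.
    replace (- / sinh x ^ 2) with ((sinh x * sinh x - cosh x * cosh x) / sinh x ^ 2)
      by (rewrite hc; field; lra).
    apply (is_derive_div cosh sinh); [apply is_derive_cosh|apply is_derive_sinh|lra]. }
  replace (- L * csch2_weight (L * t))
    with ((L * exp (L * t)) * - / sinh (exp (L * t)) ^ 2)
    by (unfold csch2_weight; field; lra).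
  apply (is_derive_comp coth (fun t => exp (L * t)) t); [exact d|].
  auto_derive; auto; toR; ring.
Qed.

Lemma is_derive_coth_right (L t : R) : is_derive (coth_right L) t (dcoth_right L t).
Proof.
  unfold dcoth_right; rewrite <- (Rminus_0_r (_ * _)).
  apply (is_derive_minus (fun t => coth (exp (L * t))) (fun _ => 1)).
  - apply is_derive_coth_exp.
  - apply (is_derive_const (K := R_AbsRing) (V := R_NormedModule)).
Qed.

Lemma is_derive_coth_left (L t : R) : is_derive (coth_left L) t (dcoth_left L t).
Proof.
  unfold dcoth_left.
  replace (L * (exp (- (L * t)) - csch2_weight (L * t)))
    with (- L * csch2_weight (L * t) - - L * exp (- (L * t))) by ring.
  apply (is_derive_minus (fun t => coth (exp (L * t))) (fun t => exp (- (L * t)))).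
  - apply is_derive_coth_exp.
  - auto_derive; auto; toR; ring.
Qed.

Lemma is_derive_csch2_scaled (L t : R) :
  is_derive (fun t => csch2_weight (L * t)) t
            (L * (regular_weight (L * t) - csch2_weight (L * t))).
Proof.
  apply (is_derive_comp csch2_weight (fun t => L * t) t).
  - apply is_derive_csch2_weight.
  - auto_derive; auto; toR; ring.
Qed.

(** The second derivatives are expressed by [regular_weight] and the first
    derivatives, on both sides in the same way. *)
Lemma is_derive_dcoth_right (L t : R) : is_derive (dcoth_right L) t
  (- L ^ 2 * regular_weight (L * t) - L * dcoth_right L t).
Proof.
  replace (- L ^ 2 * regular_weight (L * t) - L * dcoth_right L t)
    with (- L * (L * (regular_weight (L * t) - csch2_weight (L * t))))
    by (unfold dcoth_right; ring).
  apply (is_derive_scal (fun t => csch2_weight (L * t)) t (- L)), is_derive_csch2_scaled.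
Qed.

Lemma is_derive_dcoth_left (L t : R) : is_derive (dcoth_left L) t
  (- L ^ 2 * regular_weight (L * t) - L * dcoth_left L t).
Proof.
  replace (- L ^ 2 * regular_weight (L * t) - L * dcoth_left L t)
    with (L * (- L * exp (- (L * t)) - L * (regular_weight (L * t) - csch2_weight (L * t))))
    by (unfold dcoth_left; ring).
  apply (is_derive_scal (fun t => exp (- (L * t)) - csch2_weight (L * t)) t L).
  apply (is_derive_minus (fun t => exp (- (L * t)))); [|apply is_derive_csch2_scaled].
  auto_derive; auto; toR; ring.
Qed.

Lemma coth_right_bound (L t : R) : Rabs (coth_right L t) <= exp (- (L * t)).
Proof.
  assert (h := coth_sub_1_bounds _ (exp_pos (L * t))).
  unfold coth_right; rewrite exp_Ropp, Rabs_pos_eq; lra.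
Qed.

Lemma coth_left_bound (L t : R) : Rabs (coth_left L t) <= exp (L * t).
Proof.
  assert (h := coth_sub_inv_bounds _ (exp_pos (L * t))).
  unfold coth_left; rewrite exp_Ropp, Rabs_pos_eq; lra.
Qed.

Lemma dcoth_right_bound (L t : R) : 0 < L -> Rabs (dcoth_right L t) <= L * exp (- (L * t)).
Proof.
  intros hL; assert (hs := sinh_exp_pos (L * t)); assert (he := exp_pos (L * t)).
  assert (h := sinh_ge (exp (L * t))).
  unfold dcoth_right, csch2_weight; rewrite Rabs_mult, Rabs_Ropp, (Rabs_pos_eq L) by lra.
  apply Rmult_le_compat_l; [lra|].
  assert (hp : 0 < sinh (exp (L * t)) ^ 2) by (apply pow_lt; auto).
  rewrite exp_Ropp, Rabs_pos_eq by (apply Rdiv_le_0_compat; lra).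
  apply Rle_div_l; [auto|].
  apply Rle_trans with (/ exp (L * t) * exp (L * t) ^ 2).
  - right; field; lra.
  - apply Rmult_le_compat_l; [apply Rlt_le, Rinv_0_lt_compat; auto|].
    apply pow_incr; lra.
Qed.

Lemma dcoth_left_bound (L t : R) : 0 < L -> Rabs (dcoth_left L t) <= L * exp (L * t).
Proof.
  intros hL; set (x := exp (L * t)); assert (hx : 0 < x) by apply exp_pos.
  assert (hs := sinh_pos x hx); assert (h1 := sinh_ge x); assert (h2 := sinh_le_x_cosh x).
  assert (h3 := cosh_sqr x).
  unfold dcoth_left, csch2_weight; rewrite exp_Ropp; fold x.
  rewrite Rabs_mult, (Rabs_pos_eq L) by lra.
  apply Rmult_le_compat_l; [lra|].
  replace (/ x - x / sinh x ^ 2) with ((sinh x ^ 2 - x ^ 2) / (x * sinh x ^ 2)) by (field; lra).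
  assert (hp : 0 < sinh x ^ 2) by (apply pow_lt; auto).
  assert (k1 : x ^ 2 <= sinh x ^ 2) by (apply pow_incr; lra).
  assert (k2 : sinh x ^ 2 <= (x * cosh x) ^ 2) by (apply pow_incr; lra).
  replace ((x * cosh x) ^ 2) with (x ^ 2 * (1 + sinh x ^ 2)) in k2
    by (simpl; rewrite Rmult_1_r, Rmult_1_r, <- h3; ring).
  rewrite Rabs_pos_eq by (apply Rdiv_le_0_compat; [lra|apply Rmult_lt_0_compat; auto]).
  apply Rle_div_l; [apply Rmult_lt_0_compat; auto|].
  replace (x * (x * sinh x ^ 2)) with (x ^ 2 * sinh x ^ 2) by ring; lra.
Qed.

Lemma exp_neg_le_inv_sqr (L : R) (n : nat) : 0 < L ->
  exp (- (L * INR (S n))) <= 4 / L ^ 2 / INR (S n) ^ 2.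
Proof.
  intros hL; assert (hn : 0 < INR (S n)) by (apply lt_0_INR; lia).
  assert (hz : 0 < L * INR (S n)) by (apply Rmult_lt_0_compat; auto).
  eapply Rle_trans; [apply (pow_exp_neg_le 2); auto|].
  replace (INR (fact 2)) with 2 by (simpl; ring).
  replace (2 / (L * INR (S n)) ^ 2) with (2 * (/ L ^ 2 / INR (S n) ^ 2)) by (field; lra).
  replace (4 / L ^ 2 / INR (S n) ^ 2) with (4 * (/ L ^ 2 / INR (S n) ^ 2)) by (field; lra).
  apply Rmult_le_compat_r; [|lra].
  apply Rdiv_le_0_compat; [apply Rlt_le, Rinv_0_lt_compat, pow_lt; auto|apply pow_lt; auto].
Qed.

Definition coth_term (L : R) (j : nat) (t : R) : R :=
  coth_right L (t + INR j) + coth_left L (t - INR (S j)).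
Definition dcoth_term (L : R) (j : nat) (t : R) : R :=
  dcoth_right L (t + INR j) + dcoth_left L (t - INR (S j)).

(** A neighbourhood of the period [[0, 1]] is needed to differentiate at its ends. *)
Lemma two_sided_bound (L c t : R) (j : nat) (r l : R -> R) : 0 < L -> 0 <= c -> -1 <= t <= 2 ->
  (forall t, Rabs (r t) <= c * exp (- (L * t))) -> (forall t, Rabs (l t) <= c * exp (L * t)) ->
  Rabs (r (t + INR j) + l (t - INR (S j)))
  <= c * (8 * exp (2 * L) / L ^ 2) / INR (S j) ^ 2.
Proof.
  intros hL hc ht hr hl.
  assert (hn : 0 < INR (S j)) by (apply lt_0_INR; lia).
  assert (e : forall z, z <= 2 * L - L * INR (S j) ->
    c * exp z <= c * (4 * exp (2 * L) / L ^ 2) / INR (S j) ^ 2).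
  { intros z hz.
    apply Rle_trans with (c * (exp (2 * L) * (4 / L ^ 2 / INR (S j) ^ 2))).
    - apply Rmult_le_compat_l; auto.
      apply Rle_trans with (exp (2 * L) * exp (- (L * INR (S j)))).
      + rewrite <- exp_plus; apply exp_le; lra.
      + apply Rmult_le_compat_l; [apply Rlt_le, exp_pos|apply exp_neg_le_inv_sqr; auto].
    - right; field; lra. }
  eapply Rle_trans; [apply Rabs_triang|].
  replace (c * (8 * exp (2 * L) / L ^ 2) / INR (S j) ^ 2)
    with (c * (4 * exp (2 * L) / L ^ 2) / INR (S j) ^ 2
        + c * (4 * exp (2 * L) / L ^ 2) / INR (S j) ^ 2) by (field; lra).
  apply Rplus_le_compat.
  - eapply Rle_trans; [apply hr|apply e].
    assert (- (L * t) <= L) by nra; rewrite S_INR; lra.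
  - eapply Rle_trans; [apply hl|apply e].
    assert (L * t <= 2 * L) by nra; lra.
Qed.

Lemma coth_term_bound (L t : R) (j : nat) : 0 < L -> -1 <= t <= 2 ->
  Rabs (coth_term L j t) <= 8 * exp (2 * L) / L ^ 2 / INR (S j) ^ 2.
Proof.
  intros hL ht; rewrite <- (Rmult_1_l (8 * exp (2 * L) / L ^ 2)); apply (two_sided_bound L 1 t j (coth_right L) (coth_left L)); auto; try lra.
  - intros u; rewrite Rmult_1_l; apply coth_right_bound.
  - intros u; rewrite Rmult_1_l; apply coth_left_bound.
Qed.

Lemma dcoth_term_bound (L t : R) (j : nat) : 0 < L -> -1 <= t <= 2 ->
  Rabs (dcoth_term L j t) <= L * (8 * exp (2 * L) / L ^ 2) / INR (S j) ^ 2.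
Proof.
  intros hL ht; apply (two_sided_bound L L t j (dcoth_right L) (dcoth_left L)); auto; try lra;
    intros u; [apply dcoth_right_bound|apply dcoth_left_bound]; auto.
Qed.

(** The correction makes the sum of the terms, which changes by
    [1 - exp (- L t)] when [t] grows by [1], periodic. *)
Definition correction (L t : R) : R := - t - exp L / (exp L - 1) * exp (- (L * t)).
Definition dcorrection (L t : R) : R := -1 + L * (exp L / (exp L - 1)) * exp (- (L * t)).

Definition partial_sum (L : R) (K : nat) (t : R) : R :=
  sum_n (fun j => coth_term L j t) K + correction L t.
Definition dpartial_sum (L : R) (K : nat) (t : R) : R :=
  sum_n (fun j => dcoth_term L j t) K + dcorrection L t.

Definition periodic_sum (L t : R) : R := Series (fun j => coth_term L j t) + correction L t.

Lemma exp_gt_1 (L : R) : 0 < L -> 1 < exp L.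
Proof. intros hL; rewrite <- exp_0; apply exp_increasing; auto. Qed.

Lemma is_derive_correction (L t : R) : is_derive (correction L) t (dcorrection L t).
Proof.
  unfold correction, dcorrection; auto_derive; auto; toR; ring.
Qed.

Lemma is_derive_shifted (f df : R -> R) (v t : R) : (forall u, is_derive f u (df u)) ->
  is_derive (fun t => f (t + v)) t (df (t + v)).
Proof.
  intros h; rewrite <- (Rmult_1_l (df (t + v))).
  apply (is_derive_comp f (fun t => t + v) t); [apply h|].
  auto_derive; auto.
Qed.

Lemma is_derive_coth_term (L t : R) (j : nat) :
  is_derive (coth_term L j) t (dcoth_term L j t).
Proof.
  apply (is_derive_plus (fun t => coth_right L (t + INR j))).
  - apply (is_derive_shifted _ _ (INR j) t (is_derive_coth_right L)).
  - apply (is_derive_shifted _ _ (- INR (S j)) t (is_derive_coth_left L)).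
Qed.

Definition regular_term (L : R) (j : nat) (t : R) : R :=
  regular_weight (L * (t + INR j)) + regular_weight (L * (t - INR (S j))).

Lemma is_derive_dcoth_term (L t : R) (j : nat) : is_derive (dcoth_term L j) t
  (- L ^ 2 * regular_term L j t - L * dcoth_term L j t).
Proof.
  replace (- L ^ 2 * regular_term L j t - L * dcoth_term L j t)
    with ((- L ^ 2 * regular_weight (L * (t + INR j)) - L * dcoth_right L (t + INR j))
        + (- L ^ 2 * regular_weight (L * (t - INR (S j))) - L * dcoth_left L (t - INR (S j))))
    by (unfold regular_term, dcoth_term; ring).
  apply (is_derive_plus (fun t => dcoth_right L (t + INR j))).
  - apply (is_derive_shifted _ _ (INR j) t (is_derive_dcoth_right L)).
  - apply (is_derive_shifted _ _ (- INR (S j)) t (is_derive_dcoth_left L)).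
Qed.

Lemma is_derive_partial_sum (L t : R) (K : nat) :
  is_derive (partial_sum L K) t (dpartial_sum L K t).
Proof.
  apply (is_derive_plus (fun t => sum_n (fun j => coth_term L j t) K)).
  - apply (is_derive_sum_n (fun j => coth_term L j) K t (fun j => dcoth_term L j t)).
    intros; apply is_derive_coth_term.
  - apply is_derive_correction.
Qed.

(** The equation behind the Fourier coefficients: [f'' + L f'] kills the
    constants and [exp (- L t)], hence the singular parts of all the terms, and
    leaves [- L] from the linear correction. *)
Lemma is_derive_dpartial_sum (L t : R) (K : nat) : is_derive (dpartial_sum L K) t
  (- L ^ 2 * sum_n (fun j => regular_term L j t) K - L - L * dpartial_sum L K t).
Proof.
  replace (- L ^ 2 * sum_n (fun j => regular_term L j t) K - L - L * dpartial_sum L K t)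
    with (sum_n (fun j => - L ^ 2 * regular_term L j t - L * dcoth_term L j t) K
          + - L ^ 2 * (exp L / (exp L - 1)) * exp (- (L * t))).
  - apply (is_derive_plus (fun t => sum_n (fun j => dcoth_term L j t) K)).
    + apply (is_derive_sum_n (fun j => dcoth_term L j) K t
        (fun j => - L ^ 2 * regular_term L j t - L * dcoth_term L j t)).
      intros; apply is_derive_dcoth_term.
    + unfold dcorrection; auto_derive; auto; toR; ring.
  - unfold dpartial_sum, dcorrection.
    assert (e : sum_n (fun j => - L ^ 2 * regular_term L j t - L * dcoth_term L j t) K
      = - L ^ 2 * sum_n (fun j => regular_term L j t) K
        - L * sum_n (fun j => dcoth_term L j t) K :> R).
    { induction K as [|K IH]; [rewrite !sum_O; reflexivity|rewrite !sum_SnR, IH; ring]. }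
    rewrite e; ring.
Qed.

Lemma is_series_coth_term (L t : R) : 0 < L -> -1 <= t <= 2 ->
  is_series (fun j => coth_term L j t) (Series (fun j => coth_term L j t)).
Proof.
  intros hL ht; eapply Series_correct, ex_series_inv_sqr.
  intros n; apply coth_term_bound; auto.
Qed.

Lemma partial_sum_approx (L t : R) (K : nat) : 0 < L -> -1 <= t <= 2 ->
  Rabs (partial_sum L K t - periodic_sum L t) <= 8 * exp (2 * L) / L ^ 2 / INR (S K).
Proof.
  intros hL ht; unfold partial_sum, periodic_sum.
  replace (sum_n (fun j => coth_term L j t) K + correction L t
           - (Series (fun j => coth_term L j t) + correction L t))
    with (- (Series (fun j => coth_term L j t) - sum_n (fun j => coth_term L j t) K)) by ring.
  rewrite Rabs_Ropp; apply (series_tail_inv_sqr (fun j => coth_term L j t)).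
  - intros; apply coth_term_bound; auto.
  - apply is_series_coth_term; auto.
Qed.

Lemma partial_sum_lim (L t : R) : 0 < L -> -1 <= t <= 2 ->
  is_lim_seq (fun K => partial_sum L K t) (periodic_sum L t).
Proof.
  intros hL ht; apply is_lim_seq_plus'; [|apply is_lim_seq_const].
  apply is_series_coth_term; auto.
Qed.

Lemma div_S_eventually (c : R) (eps : posreal) :
  eventually (fun n => c / INR (S n) < eps).
Proof.
  assert (h := is_lim_seq_div_S c); apply is_lim_seq_spec in h.
  destruct (h eps) as [N hN]; exists N; intros n hn; specialize (hN n hn).
  rewrite Rminus_0_r in hN; apply Rabs_def2 in hN; lra.
Qed.

(** Termwise differentiation, the derivatives of the terms being summable
    uniformly around the period. *)
Lemma periodic_sum_ex_derive (L t : R) : 0 < L -> 0 <= t <= 1 -> ex_derive (periodic_sum L) t.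
Proof.
  intros hL ht.
  set (D := fun t => -1 < t < 2).
  assert (oD : open D) by (apply open_and; [apply open_gt|apply open_lt]).
  assert (dlim : forall t, D t -> is_lim_seq (fun K => dpartial_sum L K t)
             (Series (fun j => dcoth_term L j t) + dcorrection L t)).
  { intros u hu; apply is_lim_seq_plus'; [|apply is_lim_seq_const].
    eapply Series_correct, ex_series_inv_sqr.
    intros n; apply dcoth_term_bound; unfold D in hu; lra. }
  assert (eD : forall K u, Derive (partial_sum L K) u = dpartial_sum L K u).
  { intros; apply is_derive_unique, is_derive_partial_sum. }
  assert (h := CVU_Derive (partial_sum L) D oD).
  assert (h' : is_derive (fun y => real (Lim_seq (fun n => partial_sum L n y))) t
                 (real (Lim_seq (fun n => Derive (partial_sum L n) t)))).
  { apply h.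
    - intros a b c ha hb hc; unfold D in *; lra.
    - intros eps; generalize (div_S_eventually (8 * exp (2 * L) / L ^ 2) eps).
      apply filter_imp; intros n hn u hu.
      rewrite (is_lim_seq_unique _ _ (partial_sum_lim L u hL ltac:(unfold D in hu; lra))).
      eapply Rle_lt_trans; [|exact hn].
      apply partial_sum_approx; unfold D in hu; lra.
    - intros n u _; eexists; apply is_derive_partial_sum.
    - intros n u _; apply continuity_pt_filterlim.
      apply (continuous_ext (dpartial_sum L n)); [intros; symmetry; apply eD|].
      apply (ex_derive_continuous (dpartial_sum L n)); eexists; apply is_derive_dpartial_sum.
    - intros eps; generalize (div_S_eventually (L * (8 * exp (2 * L) / L ^ 2)) eps).
      apply filter_imp; intros n hn u hu.
      rewrite (Lim_seq_ext _ _ (fun k => eD k u)), eD.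
      rewrite (is_lim_seq_unique _ _ (dlim u hu)); simpl.
      eapply Rle_lt_trans; [|exact hn].
      unfold dpartial_sum.
      replace (sum_n (fun j => dcoth_term L j u) n + dcorrection L u
           - (Series (fun j => dcoth_term L j u) + dcorrection L u))
        with (- (Series (fun j => dcoth_term L j u) - sum_n (fun j => dcoth_term L j u) n)) by ring.
      assert (hb : forall j, Rabs (dcoth_term L j u) <= L * (8 * exp (2 * L) / L ^ 2) / INR (S j) ^ 2)
        by (intros; apply dcoth_term_bound; unfold D in hu; lra).
      rewrite Rabs_Ropp; apply (series_tail_inv_sqr (fun j => dcoth_term L j u)); auto.
      eapply Series_correct, ex_series_inv_sqr; exact hb.
    - unfold D; lra. }
  eexists; eapply is_derive_ext_loc; [|exact h'].
  assert (ho : locally t D) by (apply oD; unfold D; lra).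
  revert ho; apply filter_imp; intros u hu.
  now rewrite (is_lim_seq_unique _ _ (partial_sum_lim L u hL ltac:(unfold D in hu; lra))).
Qed.

Lemma periodic_sum_continuous (L t : R) : 0 < L -> 0 <= t <= 1 -> continuous (periodic_sum L) t.
Proof. intros hL ht; apply (ex_derive_continuous (periodic_sum L)), periodic_sum_ex_derive; auto. Qed.

(** The jump over one period telescopes, from the right along [r] and from the
    left along [l]. *)
Lemma sum_two_sided_telescope (r l : R -> R) (K : nat) :
  sum_n (fun j => r (1 + INR j) + l (1 - INR (S j))) K
  - sum_n (fun j => r (0 + INR j) + l (0 - INR (S j))) K
  = r (INR (S K)) - r 0 + (l 0 - l (- INR (S K))).
Proof.
  induction K as [|K IH].
  - rewrite !sum_O; simpl INR.
    replace (1 + 0) with 1 by ring; replace (0 + 0) with 0 by ring.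
    replace (1 - 1) with 0 by ring; replace (0 - 1) with (- (1)) by ring; ring.
  - rewrite !sum_SnR.
    replace (1 + INR (S K)) with (INR (S (S K))) by (rewrite (S_INR (S K)); ring).
    replace (1 - INR (S (S K))) with (- INR (S K)) by (rewrite (S_INR (S K)); ring).
    replace (0 + INR (S K)) with (INR (S K)) by ring.
    replace (0 - INR (S (S K))) with (- INR (S (S K))) by ring.
    lra.
Qed.

Lemma correction_jump (L : R) : 0 < L -> correction L 1 = correction L 0.
Proof.
  intros hL; assert (h := exp_gt_1 L hL); unfold correction.
  rewrite Rmult_1_r, Rmult_0_r, Ropp_0, exp_0, exp_Ropp; field; lra.
Qed.

Lemma dcorrection_jump (L : R) : 0 < L -> dcorrection L 1 - dcorrection L 0 = - L.
Proof.
  intros hL; assert (h := exp_gt_1 L hL); unfold dcorrection.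
  rewrite Rmult_1_r, Rmult_0_r, Ropp_0, exp_0, exp_Ropp; field; lra.
Qed.

Lemma partial_sum_jump (L : R) (K : nat) : 0 < L ->
  Rabs (partial_sum L K 1 - partial_sum L K 0) <= 2 * exp (- (L * INR (S K))).
Proof.
  intros hL; unfold partial_sum, coth_term; rewrite correction_jump by auto.
  assert (h := sum_two_sided_telescope (coth_right L) (coth_left L) K).
  assert (e0 : coth_right L 0 = coth_left L 0).
  { unfold coth_right, coth_left; now rewrite Rmult_0_r, Ropp_0, exp_0. }
  assert (b1 := coth_right_bound L (INR (S K))).
  assert (b2 := coth_left_bound L (- INR (S K))).
  replace (L * - INR (S K)) with (- (L * INR (S K))) in b2 by ring.
  apply Rabs_le_between in b1, b2; apply Rabs_le_between; lra.
Qed.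

Lemma dpartial_sum_jump (L : R) (K : nat) : 0 < L ->
  Rabs (dpartial_sum L K 1 - dpartial_sum L K 0) <= 2 * L * exp (- (L * INR (S K))).
Proof.
  intros hL; unfold dpartial_sum, dcoth_term.
  assert (hj := dcorrection_jump L hL).
  assert (h := sum_two_sided_telescope (dcoth_right L) (dcoth_left L) K).
  assert (e0 : dcoth_left L 0 - dcoth_right L 0 = L).
  { unfold dcoth_right, dcoth_left; rewrite Rmult_0_r, Ropp_0, exp_0; ring. }
  assert (b1 := dcoth_right_bound L (INR (S K)) hL).
  assert (b2 := dcoth_left_bound L (- INR (S K)) hL).
  replace (L * - INR (S K)) with (- (L * INR (S K))) in b2 by ring.
  apply Rabs_le_between in b1, b2; apply Rabs_le_between; lra.
Qed.

Lemma is_lim_seq_exp_neg_S (L : R) : 0 < L ->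
  is_lim_seq (fun K => exp (- (L * INR (S K)))) 0.
Proof.
  intros hL; apply (is_lim_seq_incr_1 (fun K => exp (- (L * INR K)))).
  apply is_lim_seq_exp_neg; [auto|apply is_lim_seq_INR].
Qed.

Lemma is_lim_seq_0_of_bound (v e : nat -> R) :
  (forall n, Rabs (v n) <= e n) -> is_lim_seq e 0 -> is_lim_seq v 0.
Proof.
  intros h he; apply is_lim_seq_abs_0, (is_lim_seq_le_le (fun _ => 0) _ e); auto.
  - intros n; split; [apply Rabs_pos|apply h].
  - apply is_lim_seq_const.
Qed.

Lemma periodic_sum_periodic (L : R) : 0 < L -> periodic_sum L 1 = periodic_sum L 0.
Proof.
  intros hL.
  assert (h1 : is_lim_seq (fun K => partial_sum L K 1 - partial_sum L K 0)
                          (periodic_sum L 1 - periodic_sum L 0)).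
  { apply is_lim_seq_minus'; apply partial_sum_lim; auto; lra. }
  assert (h2 : is_lim_seq (fun K => partial_sum L K 1 - partial_sum L K 0) 0).
  { apply is_lim_seq_0_of_bound with (fun K => 2 * exp (- (L * INR (S K)))).
    - intros n; apply partial_sum_jump; auto.
    - replace (Finite 0) with (Rbar_mult 2 0) by (simpl; f_equal; ring).
      apply is_lim_seq_scal_l, is_lim_seq_exp_neg_S; auto. }
  apply is_lim_seq_unique in h1, h2; rewrite h1 in h2; injection h2; lra.
Qed.

(** * Unfolding *)

(** Over a period, the translates by integers tile a long interval. *)
Lemma RInt_unfold (r l E : R -> R) (K : nat) :
  (forall t, continuous r t) -> (forall t, continuous l t) -> (forall t, continuous E t) ->
  (forall n t, E (t + INR n) = E t) ->
  RInt (fun t => sum_n (fun j => r (t + INR j) + l (t - INR (S j))) K * E t) 0 1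
  = RInt (fun t => r t * E t) 0 (INR (S K)) + RInt (fun t => l t * E t) (- INR (S K)) 0.
Proof.
  intros cr cl cE pE.
  assert (crE : forall t, continuous (fun t => r t * E t) t) by (intros; cont).
  assert (clE : forall t, continuous (fun t => l t * E t) t) by (intros; cont).
  assert (sh : forall (f : R -> R) (v t : R), (forall t, continuous f t) -> continuous (fun t => f (t + v)) t).
  { intros f v t cf; apply (continuous_comp (fun t => t + v) f); [cont|apply cf]. }
  assert (pE' : forall n t, E (t - INR n) = E t).
  { intros n t; rewrite <- (pE n (t - INR n)); f_equal; ring. }
  assert (piece : forall j, RInt (fun t => (r (t + INR j) + l (t - INR (S j))) * E t) 0 1
     = RInt (fun t => r t * E t) (INR j) (INR (S j))
       + RInt (fun t => l t * E t) (- INR (S j)) (- INR j)).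
  { intros j.
    assert (s1 : RInt (fun t => r (t + INR j) * E (t + INR j)) 0 1
        = RInt (fun t => r t * E t) (0 + INR j) (1 + INR j))
      by exact (RInt_shift (fun t => r t * E t) (INR j) 0 1 crE).
    assert (s2 : RInt (fun t => l (t + - INR (S j)) * E (t + - INR (S j))) 0 1
        = RInt (fun t => l t * E t) (0 + - INR (S j)) (1 + - INR (S j)))
      by exact (RInt_shift (fun t => l t * E t) (- INR (S j)) 0 1 clE).
    rewrite (RInt_eq _ (fun t => r (t + INR j) * E (t + INR j)
                            + l (t + - INR (S j)) * E (t + - INR (S j)))).
    - rewrite RInt_Rplus, s1, s2.
      + rewrite S_INR; f_equal; f_equal; ring.
      + apply ex_RInt_cont; intros t; exact (sh (fun t => r t * E t) _ t crE).
      + apply ex_RInt_cont; intros t; exact (sh (fun t => l t * E t) _ t clE).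
    - intros t; rewrite pE; change (t + - INR (S j)) with (t - INR (S j)); rewrite pE'; ring. }
  assert (ct : forall j t, continuous (fun t => (r (t + INR j) + l (t - INR (S j))) * E t) t).
  { intros j t; apply continuous_Rmult; [|apply cE]; apply continuous_Rplus; apply sh; auto. }
  assert (cs : forall K t, continuous
     (fun t => sum_n (fun j => r (t + INR j) + l (t - INR (S j))) K * E t) t).
  { clear -ct cE; induction K as [|K IH]; intros t.
    - apply (continuous_ext (fun t => (r (t + INR 0) + l (t - INR 1)) * E t)); [|apply (ct 0%nat)].
      intros u; now rewrite sum_O.
    - apply (continuous_ext (fun t => sum_n (fun j => r (t + INR j) + l (t - INR (S j))) K * E t
         + (r (t + INR (S K)) + l (t - INR (S (S K)))) * E t)).
      + intros u; rewrite sum_SnR; toR; ring.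
      + apply continuous_Rplus; [apply IH|apply (ct (S K))]. }
  induction K as [|K IH].
  - rewrite (RInt_eq _ (fun t => (r (t + INR 0) + l (t - INR 1)) * E t)), piece.
    + simpl INR; rewrite Ropp_0; reflexivity.
    + intros t; now rewrite sum_O.
  - rewrite (RInt_eq _ (fun t => sum_n (fun j => r (t + INR j) + l (t - INR (S j))) K * E t
         + (r (t + INR (S K)) + l (t - INR (S (S K)))) * E t))
      by (intros; rewrite sum_SnR; ring).
    rewrite RInt_Rplus, IH, piece by (apply ex_RInt_cont; auto).
    rewrite (RInt_Chasles_cont _ 0 (INR (S K)) (INR (S (S K)))) by auto.
    rewrite (RInt_Chasles_cont _ (- INR (S (S K))) (- INR (S K)) 0) by auto.
    toR; ring.
Qed.

Lemma coth_right_continuous (L t : R) : continuous (coth_right L) t.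
Proof. apply (ex_derive_continuous (coth_right L)); eexists; apply is_derive_coth_right. Qed.

Lemma coth_left_continuous (L t : R) : continuous (coth_left L) t.
Proof. apply (ex_derive_continuous (coth_left L)); eexists; apply is_derive_coth_left. Qed.

Lemma partial_sum_continuous (L : R) (K : nat) (t : R) : continuous (partial_sum L K) t.
Proof. apply (ex_derive_continuous (partial_sum L K)); eexists; apply is_derive_partial_sum. Qed.

Lemma RInt_periodic_sum_lim (L : R) (E : R -> R) (c : R) : 0 < L ->
  (forall t, continuous E t) -> (forall t, Rabs (E t) <= c) ->
  is_lim_seq (fun K => RInt (fun t => partial_sum L K t * E t) 0 1)
             (RInt (fun t => periodic_sum L t * E t) 0 1).
Proof.
  intros hL cE bE.
  apply RInt_uniform_limit with
    (fun K => 8 * exp (2 * L) / L ^ 2 * c / INR (S K)); [lra| | | |].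
  - intros K t _; apply continuous_Rmult; [apply partial_sum_continuous|apply cE].
  - intros t ht; apply continuous_Rmult; [apply periodic_sum_continuous; auto|apply cE].
  - intros K t ht.
    replace (partial_sum L K t * E t - periodic_sum L t * E t)
      with ((partial_sum L K t - periodic_sum L t) * E t) by ring.
    rewrite Rabs_mult.
    replace (8 * exp (2 * L) / L ^ 2 * c / INR (S K))
      with (8 * exp (2 * L) / L ^ 2 / INR (S K) * c) by (unfold Rdiv; ring).
    apply Rmult_le_compat; try apply Rabs_pos; auto.
    apply partial_sum_approx; lra.
  - apply is_lim_seq_div_S.
Qed.

(** * The mean value *)

Lemma RInt_coth_left (L T : R) : 0 < L -> 0 <= T ->
  RInt (coth_left L) (- T) T
  = (coth_primitive (exp (L * T)) - coth_primitive (exp (- (L * T)))) / L.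
Proof.
  intros hL hT.
  assert (cg : forall u, continuous (fun u => coth (exp u) - exp (- u)) u).
  { intros u; apply (continuous_ext (coth_left 1)); [|apply coth_left_continuous].
    intros x; unfold coth_left; now rewrite Rmult_1_l. }
  assert (h := RInt_comp_lin (fun u => coth (exp u) - exp (- u)) L 0 (- T) T).
  rewrite !Rplus_0_r in h.
  assert (e : RInt (fun t => L * coth_left L t) (- T) T
            = RInt (fun u => coth (exp u) - exp (- u)) (L * - T) (L * T)).
  { rewrite <- h by (apply ex_RInt_cont; auto).
    apply RInt_eq; intros t; unfold scal; simpl; unfold mult; simpl.
    now rewrite Rplus_0_r. }
  rewrite RInt_Rscal in e by (apply ex_RInt_cont; intros; apply coth_left_continuous).
  rewrite RInt_coth_sub_inv_exp in e by nra.
  replace (L * - T) with (- (L * T)) in e by ring.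
  apply (Rmult_eq_reg_l L); [|lra]; rewrite e; field; lra.
Qed.

Lemma RInt_partial_sum (L : R) (K : nat) : 0 < L ->
  RInt (partial_sum L K) 0 1
  = (coth_primitive (exp (L * INR (S K))) - L * INR (S K)
     - coth_primitive (exp (- (L * INR (S K)))) - exp (- (L * INR (S K)))) / L - 1 / 2.
Proof.
  intros hL; set (T := INR (S K)); assert (hT : 0 <= T) by apply pos_INR.
  assert (hexp := exp_gt_1 L hL).
  assert (cr := coth_right_continuous L); assert (cl := coth_left_continuous L).
  assert (cc : forall t, continuous (correction L) t).
  { intros t; apply (ex_derive_continuous (correction L)); eexists; apply is_derive_correction. }
  assert (u := RInt_unfold (coth_right L) (coth_left L) (fun _ => 1) K cr cl
                 (fun t => continuous_const 1 t) (fun _ _ => eq_refl)).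
  assert (i1 : RInt (fun t => sum_n (fun j => coth_term L j t) K) 0 1
     = RInt (coth_right L) 0 T + RInt (coth_left L) (- T) 0).
  { rewrite (RInt_eq _ (fun t =>
       sum_n (fun j => coth_right L (t + INR j) + coth_left L (t - INR (S j))) K * 1))
      by (intros; symmetry; apply Rmult_1_r).
    rewrite u; f_equal; apply RInt_eq; intros; apply Rmult_1_r. }
  assert (i2 : RInt (correction L) 0 1 = - / 2 - / L).
  { rewrite (RInt_primitive (fun t => - t ^ 2 / 2 + exp L / (exp L - 1) * exp (- (L * t)) / L)); auto.
    - rewrite Rmult_1_r, Rmult_0_r, Ropp_0, exp_0, exp_Ropp; toR; field; lra.
    - intros t; unfold correction; auto_derive; auto; toR; field; lra. }
  assert (i3 : RInt (coth_right L) 0 T = RInt (coth_left L) 0 T + ((1 - exp (- (L * T))) / L - T)).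
  { rewrite (RInt_eq (coth_right L) (fun t => coth_left L t + (exp (- (L * t)) - 1)))
      by (intros; unfold coth_right, coth_left; ring).
    rewrite RInt_Rplus by (apply ex_RInt_cont; intros; cont).
    f_equal; rewrite (RInt_primitive (fun t => - exp (- (L * t)) / L - t)).
    - rewrite Rmult_0_r, Ropp_0, exp_0; toR; field; lra.
    - intros t; auto_derive; auto; toR; field; lra.
    - intros t; cont. }
  assert (i4 := RInt_Chasles_cont (coth_left L) (- T) 0 T cl).
  rewrite RInt_coth_left in i4 by auto.
  rewrite (RInt_eq (partial_sum L K)
     (fun t => sum_n (fun j => coth_term L j t) K + correction L t)) by reflexivity.
  rewrite RInt_Rplus, i1, i2, i3.
  - replace (RInt (coth_left L) 0 T + ((1 - exp (- (L * T))) / L - T) + RInt (coth_left L) (- T) 0)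
      with ((coth_primitive (exp (L * T)) - coth_primitive (exp (- (L * T)))) / L
            + ((1 - exp (- (L * T))) / L - T)) by (rewrite i4; ring).
    toR; field; lra.
  - apply ex_RInt_cont; intros t.
    apply (continuous_ext (fun t => partial_sum L K t - correction L t)).
    + intros; unfold partial_sum; toR; ring.
    + apply continuous_Rminus; [apply partial_sum_continuous|apply cc].
  - apply ex_RInt_cont; auto.
Qed.

(** The integral unfolds to that of [coth (exp u) - exp (- u)], of which
    [coth_primitive] is the primitive on the scale [exp u]. *)
Lemma RInt_periodic_sum (L : R) : 0 < L ->
  RInt (periodic_sum L) 0 1 = (euler_gamma - ln PI) / L - 1 / 2.
Proof.
  intros hL.
  assert (h1 := RInt_periodic_sum_lim L (fun _ => 1) 1 hL (fun t => continuous_const 1 t)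
                  (fun _ => Req_le _ _ Rabs_R1)).
  rewrite (RInt_eq _ (periodic_sum L)) in h1 by (intros; ring).
  assert (h2 : is_lim_seq (fun K => RInt (fun t => partial_sum L K t * 1) 0 1
                 - ((euler_gamma - ln PI) / L - 1 / 2)) 0).
  { apply is_lim_seq_0_of_bound with (fun K => 11 / L * exp (- (L * INR (S K)))).
    - intros K; rewrite (RInt_eq _ (partial_sum L K)) by (intros; ring).
      rewrite RInt_partial_sum by auto.
      set (T := INR (S K)).
      assert (b1 := coth_primitive_asymptotics _ (exp_pos (L * T))).
      assert (b2 := coth_primitive_bounds _ (Rlt_le _ _ (exp_pos (- (L * T))))).
      rewrite ln_exp in b1; unfold Rdiv in b1; rewrite <- exp_Ropp in b1.
      assert (he := exp_pos (- (L * T))).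
      match goal with |- Rabs ?x <= _ => replace x with
        ((coth_primitive (exp (L * T)) - euler_gamma - (L * T - ln PI)
          - coth_primitive (exp (- (L * T))) - exp (- (L * T))) * / L) by (field; lra) end.
      rewrite Rabs_mult, (Rabs_pos_eq (/ L)) by (apply Rlt_le, Rinv_0_lt_compat; auto).
      replace (11 / L * exp (- (L * T))) with ((11 * exp (- (L * T))) * / L) by (field; lra).
      apply Rmult_le_compat_r; [apply Rlt_le, Rinv_0_lt_compat; auto|].
      apply Rabs_le_between in b1, b2; apply Rabs_le_between; lra.
    - replace (Finite 0) with (Rbar_mult (11 / L) 0) by (simpl; f_equal; ring).
      apply is_lim_seq_scal_l, is_lim_seq_exp_neg_S; auto. }
  assert (h3 := is_lim_seq_minus' _ _ _ _ h1 (is_lim_seq_const ((euler_gamma - ln PI) / L - 1 / 2))).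
  apply is_lim_seq_unique in h2, h3; rewrite h2 in h3; injection h3; lra.
Qed.

(** * The Fourier coefficients *)

(** Two integrations by parts. *)
Lemma RInt_partial_sum_trig (L : R) (K : nat) (E dE ddE : R -> R) :
  (forall t, is_derive E t (dE t)) -> (forall t, is_derive dE t (ddE t)) ->
  (forall t, continuous ddE t) -> E 1 = E 0 -> dE 1 = dE 0 ->
  RInt (fun t => partial_sum L K t * (ddE t - L * dE t)) 0 1
  = (partial_sum L K 1 - partial_sum L K 0) * (dE 0 - L * E 0)
    - (dpartial_sum L K 1 - dpartial_sum L K 0) * E 0
    - L ^ 2 * RInt (fun t => sum_n (fun j => regular_term L j t) K * E t) 0 1
    - L * RInt E 0 1.
Proof.
  intros hE hdE cdd p0 p1.
  set (P := partial_sum L K); set (dP := dpartial_sum L K).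
  set (S := fun t => sum_n (fun j => regular_term L j t) K : R).
  assert (hP : forall t, is_derive P t (dP t)) by (intros; apply is_derive_partial_sum).
  assert (hdP : forall t, is_derive dP t (- L ^ 2 * S t - L - L * dP t))
    by (intros; apply is_derive_dpartial_sum).
  assert (cE : forall t, continuous E t)
    by (intros; apply (ex_derive_continuous E); eexists; apply hE).
  assert (cdE : forall t, continuous dE t)
    by (intros; apply (ex_derive_continuous dE); eexists; apply hdE).
  assert (cP : forall t, continuous P t)
    by (intros; apply (ex_derive_continuous P); eexists; apply hP).
  assert (cr : forall j t, continuous (regular_term L j) t).
  { intros j t; unfold regular_term; apply continuous_Rplus;
      apply (continuous_comp _ regular_weight); try cont; apply regular_weight_continuous. }
  assert (cS : forall t, continuous S t).
  { unfold S; clear -cr; induction K as [|K IH]; intros t.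
    - apply (continuous_ext (regular_term L 0)); [intros; now rewrite sum_O|apply cr].
    - apply (continuous_ext (fun t => sum_n (fun j => regular_term L j t) K + regular_term L (S K) t)).
      + intros; now rewrite sum_SnR.
      + apply continuous_Rplus; [apply IH|apply cr]. }
  assert (h : RInt (fun t => P t * (ddE t - L * dE t) + (L ^ 2 * (S t * E t) + L * E t)) 0 1
     = (P 1 * (dE 1 - L * E 1) - dP 1 * E 1) - (P 0 * (dE 0 - L * E 0) - dP 0 * E 0)).
  { apply (RInt_primitive (fun t => P t * (dE t - L * E t) - dP t * E t)).
    - intros t.
      replace (P t * (ddE t - L * dE t) + (L ^ 2 * (S t * E t) + L * E t))
        with ((dP t * (dE t - L * E t) + P t * (ddE t - L * dE t))
              - ((- L ^ 2 * S t - L - L * dP t) * E t + dP t * dE t)) by ring.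
      apply (is_derive_minus (fun t => P t * (dE t - L * E t)) (fun t => dP t * E t)).
      + apply (is_derive_mult P (fun t => dE t - L * E t)); [apply hP| |apply Rmult_comm].
        apply (is_derive_minus dE (fun t => L * E t)); [apply hdE|].
        apply (is_derive_scal E t L), hE.
      + apply (is_derive_mult dP E); [apply hdP|apply hE|apply Rmult_comm].
    - intros t; cont. }
  rewrite RInt_Rplus, RInt_Rplus, !RInt_Rscal in h
    by (apply ex_RInt_cont; intros; cont).
  rewrite p0, p1 in h; fold P dP.
  change (fun t => sum_n (fun j => regular_term L j t) K * E t) with (fun t => S t * E t).
  lra.
Qed.

Lemma RInt_regular_terms (L : R) (K : nat) (E : R -> R) : 0 < L ->
  (forall t, continuous E t) -> (forall n t, E (t + INR n) = E t) ->
  RInt (fun t => sum_n (fun j => regular_term L j t) K * E t) 0 1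
  = RInt (fun u => regular_weight u * E (u / L)) (- (L * INR (S K))) (L * INR (S K)) / L.
Proof.
  intros hL cE pE.
  assert (cw : forall t, continuous (fun t => regular_weight (L * t)) t).
  { intros t; apply (continuous_comp (fun t => L * t) regular_weight);
      [cont|apply regular_weight_continuous]. }
  assert (u := RInt_unfold (fun t => regular_weight (L * t)) (fun t => regular_weight (L * t))
                 E K cw cw cE pE).
  assert (e1 : RInt (fun t => sum_n (fun j => regular_term L j t) K * E t) 0 1
     = RInt (fun t => regular_weight (L * t) * E t) (- INR (S K)) (INR (S K))).
  { rewrite (RInt_Chasles_cont (fun t => regular_weight (L * t) * E t) (- INR (S K)) 0 (INR (S K)))
      by (intros; apply continuous_Rmult; auto).
    rewrite Rplus_comm; exact u. }
  assert (cf : forall v, continuous (fun v => regular_weight v * E (v / L)) v).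
  { intros v; apply continuous_Rmult; [apply regular_weight_continuous|].
    apply (continuous_comp (fun v => v / L) E); [unfold Rdiv; cont|apply cE]. }
  assert (h := RInt_comp_lin (fun v => regular_weight v * E (v / L)) L 0 (- INR (S K)) (INR (S K))).
  rewrite !Rplus_0_r in h.
  assert (e2 : RInt (fun t => L * (regular_weight (L * t) * E t)) (- INR (S K)) (INR (S K))
     = RInt (fun v => regular_weight v * E (v / L)) (L * - INR (S K)) (L * INR (S K))).
  { rewrite <- h by (apply ex_RInt_cont; auto).
    apply RInt_eq; intros t; unfold scal; simpl; unfold mult; simpl.
    rewrite Rplus_0_r; replace (L * t / L) with t by (field; lra); reflexivity. }
  rewrite RInt_Rscal in e2 by (apply ex_RInt_cont; intros; apply continuous_Rmult; auto).
  rewrite e1; replace (- (L * INR (S K))) with (L * - INR (S K)) by ring.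
  rewrite <- e2; symmetry; apply Rinv_r_simpl_m; lra.
Qed.

(** In the limit the jumps over the period vanish, and the integrals of the
    regular terms unfold to the whole line. *)
Lemma RInt_periodic_sum_trig (L c : R) (E dE ddE : R -> R) : 0 < L ->
  (forall t, is_derive E t (dE t)) -> (forall t, is_derive dE t (ddE t)) ->
  (forall t, continuous ddE t) -> (forall n t, E (t + INR n) = E t) -> dE 1 = dE 0 ->
  RInt E 0 1 = 0 -> (forall t, Rabs (E t) <= 1) -> (forall t, Rabs (ddE t - L * dE t) <= c) ->
  RInt (fun t => periodic_sum L t * (ddE t - L * dE t)) 0 1
  = - L * line_integral (fun u => regular_weight u * E (u / L)).
Proof.
  intros hL hE hdE cdd pE p1 iE bE bw.
  assert (p0 : E 1 = E 0) by (rewrite <- (pE 1%nat 0); f_equal; simpl; ring).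
  assert (cE : forall t, continuous E t)
    by (intros; apply (ex_derive_continuous E); eexists; apply hE).
  assert (cdE : forall t, continuous dE t)
    by (intros; apply (ex_derive_continuous dE); eexists; apply hdE).
  assert (l1 := RInt_periodic_sum_lim L (fun t => ddE t - L * dE t) c hL ltac:(intros; cont) bw).
  assert (cEL : forall u, continuous (fun u => E (u / L)) u).
  { intros u; apply (continuous_comp (fun v => v / L) E); [unfold Rdiv; cont|apply cE]. }
  assert (dec : decays 18432 (fun u => regular_weight u * E (u / L))).
  { destruct (decays1_bounded 18432 _ (fun u => E (u / L)) (regular_weight_decays 0 ltac:(lra)))
      as [c' b']; auto.
    assert (e : forall u, regular_weight u * exp (0 * u) * E (u / L) = regular_weight u * E (u / L)).
    { intros u; rewrite Rmult_0_l, exp_0; ring. }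
    split; intros u.
    - eapply continuous_ext; [exact e|apply c'].
    - rewrite <- e; apply b'. }
  assert (hT : is_lim_seq (fun K => L * INR (S K)) p_infty).
  { apply (is_lim_seq_incr_1 (fun K => L * INR K)).
    assert (h := is_lim_seq_scal_l INR L p_infty is_lim_seq_INR); simpl in h.
    destruct (Rle_dec 0 L); [|lra]; destruct (Rle_lt_or_eq_dec 0 L r); [exact h|lra]. }
  assert (l2 := line_integral_lim _ _ _ _ dec hT hT).
  set (I := line_integral (fun u => regular_weight u * E (u / L))) in *.
  assert (z : forall c0 k, is_lim_seq (fun K => c0 * exp (- (L * INR (S K))) * k) 0).
  { intros c0 k; replace (Finite 0) with (Finite (c0 * 0 * k)) by (f_equal; ring).
    apply (is_lim_seq_scal_r _ k (c0 * 0)), (is_lim_seq_scal_l _ c0 0), is_lim_seq_exp_neg_S; auto. }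
  assert (l3 : is_lim_seq (fun K => RInt (fun t => partial_sum L K t * (ddE t - L * dE t)) 0 1)
                 (0 - 0 - L * I)).
  { apply (is_lim_seq_ext (fun K =>
       (partial_sum L K 1 - partial_sum L K 0) * (dE 0 - L * E 0)
       - (dpartial_sum L K 1 - dpartial_sum L K 0) * E 0
       - L * RInt (fun u => regular_weight u * E (u / L)) (- (L * INR (S K))) (L * INR (S K)))).
    - intros K; rewrite (RInt_partial_sum_trig L K E dE ddE) by auto.
      rewrite RInt_regular_terms, iE by auto; toR; field; lra.
    - apply is_lim_seq_minus'; [apply is_lim_seq_minus'|].
      + apply is_lim_seq_0_of_bound with
          (fun K => 2 * exp (- (L * INR (S K))) * Rabs (dE 0 - L * E 0)); [|apply z].
        intros K; rewrite Rabs_mult; apply Rmult_le_compat_r; [apply Rabs_pos|].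
        apply partial_sum_jump; auto.
      + apply is_lim_seq_0_of_bound with
          (fun K => 2 * L * exp (- (L * INR (S K))) * Rabs (E 0)); [|apply z].
        intros K; rewrite Rabs_mult; apply Rmult_le_compat_r; [apply Rabs_pos|].
        apply dpartial_sum_jump; auto.
      + apply (is_lim_seq_scal_l _ L I), l2. }
  apply is_lim_seq_unique in l1, l3; rewrite l1 in l3; injection l3; lra.
Qed.

(** * Identification of the Fourier coefficients *)

Lemma periodic_sum_fourier_coefficients (L y : R) (n : nat) : 0 < L ->
  y = INR (S n) * (2 * PI) / L ->
  let Ic := RInt (fun t => periodic_sum L t * cos (INR (S n) * (2 * PI) * t)) 0 1 in
  let Is := RInt (fun t => periodic_sum L t * sin (INR (S n) * (2 * PI) * t)) 0 1 in
  L * (y ^ 2 * Ic - y * Is) = fst (laplace regular_weight (0, y)) /\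
  L * (y ^ 2 * Is + y * Ic) = snd (laplace regular_weight (0, y)).
Proof.
  intros hL hy; cbv zeta; set (w := INR (S n) * (2 * PI)) in *.
  assert (hw : w = L * y) by (rewrite hy; field; lra).
  assert (per : forall m t, w * (t + INR m) = w * t + 2 * INR (S n * m) * PI).
  { intros m t; unfold w; rewrite mult_INR; ring. }
  assert (cQ : forall t, 0 <= t <= 1 -> continuous (periodic_sum L) t)
    by (intros; apply periodic_sum_continuous; auto).
  assert (bt : forall p q r s, Rabs r <= 1 -> Rabs s <= 1 -> Rabs (p * r + q * s) <= Rabs p + Rabs q).
  { intros p q r s hr hs; eapply Rle_trans; [apply Rabs_triang|].
    rewrite !Rabs_mult; assert (h1 := Rabs_pos p); assert (h2 := Rabs_pos q).
    apply Rplus_le_compat; rewrite <- Rmult_1_r; apply Rmult_le_compat_l; auto. }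
  assert (exc : ex_RInt (fun t => periodic_sum L t * cos (w * t)) 0 1).
  { apply ex_RInt_segment; [lra|]; intros; apply continuous_Rmult; [auto|cont]. }
  assert (exs : ex_RInt (fun t => periodic_sum L t * sin (w * t)) 0 1).
  { apply ex_RInt_segment; [lra|]; intros; apply continuous_Rmult; [auto|cont]. }
  assert (hc := RInt_periodic_sum_trig L (Rabs (- w ^ 2) + Rabs (L * w))
     (fun t => cos (w * t)) (fun t => - w * sin (w * t)) (fun t => - w ^ 2 * cos (w * t)) hL).
  assert (hs := RInt_periodic_sum_trig L (Rabs (- w ^ 2) + Rabs (- (L * w)))
     (fun t => sin (w * t)) (fun t => w * cos (w * t)) (fun t => - w ^ 2 * sin (w * t)) hL).
  assert (fc := RInt_cos_period n); assert (fs := RInt_sin_period n); fold w in fc, fs.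
  assert (sw : sin w = 0) by apply sin_2nat_PI.
  assert (cw : cos w = 1) by apply cos_2nat_PI.
  assert (ec : RInt (fun t => periodic_sum L t * (- w ^ 2 * cos (w * t) - L * (- w * sin (w * t)))) 0 1
     = - L * line_integral (fun u => regular_weight u * cos (w * (u / L)))).
  { apply hc; auto.
    - intros t; auto_derive; auto; toR; ring.
    - intros t; auto_derive; auto; toR; ring.
    - intros t; cont.
    - intros m t; rewrite per, cos_period; reflexivity.
    - rewrite Rmult_1_r, Rmult_0_r, sin_0, sw; reflexivity.
    - intros t; apply Rabs_cos_le_1.
    - intros t; replace (- w ^ 2 * cos (w * t) - L * (- w * sin (w * t)))
        with (- w ^ 2 * cos (w * t) + L * w * sin (w * t)) by ring.
      apply bt; [apply Rabs_cos_le_1|apply Rabs_sin_le_1]. }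
  assert (es : RInt (fun t => periodic_sum L t * (- w ^ 2 * sin (w * t) - L * (w * cos (w * t)))) 0 1
     = - L * line_integral (fun u => regular_weight u * sin (w * (u / L)))).
  { apply hs; auto.
    - intros t; auto_derive; auto; toR; ring.
    - intros t; auto_derive; auto; toR; ring.
    - intros t; cont.
    - intros m t; rewrite per, sin_period; reflexivity.
    - rewrite Rmult_1_r, Rmult_0_r, cos_0, cw; reflexivity.
    - intros t; apply Rabs_sin_le_1.
    - intros t; replace (- w ^ 2 * sin (w * t) - L * (w * cos (w * t)))
        with (- w ^ 2 * sin (w * t) + - (L * w) * cos (w * t)) by ring.
      apply bt; [apply Rabs_sin_le_1|apply Rabs_cos_le_1]. }
  rewrite (RInt_eq _ (fun t => - w ^ 2 * (periodic_sum L t * cos (w * t))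
             - - (L * w) * (periodic_sum L t * sin (w * t)))) in ec by (intros; ring).
  rewrite (RInt_eq _ (fun t => - w ^ 2 * (periodic_sum L t * sin (w * t))
             - L * w * (periodic_sum L t * cos (w * t)))) in es by (intros; ring).
  rewrite RInt_Rminus, !RInt_Rscal in ec by (auto; apply (ex_RInt_scal (V := R_NormedModule)); auto).
  rewrite RInt_Rminus, !RInt_Rscal in es by (auto; apply (ex_RInt_scal (V := R_NormedModule)); auto).
  set (Ic := RInt (fun t => periodic_sum L t * cos (w * t)) 0 1) in *.
  set (Is := RInt (fun t => periodic_sum L t * sin (w * t)) 0 1) in *.
  unfold laplace; simpl fst; simpl snd.
  rewrite (line_integral_ext (fun u => regular_weight u * exp (0 * u) * cos (y * u))
             (fun u => regular_weight u * cos (w * (u / L)))).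
  2:{ intros u; rewrite Rmult_0_l, exp_0, Rmult_1_r, hw; do 2 f_equal; field; lra. }
  rewrite (line_integral_ext (fun u => regular_weight u * exp (0 * u) * sin (y * u))
             (fun u => regular_weight u * sin (w * (u / L)))).
  2:{ intros u; rewrite Rmult_0_l, exp_0, Rmult_1_r, hw; do 2 f_equal; field; lra. }
  set (N1 := line_integral (fun u => regular_weight u * cos (w * (u / L)))) in *.
  set (N2 := line_integral (fun u => regular_weight u * sin (w * (u / L)))) in *.
  rewrite hw in ec, es.
  split; apply (Rmult_eq_reg_l (- L)); lra.
Qed.

(** Both sides, multiplied by [s (s - 1)], which is not [0] at [s = i y], give the same
    multiple of the transform of [regular_weight]. *)
Lemma zeta_Gamma_term_fourier (zeta : C -> C) (L y : R) (n : nat) :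
  is_Riemann_zeta zeta -> 0 < L -> y = INR (S n) * (2 * PI) / L ->
  (zeta (0, y) * Gamma (0, y) * cpower 2 (- (0, y)))%C
  = (L / 2 * RInt (fun t => periodic_sum L t * cos (INR (S n) * (2 * PI) * t)) 0 1,
     L / 2 * RInt (fun t => periodic_sum L t * sin (INR (S n) * (2 * PI) * t)) 0 1).
Proof.
  intros hz hL hy.
  assert (hn : 0 < INR (S n)) by (apply lt_0_INR; lia); assert (hp := PI_RGT_0).
  assert (y0 : 0 < y) by (rewrite hy; apply Rdiv_lt_0_compat; [nra|auto]).
  destruct (periodic_sum_fourier_coefficients L y n hL hy) as [e1 e2].
  assert (e := zeta_Gamma_term zeta y hz ltac:(lra)).
  set (Ic := RInt (fun t => periodic_sum L t * cos (INR (S n) * (2 * PI) * t)) 0 1 : R) in *.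
  set (Is := RInt (fun t => periodic_sum L t * sin (INR (S n) * (2 * PI) * t)) 0 1 : R) in *.
  destruct (zeta (0, y) * Gamma (0, y) * cpower 2 (- (0, y)))%C as [t1 t2].
  destruct (laplace regular_weight (0, y)) as [n1 n2]; simpl fst in e1; simpl snd in e2.
  unfold Cmult, Cminus, Cplus, Copp, RtoC in e; simpl in e; injection e as e3 e4.
  set (d1 := 2 * t1 - L * Ic); set (d2 := 2 * t2 - L * Is).
  assert (h1 : y * (- y * d1 + d2) = 0) by (unfold d1, d2; nra).
  assert (h2 : y * (- y * d2 - d1) = 0) by (unfold d1, d2; nra).
  apply Rmult_integral in h1, h2; destruct h1 as [h1|h1]; [lra|]; destruct h2 as [h2|h2]; [lra|].
  assert (k2 : d2 = y * d1) by lra.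
  assert (k1 : d1 * (1 + y * y) = 0) by (rewrite k2 in h2; lra).
  apply Rmult_integral in k1; destruct k1 as [k1|k1]; [|nra].
  rewrite k1, Rmult_0_r in k2; unfold d1, d2 in k1, k2.
  f_equal; lra.
Qed.

Theorem mainTheorem3 :
  forall zeta : C -> C, is_Riemann_zeta zeta ->
  forall a : R, 1 < a ->
  let s := fun k : nat => (2 * Ci * RtoC PI * RtoC (INR k) / RtoC (ln a))%C in
  exists (S1 S2 : R) (S3 : C),
    is_series (fun n : nat => exp (- a ^ n) / sinh (a ^ n)) S1 /\
    is_series (fun n : nat => a ^ (S n) - coth (/ a ^ (S n))) S2 /\
    @is_series C_AbsRing C_NormedModule
      (fun n : nat =>
         (zeta (s (S n)) * Gamma (s (S n)) * cpower 2 (- s (S n)))%C) S3 /\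
    S1 = - (ln PI / ln a) - 1 / 2 + a / (a - 1) + euler_gamma / ln a
         + S2 + 4 / ln a * Re S3.
Proof.
  intros zeta hz a ha s.
  set (L := ln a).
  assert (hL : 0 < L) by (unfold L; rewrite <- ln_1; apply ln_increasing; lra).
  assert (eL : exp L = a) by (unfold L; apply exp_ln; lra).
  assert (ea : forall n, exp (L * INR n) = a ^ n).
  { intros n; rewrite Rmult_comm, exp_mult_nat, eL; reflexivity. }
  assert (es : forall n, s (S n) = (0, INR (S n) * (2 * PI) / L)).
  { intros n; unfold s; fold L.
    replace (RtoC (INR (S n)) / RtoC L)%C with (RtoC (INR (S n) / L)) by (apply RtoC_div; lra).
    unfold Cdiv; rewrite <- RtoC_inv by lra.
    apply injective_projections; simpl; field; lra. }
  set (Q := periodic_sum L).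
  assert (term : forall n, (zeta (s (S n)) * Gamma (s (S n)) * cpower 2 (- s (S n)))%C
    = (L / 2 * RInt (fun t => Q t * cos (INR (S n) * (2 * PI) * t)) 0 1,
       L / 2 * RInt (fun t => Q t * sin (INR (S n) * (2 * PI) * t)) 0 1)).
  { intros n; rewrite (es n); apply zeta_Gamma_term_fourier; auto. }
  destruct (periodic_sum_ex_derive L 0 hL ltac:(lra)) as [d0 hd0].
  destruct (periodic_sum_ex_derive L 1 hL ltac:(lra)) as [d1 hd1].
  destruct (fourier_series_at_0 Q d0 d1
    (fun t ht => periodic_sum_continuous L t hL ht) (periodic_sum_periodic L hL) hd0 hd1)
    as [hcos [Ssin hsin]].
  unfold Q in hcos at 3; rewrite RInt_periodic_sum in hcos by auto.
  assert (pos : forall n, 0 < INR (S n)) by (intros; apply lt_0_INR; lia).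
  assert (ex1 : exists T : R, is_series (fun n => coth_right L (0 + INR n)) T).
  { apply (ex_series_inv_sqr _ (4 * exp L / L ^ 2)); intros n.
    eapply Rle_trans; [apply coth_right_bound|].
    replace (- (L * (0 + INR n))) with (L + - (L * INR (S n))) by (rewrite S_INR; ring).
    rewrite exp_plus.
    replace (4 * exp L / L ^ 2 / INR (S n) ^ 2) with (exp L * (4 / L ^ 2 / INR (S n) ^ 2))
      by (specialize (pos n); field; lra).
    apply Rmult_le_compat_l; [apply Rlt_le, exp_pos|apply exp_neg_le_inv_sqr; auto]. }
  assert (ex2 : exists T : R, is_series (fun n => coth_left L (0 - INR (S n))) T).
  { apply (ex_series_inv_sqr _ (4 / L ^ 2)); intros n.
    eapply Rle_trans; [apply coth_left_bound|].
    replace (L * (0 - INR (S n))) with (- (L * INR (S n))) by ring.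
    apply exp_neg_le_inv_sqr; auto. }
  destruct ex1 as [T1 h1]; destruct ex2 as [T2 h2].
  assert (Q0 : Q 0 = T1 + T2 - a / (a - 1)).
  { unfold Q, periodic_sum, correction.
    rewrite Rmult_0_r, Ropp_0, exp_0, eL.
    assert (e : Series (fun j => coth_term L j 0) = T1 + T2)
      by (apply is_series_unique; exact (is_series_plus _ _ _ _ h1 h2)).
    rewrite e; field; lra. }
  exists T1, (- T2), (L / 4 * (Q 0 - ((euler_gamma - ln PI) / L - 1 / 2)), L / 2 * Ssin).
  split; [|split; [|split]].
  - revert h1; apply is_series_ext; intros n.
    rewrite Rplus_0_l; unfold coth_right; rewrite ea; apply coth_sub_1, pow_lt; lra.
  - apply is_series_opp in h2; revert h2; apply is_series_ext; intros n.
    unfold coth_left; replace (L * (0 - INR (S n))) with (- (L * INR (S n))) by ring.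
    rewrite Ropp_involutive, exp_Ropp, ea; unfold opp; simpl; ring.
  - apply is_series_C; split.
    + apply (is_series_scal (L / 4)) in hcos; revert hcos; apply is_series_ext; intros n.
      rewrite term.
      change (L / 4 * (2 * RInt (fun t => Q t * cos (INR (S n) * (2 * PI) * t)) 0 1)
        = L / 2 * RInt (fun t => Q t * cos (INR (S n) * (2 * PI) * t)) 0 1); field.
    + apply (is_series_scal (L / 2)) in hsin; revert hsin; apply is_series_ext; intros n.
      rewrite term; reflexivity.
  - unfold Re; simpl fst; rewrite Q0; field; lra.
Qed.
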